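(* Let $d_1\in\{1,2,3,4\}$. For each integer $d_2\ge 5$, let $X_{d_1,d_2}$ be a random variable having the $F$-distribution with numerator degrees of freedom $d_1$ and denominator degrees of freedom $d_2$. Let $Z$ be a standard normal random variable and let $\Gamma_{d_1}$ be a $\chi^2$-random variable with $d_1$ degrees of freedom. Then for every integer $d_2\ge 5$, $$P\left\{|X_{d_1,d_2}-E[X_{d_1,d_2}]|\le \sqrt{\mathrm{Var}(X_{d_1,d_2})}\right\}>P\{|Z|\le 1\}\approx 0.6827,$$ and $$\inf_{d_2\in\mathbb{N},\, d_2\ge 5}P\left\{|X_{d_1,d_2}-E[X_{d_1,d_2}]|\le \sqrt{\mathrm{Var}(X_{d_1,d_2})}\right\}=P\left\{|\Gamma_{d_1}-E[\Gamma_{d_1}]|\le \sqrt{\mathrm{Var}(\Gamma_{d_1})}\right\}.$$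
   Context: The $F$-distribution with parameters $d_1,d_2\in\mathbb{N}$ (numerator and denominator degrees of freedom) is the law of $\frac{\Gamma_{d_1}/d_1}{\Gamma_{d_2}/d_2}$, where $\Gamma_{d_1}$ and $\Gamma_{d_2}$ are independent $\chi^2$-random variables with $d_1$ and $d_2$ degrees of freedom respectively. Equivalently, for $x>0$, $$P\{X_{d_1,d_2}\le x\}=I_{\frac{d_1x}{d_1x+d_2}}\left(\tfrac{d_1}{2},\tfrac{d_2}{2}\right),\qquad I_z(a,b)=\frac{\int_0^z t^{a-1}(1-t)^{b-1}\,dt}{B(a,b)},$$ where $B(a,b)=\int_0^1 t^{a-1}(1-t)^{b-1}\,dt$ is the beta function. The variance is finite only if $d_2>4$, and for $d_2\ge 5$, $$E[X_{d_1,d_2}]=\frac{d_2}{d_2-2},\qquad \mathrm{Var}(X_{d_1,d_2})=\frac{2d_2^2(d_1+d_2-2)}{d_1(d_2-2)^2(d_2-4)}.$$ The symbol ''$\approx 0.6827$'' only indicates the numerical value of $P\{|Z|\le 1\}$. *)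

(* Defs.v *)
From HB Require Import structures.
From mathcomp Require Import all_boot all_order all_algebra.
From mathcomp Require Import all_classical all_reals all_analysis.
From mathcomp Require Import measurable_realfun.
From mathcomp Require Import ring lra.

Set Implicit Arguments.
Unset Strict Implicit.
Unset Printing Implicit Defensive.

Import Order.TTheory GRing.Theory Num.Theory.
Import numFieldNormedType.Exports.

Local Open Scope classical_set_scope.
Local Open Scope ring_scope.

Section gamma_function.
Context {R : realType}.
Implicit Types a x : R.
Local Notation mu := (@lebesgue_measure R).

Definition gamma_integrand a x : R := x `^ (a - 1) * expR (- x).

Definition gamma_fun a : R :=
  fine (\int[mu]_(x in `]0%R, +oo[) (gamma_integrand a x)%:E)%E.

Lemma gamma_integrand_ge0 a x : 0 <= gamma_integrand a x.
Proof. by rewrite mulr_ge0 ?powR_ge0 ?expR_ge0. Qed.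

Lemma measurable_gamma_integrand a : measurable_fun setT (gamma_integrand a).
Proof.
apply: measurable_funM; first exact: measurable_powR.
exact: measurableT_comp.
Qed.

Let majorant a x : R := x `^ (a - 1) / (1 + x `^ a) ^+ 2.

Let gamma_integrand_le a : 0 < a -> exists C : R, 0 < C /\
  forall x, 0 < x -> gamma_integrand a x <= C * majorant a x.
Proof.
move=> a0; pose N := (Num.truncn a).+1.
have aN : a <= N%:R by apply: ltW; exact: truncnS_gt.
exists (8 + 2 * (N.*2)`!%:R).
split; first by rewrite ltr_wpDr// mulr_ge0.
move=> x x0.
have xa0 : 0 < x `^ a by exact: powR_gt0.
have xN0 : 0 <= x ^+ N by rewrite exprn_ge0// ltW.
have e0 : 0 < expR x := expR_gt0 x.
have f0 : 0 < (N.*2)`!%:R :> R by rewrite ltr0n fact_gt0.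
have xaN : x `^ a <= 1 + x ^+ N.
  have [x1|x1] := leP x 1.
    have : x `^ a <= 1 `^ a by apply: ge0_ler_powR; rewrite ?nnegrE// ltW.
    by rewrite powR1 => /le_trans; apply; rewrite lerDl.
  rewrite -(powR_mulrn N (ltW x0)).
  have : x `^ a <= x `^ N%:R by apply: ler_powR => //; exact: ltW.
  by move=> /le_trans; apply; rewrite lerDr.
have eN : x ^+ N.*2 <= (N.*2)`!%:R * expR x.
  have := @expR_ge1Dxn _ x (N.*2).-1 (ltW x0); rewrite prednK ?double_gt0// => h.
  by rewrite -ler_pdivrMl// mulrC; apply: le_trans h; rewrite lerDr.
have e1 : 1 <= expR x by rewrite -expR0 ler_expR ltW.
have sq : (1 + x `^ a) ^+ 2 <= (8 + 2 * (N.*2)`!%:R) * expR x.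
  have /le_trans -> // : (1 + x `^ a) ^+ 2 <= (2 + x ^+ N) ^+ 2.
    by rewrite ler_pXn2r ?nnegrE//; lra.
  have zE : x ^+ N * x ^+ N = x ^+ N.*2 by rewrite -exprD addnn.
  have : 0 <= (x ^+ N - 2) ^+ 2 := sqr_ge0 _.
  by rewrite !expr2; nra.
rewrite /gamma_integrand /majorant expRN mulrCA ler_wpM2l ?powR_ge0//.
rewrite ler_pdivlMr; first by rewrite ler_pdivrMl// mulrC.
by rewrite exprn_gt0// addr_gt0.
Qed.

Let primitive a x : R := - (a^-1 * (1 + x `^ a)^-1).

Let is_derive_primitive a x : 0 < a -> 0 < x ->
  is_derive x 1 (primitive a) (majorant a x).
Proof.
move=> a0 x0.
have p0 : 1 + x `^ a != 0 by rewrite gt_eqF// ltr_pwDl// powR_ge0.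
have d1 : is_derive x 1 (fun y => 1 + y `^ a) (a * x `^ (a - 1)).
  have -> : a * x `^ (a - 1) = 0 + a * x `^ (a - 1) by rewrite add0r.
  have c : is_derive x (1 : R) (cst 1 : R -> R) 0 by exact: is_derive_cst.
  exact: (is_deriveD c (is_derive1_powR a x0)).
have d2 := @is_deriveV _ (fun y => 1 + y `^ a) x _ 1 p0 d1.
have d3 := @is_deriveZ _ _ _ (fun y => (1 + y `^ a)^-1) a^-1 _ _ _ d2.
have d4 := @is_deriveN _ _ _ _ _ _ _ d3.
apply: (is_derive_eq d4).
rewrite /majorant -!mulNr /GRing.scale/=; field.
by rewrite p0 gt_eqF.
Qed.

Let gamma_integral_cc_le a C (p q : R) : 0 < a -> 0 < p -> p < q -> 0 < C ->
  (forall x, 0 < x -> gamma_integrand a x <= C * majorant a x) ->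
  (\int[mu]_(x in `[p, q]) (gamma_integrand a x)%:E <= (C / a)%:E)%E.
Proof.
move=> a0 p0 pq C0 gC.
have pos x : x \in `[p, q] -> 0 < x.
  by rewrite in_itv/= => /andP[px _]; exact: lt_le_trans px.
have cH x : 0 < x -> {for x, continuous (primitive a)}.
  move=> x0; apply: differentiable_continuous; apply/derivable1_diffP.
  by have [] := is_derive_primitive a0 x0.
have cpow b x : 0 < x -> {for x, continuous (@powR R ^~ b)}.
  move=> x0; apply: differentiable_continuous; apply/derivable1_diffP.
  by apply: derivable_powR; rewrite in_itv/= x0.
have cm : {within `[p, q], continuous (majorant a)}.
  apply/continuous_in_subspaceT => x; rewrite inE => /pos x0.
  apply: cvgM; first exact: cpow.
  apply: cvgV; first by rewrite expf_neq0// gt_eqF// ltr_pwDl// powR_ge0.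
  by rewrite expr2; apply: cvgM; apply: cvgD; first [exact: cvg_cst|exact: cpow].
have mm : measurable_fun `[p, q] (majorant a).
  exact: subspace_continuous_measurable_fun.
have m0 x : 0 <= majorant a x by rewrite divr_ge0 ?powR_ge0 ?sqr_ge0.
apply: (@le_trans _ _ (\int[mu]_(x in `[p, q]) (C%:E * (majorant a x)%:E))%E).
  apply: ge0_le_integral => //=.
  - by move=> x _; rewrite lee_fin gamma_integrand_ge0.
  - apply/measurable_EFinP/measurable_funTS; exact: measurable_gamma_integrand.
  - apply: measurable_funeM; exact/measurable_EFinP.
  - by move=> x /pos /gC; rewrite lee_fin.
rewrite ge0_integralZl//=; last 3 first.
- by exact/measurable_EFinP.
- by move=> x _; rewrite lee_fin.
- by rewrite lee_fin ltW.
rewrite (@continuous_FTC2 _ (majorant a) (primitive a))//; last 2 first.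
- split.
  + move=> x xpq; have x0 := pos _ (subset_itv_oo_cc xpq).
    by have [] := is_derive_primitive a0 x0.
  + by apply: cvg_at_right_filter; exact: cH.
  + by apply: cvg_at_left_filter; apply: cH; exact: lt_trans pq.
- move=> x xpq; have x0 := pos _ (subset_itv_oo_cc xpq).
  by rewrite derive1E; have [_ ->] := is_derive_primitive a0 x0.
rewrite -EFinB -EFinM lee_fin /primitive ler_pM2l// opprK addrC.
rewrite -[leRHS]addr0 lerD// ?oppr_le0; last first.
  by rewrite mulr_ge0 ?invr_ge0 ?(ltW a0)// addr_ge0// powR_ge0.
rewrite ger_pMr ?invr_gt0// invf_le1 ?ltr_pwDl ?powR_ge0//.
by rewrite lerDl powR_ge0.
Qed.

Lemma gamma_integral_lty a : 0 < a ->
  (\int[mu]_(x in `]0%R, +oo[) (gamma_integrand a x)%:E < +oo)%E.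
Proof.
move=> a0; have [C [C0 gC]] := gamma_integrand_le a0.
pose B n : set R := `[(n.+1%:R)^-1, n.+1%:R]%classic.
pose g n : R -> \bar R := (EFin \o gamma_integrand a) \_ (B n).
have mg n : measurable_fun setT (g n).
  apply/(measurable_restrictT _ _).1; first exact: measurable_itv.
  apply/measurable_EFinP; apply: measurable_funTS.
  exact: measurable_gamma_integrand.
have g0 n x : (0 <= g n x)%E.
  by apply: erestrict_ge0 => y _; rewrite lee_fin gamma_integrand_ge0.
have BS n m x : (n <= m)%N -> B n x -> B m x.
  rewrite /B/= !in_itv/= => nm /andP[nx xn]; apply/andP; split.
    by apply: le_trans nx; rewrite lef_pV2 ?posrE// ler_nat.
  by apply: (le_trans xn); rewrite ler_nat.
have gx x : 0 < x -> \forall n \near \oo, B n x.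
  move=> x0; near=> n; rewrite /B/= in_itv/=; apply/andP; split.
    by apply: ltW; near: n; exact: (near_infty_natSinv_lt (PosNum x0)).
  apply: (@le_trans _ _ n%:R); last by rewrite ler_nat.
  by apply: ltW; near: n; exact: nbhs_infty_gtr.
have gE x : `]0%R, +oo[%classic x ->
    limn (g ^~ x) = (gamma_integrand a x)%:E.
  rewrite /= in_itv/= andbT => x0; apply/cvg_lim => //.
  apply: cvg_near_cst; near=> n.
  by rewrite /g patchE mem_set//; near: n; exact: gx.
have -> : (\int[mu]_(x in `]0%R, +oo[) (gamma_integrand a x)%:E =
          \int[mu]_(x in `]0%R, +oo[) limn (g ^~ x))%E.
  by apply: eq_integral => x; rewrite inE => /gE ->.
rewrite monotone_convergence//; last first.
  move=> x _ n m nm; rewrite /g !patchE; case: ifPn => [|_]; last first.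
    by case: ifPn => // _; rewrite lee_fin gamma_integrand_ge0.
  by rewrite inE => /(BS _ _ _ nm) xB; rewrite mem_set.
  by move=> n; apply: measurable_funTS; exact: mg.
apply: (@le_lt_trans _ _ (C / a)%:E); last exact: ltry.
apply: lime_le.
  apply: ereal_nondecreasing_is_cvgn => n m nm; apply: ge0_le_integral => //.
  - by apply: measurable_funTS; exact: mg.
  - by apply: measurable_funTS; exact: mg.
  - move=> x _; rewrite /g !patchE; case: ifPn => [|_]; last first.
      by case: ifPn => // _; rewrite lee_fin gamma_integrand_ge0.
    by rewrite inE => /(BS _ _ _ nm) xB; rewrite mem_set.
near=> n.
have n0 : (0 < n)%N by near: n; exact: nbhs_infty_gt.
rewrite -integral_mkcondr setIidr; last first.
  move=> x; rewrite /B/= !in_itv/= andbT => /andP[+ _].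
  by apply: lt_le_trans; rewrite invr_gt0.
apply: gamma_integral_cc_le => //.
by apply: (@lt_trans _ _ 1); rewrite ?invf_lt1// ltr1n ltnS.
Unshelve. all: by end_near. Qed.

Lemma gamma_fun_gt0 a : 0 < a -> 0 < gamma_fun a.
Proof.
move=> a0; apply: fine_gt0; rewrite gamma_integral_lty// andbT.
have mG (D : set R) : measurable D ->
    measurable_fun D (EFin \o gamma_integrand a).
  by move=> mD; apply/measurable_EFinP; apply: measurable_funTS;
    exact: measurable_gamma_integrand.
apply: (@lt_le_trans _ _ (\int[mu]_(x in `[1%R, 2%R]) (expR (- 2) / 2)%:E)%E).
  rewrite integral_cst//= lebesgue_measure_itv/= lte_fin ltr1n/= -EFinB -EFinM.
  by rewrite lte_fin !mulr_gt0 ?expR_gt0 ?invr_gt0//; lra.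
apply: (@le_trans _ _ (\int[mu]_(x in `[1%R, 2%R]) (gamma_integrand a x)%:E)%E).
  apply: ge0_le_integral => //.
  - by apply: mG; exact: measurable_itv.
  - move=> x; rewrite /= in_itv/= => /andP[x1 x2]; rewrite lee_fin mulrC.
    have x0 : 0 < x by exact: lt_le_trans x1.
    apply: ler_pM; rewrite ?expR_ge0 ?invr_ge0// ?ler_expR ?lerN2//.
    apply: (@le_trans _ _ (x `^ (-1))); last first.
      by apply: ler_powR => //; rewrite lerBrDr addNr ltW.
    by rewrite (powR_inv1 (ltW x0)) lef_pV2 ?posrE.
apply: ge0_subset_integral => //=.
- by apply: mG; exact: measurable_itv.
- by move=> x _; rewrite lee_fin gamma_integrand_ge0.
- by move=> x; rewrite /= !in_itv/= andbT => /andP[+ _]; exact: lt_le_trans.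
Qed.

Lemma gamma_funE a : 0 < a ->
  (\int[mu]_(x in `]0%R, +oo[) (gamma_integrand a x)%:E = (gamma_fun a)%:E)%E.
Proof.
move=> a0; rewrite fineK// ge0_fin_numE ?gamma_integral_lty//.
by apply: integral_ge0 => x _; rewrite lee_fin gamma_integrand_ge0.
Qed.

Let lebesgue_measure_half (A : set R) : measurable A ->
  (mu A = (2^-1)%:E *
    pushforward mu ( *%R 2^-1 : R -> measurableTypeR R) A)%E.
Proof.
have mh : measurable_fun [set: measurableTypeR R]
    ( *%R 2^-1 : measurableTypeR R -> measurableTypeR R).
  exact: measurable_funM.
pose nu := @measure_function_pushforward__canonical__measure_function_Measure
  _ _ _ _ _ (mu : measure _ _) _ mh.
have h0 : 0 <= 2^-1 :> R by rewrite invr_ge0.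
move=> mA; apply: (@lebesgue_measure_unique R (mscale (NngNum h0) nu)) => //= _ [[b c]] _ <-.
rewrite /mscale/= /pushforward.
have -> : *%R 2^-1 @^-1` `]b, c] = `](2 * b), (2 * c)]%classic.
  by apply/seteqP; split => x /=; rewrite !in_itv/= => /andP[? ?];
    apply/andP; split; lra.
rewrite !lebesgue_measure_itv/= !lte_fin ltr_pM2l//.
case: ifPn => _; last by rewrite mule0.
by rewrite -!EFinB -EFinM; congr EFin; field.
Qed.

Lemma gamma_integral_half a : 0 < a ->
  (\int[mu]_(x in `]0%R, +oo[) (x `^ (a - 1) * expR (- x / 2))%:E =
   (2 `^ a * gamma_fun a)%:E)%E.
Proof.
move=> a0; have h0 : 0 <= 2^-1 :> R by rewrite invr_ge0.
have mh : measurable_fun [set: measurableTypeR R]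
    ( *%R 2^-1 : measurableTypeR R -> measurableTypeR R).
  exact: measurable_funM.
pose nu := @measure_function_pushforward__canonical__measure_function_Measure
  _ _ _ _ _ (mu : measure _ _) _ mh.
have mG : measurable_fun (`]0, +oo[%classic : set R) (EFin \o gamma_integrand a).
  apply/measurable_EFinP; apply: measurable_funTS.
  exact: measurable_gamma_integrand.
have G0 (x : R) : `]0, +oo[%classic x -> (0 <= (EFin \o gamma_integrand a) x)%E.
  by move=> _; rewrite lee_fin gamma_integrand_ge0.
rewrite EFinM -gamma_funE//.
rewrite [X in (_ * X)%E](@eq_measure_integral _ _ _ _ (mscale (NngNum h0) nu) mu); last first.
  by move=> A mA _; exact: lebesgue_measure_half.
rewrite ge0_integral_mscale//=.
have -> : (\int[nu]_(x in `]0%R, +oo[) (gamma_integrand a x)%:E =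
    \int[mu]_(x in *%R 2^-1 @^-1` `]0%R, +oo[)
      (gamma_integrand a (2^-1 * x))%:E)%E.
  have E := @ge0_integral_pushforward _ _ _ _ R _ mh mu _ _ (measurable_itv _) mG.
  by apply: E => x; rewrite inE; exact: G0.
have -> : *%R 2^-1 @^-1` `]0, +oo[ = `]0%R, +oo[%classic :> set R.
  by apply/seteqP; split => x /=; rewrite !in_itv/= !andbT; lra.
rewrite muleA -EFinM -ge0_integralZl//=; last 2 first.
- apply/measurable_EFinP; apply: measurable_funTS.
  exact: (measurableT_comp (measurable_gamma_integrand a) mh).
- by move=> x _; rewrite lee_fin gamma_integrand_ge0.
apply: eq_integral => x; rewrite inE/= in_itv/= andbT => x0.
have E1 : 2 `^ a / 2 = 2 `^ (a - 1) :> R.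
  by rewrite powRB ?powRr1//; apply/implyP.
have E2 : 2^-1 `^ (a - 1) = (2 `^ (a - 1))^-1 :> R.
  by rewrite -powR_inv1// -powRrM mulN1r powRN.
rewrite -EFinM E1 /gamma_integrand powRM ?invr_ge0//; last exact: ltW.
rewrite E2 !mulrA divff ?mul1r ?gt_eqF ?powR_gt0//.
by congr (_ * expR _)%:E; rewrite mulNr mulrC.
Qed.

End gamma_function.

Section chi_square.
Context {R : realType}.
Local Notation mu := (@lebesgue_measure R).

Definition chi2_pdf (k : nat) (x : R) : R :=
  if 0 < x then
    x `^ (k%:R / 2 - 1) * expR (- x / 2) / (2 `^ (k%:R / 2) * gamma_fun (k%:R / 2 : R))
  else 0.

(* With zero degrees of freedom the convention is the Dirac mass at 0. *)
Definition chi2_prob (k : nat) : set R -> \bar R :=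
  if k is 0%N then \d_(0 : R)
  else fun A => (\int[mu]_(x in A) (chi2_pdf k x)%:E)%E.

Lemma chi2_pdf_ge0 k x : 0 <= chi2_pdf k x.
Proof.
rewrite /chi2_pdf; case: ifPn => // _.
rewrite divr_ge0// mulr_ge0 ?powR_ge0 ?expR_ge0//.
by apply: fine_ge0; apply: integral_ge0 => y _; rewrite lee_fin gamma_integrand_ge0.
Qed.

Lemma measurable_chi2_pdf k : measurable_fun setT (chi2_pdf k).
Proof.
apply: measurable_fun_ifT => //.
  exact: measurable_fun_ltr.
apply: measurable_funM => //; apply: measurable_funM; first exact: measurable_powR.
by apply: measurableT_comp => //; apply: measurable_funM => //; exact: measurableT_comp.
Qed.

Lemma integral_chi2_pdf k : (0 < k)%N ->
  (\int[mu]_x (chi2_pdf k x)%:E = 1)%E.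
Proof.
move=> k0.
have a0 : 0 < k%:R / 2 :> R by rewrite divr_gt0 ?ltr0n.
have c0 : 0 < 2 `^ (k%:R / 2) * gamma_fun (k%:R / 2) :> R.
  by rewrite mulr_gt0 ?powR_gt0 ?gamma_fun_gt0.
have -> : (\int[mu]_x (chi2_pdf k x)%:E =
    \int[mu]_(x in `]0%R, +oo[) ((2 `^ (k%:R / 2) * gamma_fun (k%:R / 2))^-1%:E *
      (x `^ (k%:R / 2 - 1) * expR (- x / 2))%:E))%E.
  rewrite [RHS]integral_mkcond; apply: eq_integral => x _.
  rewrite patchE /chi2_pdf mem_setE in_itv/= andbT.
  by case: ifPn => // _; rewrite -EFinM mulrC.
rewrite ge0_integralZl//=; last 3 first.
- apply/measurable_EFinP; apply: measurable_funTS.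
  apply: measurable_funM; first exact: measurable_powR.
  by apply: measurableT_comp => //; apply: measurable_funM => //.
- by move=> x _; rewrite lee_fin mulr_ge0 ?powR_ge0 ?expR_ge0.
- by rewrite lee_fin invr_ge0 ltW.
by rewrite gamma_integral_half// -EFinM mulVf// gt_eqF.
Qed.

Let chi2_prob0 k : chi2_prob k set0 = 0%E.
Proof. by case: k => [|k]; rewrite /chi2_prob ?measure0 ?integral_set0. Qed.

Let chi2_prob_ge0 k A : (0 <= chi2_prob k A)%E.
Proof.
case: k => [|k]; rewrite /chi2_prob; first exact: measure_ge0.
by apply: integral_ge0 => x _; rewrite lee_fin chi2_pdf_ge0.
Qed.

Let chi2_prob_sigma_additive k : semi_sigma_additive (chi2_prob k).
Proof.
case: k => [|k]; rewrite /chi2_prob; first exact: measure_semi_sigma_additive.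
move=> /= F mF tF mUF; apply: cvg_toP.
  apply: ereal_nondecreasing_is_cvgn => m n mn.
  apply: lee_sum_nneg_natr => // i _ _; apply: integral_ge0 => /= x _.
  by rewrite lee_fin chi2_pdf_ge0.
rewrite ge0_integral_bigcup//=.
- apply/measurable_EFinP; apply: measurable_funTS; exact: measurable_chi2_pdf.
- by move=> x _; rewrite lee_fin chi2_pdf_ge0.
Qed.

HB.instance Definition _ k := isMeasure.Build _ _ _ (chi2_prob k)
  (chi2_prob0 k) (@chi2_prob_ge0 k) (@chi2_prob_sigma_additive k).

Let chi2_prob_setT k : chi2_prob k setT = 1%E.
Proof.
case: k => [|k]; rewrite /chi2_prob; first exact: diracT.
exact: integral_chi2_pdf.
Qed.

HB.instance Definition _ k :=
  @Measure_isProbability.Build _ _ R (chi2_prob k) (chi2_prob_setT k).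

End chi_square.

(* The law of the ratio of two independent scaled chi-square variables: the
   product measure is the joint law of the pair. *)
Definition fisher_prob {R : realType} (d1 d2 : nat) : set R -> \bar R :=
  pushforward (chi2_prob d1 \x chi2_prob d2)%E
    (fun g : R * R => (g.1 / d1%:R) / (g.2 / d2%:R)).

(* Measures are only compared on measurable sets, since a measure is
   unconstrained elsewhere. *)
Definition has_law d (T : measurableType d) (R : realType) (P : probability T R)
    (X : {RV P >-> R}) (m : set R -> \bar R) : Prop :=
  forall A : set R, measurable A -> distribution P X A = m A.

Definition prob_within_sd d (T : measurableType d) (R : realType)
    (P : probability T R) (X : {RV P >-> R}) : \bar R :=
  P [set t | `|X t - fine 'E_P[X]%E| <= Num.sqrt (fine 'V_P[X]%E)].

(* Main.v *)
(* Put [a = d1 / 2], [b = d2 / 2]. Up to the scale [b / a], X has the beta prime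
   density with parameters [a] and [b], so that its probability of lying within
   one standard deviation of the mean is [H (s+) - H (s-)], where H is the beta
   prime distribution function and
   [s+- = a / (b - 1) * (1 +- sqrt ((a + b - 1) / (a * (b - 2))))]; for the
   chi-square law it is [K (y+) - K (y-)] with [y+- = 2 a (1 +- 1 / sqrt a)].

   Monotonicity of the likelihood ratio between the beta prime law and the image
   of the chi-square law under [y |-> exp (y / k) - 1] sandwiches [H s] between
   [K (2 b ln (1 + s))] and [K ((2 b + a - 1) ln (1 + s))], the order depending on
   the sign of [a - 1]. With [2 y / (2 + y) <= ln (1 + y) <= y] this yields
   [H (s+) >= K (y+)] and [H (s-) <= K (y-)], except when [a = 2], where the upper
   endpoint is handled with the explicit tails. Hence each probability for X is at
   least the one for the chi-square law; the same sandwich shows that the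
   difference is [O (1 / b)], so the latter is the infimum. Finally
   [P (|Z| <= 1) <= 0.722], while the four chi-square probabilities exceed 0.722. *)

Require Import Defs.
From mathcomp Require Import all_boot all_order all_algebra.
From mathcomp Require Import all_classical all_reals all_analysis.
From mathcomp Require Import measurable_realfun.
From mathcomp Require Import ring lra.

Set Implicit Arguments.
Unset Strict Implicit.
Unset Printing Implicit Defensive.

Import Order.TTheory GRing.Theory Num.Theory.
Import numFieldNormedType.Exports.

Local Open Scope classical_set_scope.
Local Open Scope ring_scope.

(** * The law of a ratio of chi-square variables *)

(** With [v = ln (1 + s)], the ratio of the beta prime density to the image density is, up to a
    constant, [(s / v)^(a - 1) * exp ((k / 2 + 1 - a - b) v)]. At [k = 2 b] it equals
    [((1 - exp (- v)) / v)^(a - 1)], at [k = 2 b + a - 1] it equals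
    [(sinh (v / 2) / (v / 2))^(a - 1)]. The two bases are monotone in opposite directions, whence
    the two sides of the sandwich and the role of the sign of [a - 1].

    For [a >= 1] the lower bound on H has [k = 2 b], and with [r = 1 / sqrt a] one finds [2 b ln (1
    + s+) - y+ = (a / b) ((1 - a) + (3 - a) r) + O (1 / b^2)]. The coefficient is positive at 1 and
    3/2 but negative at 2: there the sandwich itself is too weak for large [b], however well the
    logarithm is estimated.

    For [a = 1/2] and [a = 3/2] the chi-square distribution function is not elementary. Its density
    is dominated by combinations of those for 1 and 2, and the only fact needed about
    [gamma_fun (1/2)] is a lower bound, itself read off from total masses. *)

Section density.
Context d (T : measurableType d) (R : realType).
Variables (mu nu : {measure set T -> \bar R}) (f : T -> R).
Hypotheses (mf : measurable_fun setT f) (f0 : forall x, 0 <= f x).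
Hypothesis nuE : forall A, measurable A -> nu A = (\int[mu]_(x in A) (f x)%:E)%E.
Local Open Scope ereal_scope.
Import HBNNSimple.

Let integral_density_nnsfun (h : {nnsfun T >-> R}) :
  \int[nu]_x (h x)%:E = \int[mu]_x ((h x)%:E * (f x)%:E).
Proof.
have E x : (h x)%:E = \sum_(y \in range h) (y * \1_(h @^-1` [set y]) x)%:E.
  by rewrite /= fimfunE -fsumEFin.
have indic r : measurable_fun setT (fun x => (r * \1_(h @^-1` [set r]) x)%:E : \bar R).
  by apply/measurable_EFinP; exact: measurable_funM.
under eq_integral do rewrite E.
rewrite ge0_integral_fsum//; last first.
  by move=> *; exact: nnfun_muleindic_ge0.
transitivity (\int[mu]_x (\sum_(y \in range h)
    (y * \1_(h @^-1` [set y]) x)%:E * (f x)%:E)); last first.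
  apply: eq_integral => x _; rewrite E ge0_mule_fsuml// => y.
  exact: nnfun_muleindic_ge0.
rewrite ge0_integral_fsum//; last 2 first.
- move=> y; apply: emeasurable_funM => //; exact/measurable_EFinP.
- by move=> m y Ey; rewrite mule_ge0 ?lee_fin ?f0// -lee_fin nnfun_muleindic_ge0.
apply: eq_fsbigr => r; rewrite inE => -[t _ <-].
have h0 : (0 <= h t)%R by [].
under eq_integral do rewrite EFinM.
under [RHS]eq_integral do rewrite EFinM -muleA.
have m1 : measurable_fun setT (fun x => (\1_(h @^-1` [set h t]) x)%:E : \bar R).
  by apply/measurable_EFinP; exact: measurable_indic.
rewrite !ge0_integralZl//; last 2 first.
- by apply: emeasurable_funM => //; exact/measurable_EFinP.
- by move=> x _; rewrite mule_ge0 ?lee_fin.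
congr (_ * _); rewrite integral_indic// setIT nuE// integral_mkcond.
apply: eq_integral => x _; rewrite patchE indicE.
by case: ifPn; rewrite ?(mul1e, mul0e).
Qed.

(** Simple functions reduce to the set-wise hypothesis [nuE], and monotone convergence does the
    rest. Laws are given by their values on sets, while moments require integrals of functions. *)
Lemma ge0_integral_density (g : T -> \bar R) : measurable_fun setT g ->
  (forall x, 0 <= g x) -> \int[nu]_x g x = \int[mu]_x (g x * (f x)%:E).
Proof.
move=> mg g0; pose h := nnsfun_approx measurableT mg.
have gE x : (EFin \o h ^~ x) n @[n --> \oo] --> g x.
  exact: cvg_nnsfun_approx.
have mh n : measurable_fun setT (EFin \o h n : T -> \bar R).
  exact/measurable_EFinP.
transitivity (limn (fun n => \int[nu]_x (EFin \o h n) x)).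
  rewrite -monotone_convergence//.
  - by apply: eq_integral => x _; apply/esym/cvg_lim => //; exact: gE.
  - by move=> n x _ /=; rewrite lee_fin.
  - by move=> x _ a b ab; rewrite lee_fin; exact/lefP/nd_nnsfun_approx.
transitivity (limn (fun n => \int[mu]_x ((EFin \o h n) x * (f x)%:E))).
  by under eq_fun do rewrite integral_density_nnsfun.
rewrite -monotone_convergence//.
- by apply: eq_integral => x _; apply/cvg_lim => //; apply: cvgeZr; [by []|exact: gE].
- by move=> n; apply: emeasurable_funM => //; exact/measurable_EFinP.
- by move=> n x _; rewrite mule_ge0 ?lee_fin.
- move=> x _ a b ab; rewrite lee_wpmul2r ?lee_fin//.
  exact/lefP/nd_nnsfun_approx.
Qed.

End density.

Section scaling.
Context {R : realType}.
Local Notation mu := (@lebesgue_measure R).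
Variable c : R.
Hypothesis c0 : 0 < c.

Let mc : measurable_fun [set: measurableTypeR R]
    ( *%R c : measurableTypeR R -> measurableTypeR R).
Proof. exact: measurable_funM. Qed.

Let lebesgue_measure_scale (A : set R) : measurable A ->
  (mu A = c%:E * pushforward mu ( *%R c : R -> measurableTypeR R) A)%E.
Proof.
pose nu := @measure_function_pushforward__canonical__measure_function_Measure
  _ _ _ _ _ (mu : measure _ _) _ mc.
move=> mA; apply: (@lebesgue_measure_unique R (mscale (NngNum (ltW c0)) nu)) => //= _ [[p q]] _ <-.
rewrite /mscale/= /pushforward.
have -> : *%R c @^-1` `]p, q] = `](c^-1 * p), (c^-1 * q)]%classic.
  by apply/seteqP; split => x /=; rewrite !in_itv/= ler_pdivlMl// ltr_pdivrMl.
rewrite !lebesgue_measure_itv/= !lte_fin ltr_pM2l ?invr_gt0//.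
case: ifPn => _; last by rewrite mule0.
by rewrite -!EFinB -EFinM; congr EFin; field; rewrite gt_eqF.
Qed.

(** Lebesgue measure is [c] times its image under [x |-> c x], by uniqueness on half-open intervals,
    so the substitution asks no continuity of [g]. *)
Lemma ge0_integral_scale (g : R -> \bar R) : measurable_fun setT g ->
  (forall x, 0 <= g x)%E -> (\int[mu]_x g x = \int[mu]_x (c%:E * g (c * x)%R))%E.
Proof.
move=> mg g0.
pose nu := @measure_function_pushforward__canonical__measure_function_Measure
  _ _ _ _ _ (mu : measure _ _) _ mc.
rewrite (@eq_measure_integral _ _ _ _ (mscale (NngNum (ltW c0)) nu) mu); last first.
  by move=> A mA _; exact: lebesgue_measure_scale.
rewrite ge0_integral_mscale//=.
rewrite [X in (_ * X)%E](_ : _ = (\int[mu]_x g (c * x)%R)%E); last first.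
  have := @ge0_integral_pushforward _ _ _ _ R _ mc mu setT g measurableT mg.
  by rewrite preimage_setT => -> // x _; exact: g0.
rewrite -ge0_integralZl//; last by rewrite lee_fin ltW.
by apply: measurableT_comp => //; exact: mc.
Qed.

End scaling.

Section ratio_law.
Context {R : realType}.
Implicit Types a b x y s : R.
Local Notation mu := (@lebesgue_measure R).

Local Opaque gamma_fun.

(* The chi-square density with [2 a] degrees of freedom, for real [a]. *)
Definition chid a x : R :=
  if 0 < x then x `^ (a - 1) * expR (- x / 2) / (2 `^ a * gamma_fun a) else 0.

(** The density of the ratio of independent [chid a] and [chid b] variables. The constant
    [1 / B(a, b)] is spelled with gamma functions, so that no beta integral has to be evaluated. *)
Definition beta_prime a b s : R :=
  if 0 < s then s `^ (a - 1) * (1 + s) `^ (- (a + b)) *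
    (gamma_fun (a + b) / (gamma_fun a * gamma_fun b)) else 0.

Lemma chid_norm_gt0 a : 0 < a -> 0 < 2 `^ a * gamma_fun a.
Proof. by move=> a0; rewrite mulr_gt0 ?powR_gt0 ?gamma_fun_gt0. Qed.

Lemma chid_ge0 a x : 0 < a -> 0 <= chid a x.
Proof.
move=> a0; rewrite /chid; case: ifPn => // _.
by rewrite divr_ge0 ?(ltW (chid_norm_gt0 a0))// mulr_ge0 ?powR_ge0 ?expR_ge0.
Qed.

Lemma beta_prime_ge0 a b s : 0 < a -> 0 < b -> 0 <= beta_prime a b s.
Proof.
move=> a0 b0; rewrite /beta_prime; case: ifPn => // _.
apply: mulr_ge0; first by rewrite mulr_ge0 ?powR_ge0.
by rewrite divr_ge0 ?mulr_ge0 ?ltW ?gamma_fun_gt0 ?addr_gt0.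
Qed.

Lemma measurable_chid a : measurable_fun setT (chid a).
Proof.
apply: measurable_fun_ifT => //; first exact: measurable_fun_ltr.
apply: measurable_funM => //; apply: measurable_funM; first exact: measurable_powR.
by apply: measurableT_comp => //; apply: measurable_funM => //; exact: measurableT_comp.
Qed.

Lemma measurable_beta_prime a b : measurable_fun setT (beta_prime a b).
Proof.
apply: measurable_fun_ifT => //; first exact: measurable_fun_ltr.
apply: measurable_funM => //; apply: measurable_funM; first exact: measurable_powR.
apply: (measurableT_comp (measurable_powR _)).
by apply: measurable_funD.
Qed.

Lemma integral_chid a : 0 < a -> (\int[mu]_x (chid a x)%:E = 1)%E.
Proof.
move=> a0; have c0 := chid_norm_gt0 a0.
have -> : (\int[mu]_x (chid a x)%:E =
    \int[mu]_(x in `]0%R, +oo[) ((2 `^ a * gamma_fun a)^-1%:E *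
      (x `^ (a - 1) * expR (- x / 2))%:E))%E.
  rewrite [RHS]integral_mkcond; apply: eq_integral => x _.
  rewrite patchE /chid mem_setE in_itv/= andbT.
  by case: ifPn => // _; rewrite -EFinM mulrC.
rewrite ge0_integralZl//=; last 3 first.
- apply/measurable_EFinP; apply: measurable_funTS.
  apply: measurable_funM; first exact: measurable_powR.
  by apply: measurableT_comp => //; apply: measurable_funM.
- by move=> x _; rewrite lee_fin mulr_ge0 ?powR_ge0 ?expR_ge0.
- by rewrite lee_fin invr_ge0 ltW.
by rewrite gamma_integral_half// -EFinM mulVf// gt_eqF.
Qed.

(** At [x = y s], with Jacobian [y], the joint density of [(x, y)] splits into a function of the
    ratio [s] and a function of the sum [x + y = (1 + s) y]: the classical independence of ratio and
    sum. *)
Let chid_mul a b y s : 0 < a -> 0 < b ->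
  y * chid a (y * s) * chid b y =
  beta_prime a b s * ((1 + s) * chid (a + b) ((1 + s) * y)).
Proof.
move=> a0 b0; have ga := gamma_fun_gt0 a0; have gb := gamma_fun_gt0 b0.
have gab := gamma_fun_gt0 (addr_gt0 a0 b0).
rewrite /beta_prime /chid.
move: (gamma_fun a) (gamma_fun b) (gamma_fun (a + b)) ga gb gab => ga gb gab.
move=> ga0 gb0 gab0.
have [y0|y0] := ltP 0 y; last first.
  rewrite mulr0; case: ifPn => s0; last by rewrite mul0r.
  by rewrite ltNge mulr_ge0_le0 ?mulr0//; lra.
rewrite pmulr_rgt0//.
case: ifPn => s0; last by rewrite mulr0 !mul0r.
have s1 : 0 < 1 + s by lra.
rewrite pmulr_rgt0// y0 !powRM ?(ltW y0) ?(ltW s0) ?(ltW s1)//.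
have E (c z : R) : 0 < z -> z `^ (c - 1) = z `^ c / z.
  by move=> z0; rewrite powRB ?powRr1 ?ltW//; apply/implyP => _; rewrite gt_eqF.
rewrite !E// powRN.
have D (z : R) : 0 < z -> z `^ (a + b) = z `^ a * z `^ b.
  by move=> z0; rewrite powRD//; apply/implyP => _; rewrite gt_eqF.
rewrite !D//.
have -> : - ((1 + s) * y) / 2 = - (y * s) / 2 + - y / 2 by lra.
rewrite expRD.
have P (z c : R) (z0 : 0 < z) : z `^ c != 0 by rewrite gt_eqF// powR_gt0.
have := P y a y0; have := P y b y0; have := P s a s0; have := P _ a s1.
have := P _ b s1; have := P 2 a (ltr0Sn R 1); have := P 2 b (ltr0Sn R 1).
move: (y `^ a) (y `^ b) (s `^ a) ((1 + s) `^ a) ((1 + s) `^ b) (2 `^ a) (2 `^ b).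
move: (expR _) (expR _) => e1 e2 u1 u2 u3 u4 u5 u6 u7 *.
field; rewrite !(gt_eqF ga0, gt_eqF gb0, gt_eqF gab0, gt_eqF y0, gt_eqF s0, gt_eqF s1).
by do ?[apply/andP; split].
Qed.

Lemma integral_ratio_chid a b (h : R -> \bar R) : 0 < a -> 0 < b ->
  measurable_fun setT h -> (forall s, 0 <= h s)%E ->
  measurable_fun [set: R * R] (fun z : R * R => h (z.1 / z.2)) ->
  (\int[mu]_y ((\int[mu]_x (h (x / y)%R * (chid a x)%:E)) * (chid b y)%:E) =
   \int[mu]_s (h s * (beta_prime a b s)%:E))%E.
Proof.
move=> a0 b0 mh h0 mhr.
have mca := @measurable_chid a; have mcb := @measurable_chid b.
have mcE c : measurable_fun setT (fun x => (chid c x)%:E).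
  by apply/measurable_EFinP; exact: measurable_chid.
have mcaE := mcE a.
have k0 y s : 0 <= y * chid a (y * s) * chid b y.
  have [y0|y0] := leP 0 y; first by rewrite !mulr_ge0 ?chid_ge0.
  by rewrite [chid b y]/chid (lt_gtF y0) mulr0.
transitivity (\int[mu]_y \int[mu]_s
    (h s * (y * chid a (y * s) * chid b y)%:E))%E.
  apply: eq_integral => y _.
  have [y0|y0] := ltP 0 y; last first.
    rewrite [chid b y]/chid ltNge y0/= mule0 integral0_eq// => s _.
    by rewrite mulr0 mule0.
  rewrite (ge0_integral_scale y0); last 2 first.
  - apply: emeasurable_funM; last exact: mcaE.
    exact: (measurableT_comp mh (mulrr_measurable _)).
  - by move=> x; rewrite mule_ge0 ?lee_fin ?chid_ge0.
  rewrite -ge0_integralZr//; last 3 first.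
  - apply: measurable_funeM; apply: emeasurable_funM.
      apply: (measurableT_comp mh); exact: measurable_funM.
    exact: (measurableT_comp mcaE (mulrl_measurable y)).
  - by move=> x _; rewrite !mule_ge0 ?lee_fin ?chid_ge0// ltW.
  - by rewrite lee_fin chid_ge0.
  apply: eq_integral => s _.
  have -> : (y * s / y)%R = s by field; rewrite gt_eqF.
  by rewrite muleCA -!muleA -!EFinM mulrA.
pose F (z : R * R) := (h z.2 * (z.1 * chid a (z.1 * z.2) * chid b z.1)%:E)%E.
have mp : measurable_fun [set: R * R] (fun z : R * R => z.1 * z.2).
  exact: measurable_funM measurable_fst measurable_snd.
have mF : measurable_fun setT F.
  apply: emeasurable_funM; first exact: (measurableT_comp mh measurable_snd).
  apply/measurable_EFinP; apply: measurable_funM.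
    by apply: measurable_funM; [exact: measurable_fst|exact: (measurableT_comp mca mp)].
  exact: (measurableT_comp mcb measurable_fst).
have F0 z : (0 <= F z)%E by rewrite mule_ge0// lee_fin.
(* After Tonelli the inner integral is the total mass of a rescaled [chid (a + b)], which is 1. *)
transitivity (\int[mu]_s \int[mu]_y F (y, s))%E.
  exact: (fubini_tonelli (m1 := mu) (m2 := mu) F mF F0).
rewrite /F/=.
apply: eq_integral => s _.
have mcab : measurable_fun setT (fun y => ((1 + s) * chid (a + b) ((1 + s) * y))%:E).
  under eq_fun do rewrite EFinM; apply: measurable_funeM.
  exact: (measurableT_comp (mcE (a + b)) (mulrl_measurable (1 + s))).
have ab0 : 0 < a + b by rewrite addr_gt0.
under eq_integral do rewrite chid_mul//.
have [s0|s0] := ltP 0 s; last first.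
  rewrite /beta_prime ltNge s0/= mule0 integral0_eq// => y _.
  by rewrite mul0r mule0.
have s1 : 0 < 1 + s by lra.
have c0 y : 0 <= (1 + s) * chid (a + b) ((1 + s) * y).
  by rewrite mulr_ge0 ?chid_ge0// ltW.
rewrite ge0_integralZl//; last 2 first.
- under eq_fun do rewrite EFinM.
  exact: measurable_funeM.
- by move=> y _; rewrite lee_fin mulr_ge0 ?beta_prime_ge0.
congr (_ * _)%E.
under eq_integral do rewrite EFinM.
rewrite ge0_integralZl//; last 2 first.
- by move=> y _; rewrite lee_fin.
- by rewrite lee_fin beta_prime_ge0.
rewrite -[RHS]mule1 -(integral_chid ab0); congr (_ * _)%E.
rewrite [RHS](ge0_integral_scale s1); [by []|exact: mcE|].
by move=> x; rewrite lee_fin chid_ge0.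
Qed.

(** This is the ratio formula for the constant function 1: its left side is a product of chi-square
    total masses, so the beta integral comes for free. *)
Lemma integral_beta_prime a b : 0 < a -> 0 < b ->
  (\int[mu]_s (beta_prime a b s)%:E = 1)%E.
Proof.
move=> a0 b0.
have m1 : measurable_fun setT (cst 1%E : R -> \bar R) by exact: measurable_cst.
have := @integral_ratio_chid a b (cst 1%E) a0 b0 m1 (fun=> lee01).
move=> /(_ (measurable_cst _)).
under eq_integral do under eq_integral do rewrite mul1e.
under [in X in _ = X -> _]eq_integral do rewrite mul1e.
move=> <-; rewrite integral_chid//.
by under eq_integral do rewrite mul1e; rewrite integral_chid.
Qed.

End ratio_law.

(** * Moments *)

Section moments.
Context {R : realType}.
Implicit Types a b x y s : R.
Local Notation mu := (@lebesgue_measure R).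
Local Opaque gamma_fun.

Lemma powR_cvgy0 b : 0 < b -> (1 + s) `^ (- b) @[s --> +oo] --> (0 : R).
Proof.
move=> b0; apply/cvgrPdist_lt => e e0; near=> s.
have s0 : 0 < s by near: s; exact: nbhs_pinfty_gt.
have s1 : 0 < 1 + s by rewrite addr_gt0.
rewrite sub0r normrN ger0_norm ?powR_ge0// powRN.
rewrite invf_plt ?posrE ?powR_gt0//.
have -> : e^-1 = (e^-1 `^ b^-1) `^ b.
  by rewrite -powRrM mulVf ?gt_eqF// powRr1// invr_ge0 ltW.
apply: gt0_ltr_powR => //; rewrite ?nnegrE ?powR_ge0 ?ltW//.
apply: (@lt_trans _ _ s); last by rewrite ltrDr.
by near: s; exact: nbhs_pinfty_gt.
Unshelve. all: by end_near. Qed.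

Lemma is_derive1_continuous (f : R -> R) (x d : R) :
  is_derive x (1 : R) f d -> {for x, continuous f}.
Proof.
by case=> df _; apply: differentiable_continuous; exact/derivable1_diffP.
Qed.

Lemma is_derive1_powR1D (c s : R) : 0 <= s ->
  is_derive s (1 : R) (fun t => (1 + t) `^ c) (c * (1 + s) `^ (c - 1)).
Proof.
move=> s0; have s1 : 0 < 1 + s by rewrite ltr_wpDr.
have d1 : is_derive s (1 : R) (fun t => 1 + t) 1.
  have c1 : is_derive s (1 : R) (cst 1 : R -> R) 0 by exact: is_derive_cst.
  have i1 : is_derive s (1 : R) (id : R -> R) 1 by exact: is_derive_id.
  by apply: (is_derive_eq (is_deriveD c1 i1)); rewrite add0r.
apply: (is_derive_eq (is_derive1_comp (is_derive1_powR c s1) d1)).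
exact: mulr1.
Qed.

Lemma gamma_fun1 : gamma_fun (1 : R) = 1.
Proof.
have E : (\int[mu]_(x in `]0%R, +oo[) (gamma_integrand 1 x)%:E = 1)%E.
  have dE (x : R) : is_derive x (1 : R) (fun y => - expR (- y)) (expR (- x)).
    have d1 := is_derive1_comp (is_derive_expR (- x)) (is_deriveNid x (1 : R)).
    by apply: (is_derive_eq (is_deriveN d1)); rewrite mulrN1 opprK.
  transitivity (\int[mu]_(x in `]0%R, +oo[) (expR (- x))%:E)%E.
    apply: eq_integral => x _; by rewrite /gamma_integrand subrr powRr0 mul1r.
  rewrite integral_itv_obnd_cbnd; last first.
    apply/measurable_EFinP; apply: measurable_funTS.
    exact: (measurableT_comp (@measurable_expR R) (@oppr_measurable R setT)).
  rewrite (@ge0_continuous_FTC2y _ _ (fun y => - expR (- y)) _ 0).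
  - by rewrite oppr0 expR0 sub0e -EFinN opprK.
  - by move=> x _; exact: expR_ge0.
  - apply: continuous_subspaceT => x; apply: continuous_comp; first exact: opp_continuous.
    exact: continuous_expR.
  - rewrite -[X in _ --> X]oppr0; apply: cvgN; exact: cvgr_expR.
  - by move=> x _; have [] := dE x.
  - apply: cvg_at_right_filter; exact: (is_derive1_continuous (dE 0)).
  - by move=> x _; rewrite derive1E; have [_ ->] := dE x.
by have := gamma_funE (@ltr01 R); rewrite E => -[].
Qed.

(* Read off the total mass of [beta_prime 1 b], whose density has an elementary
   primitive. *)
Lemma gamma_funS b : 0 < b -> gamma_fun (b + 1) = b * gamma_fun b.
Proof.
move=> b0.
have db s : 0 <= s -> is_derive s (1 : R) (fun s => - (b^-1 * (1 + s) `^ (- b)))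
    ((1 + s) `^ (- (1 + b))).
  move=> s0.
  have d2 := is_derive1_powR1D (- b) s0.
  have d3 := @is_deriveZ _ _ _ _ b^-1 _ _ _ d2.
  have d4 := @is_deriveN _ _ _ _ _ _ _ d3.
  apply: (is_derive_eq d4).
  rewrite /GRing.scale/= mulrA mulrN mulVf ?gt_eqF// mulN1r opprK.
  by congr (_ `^ _); lra.
have cF s : 0 <= s -> {for s, continuous (fun s => - (b^-1 * (1 + s) `^ (- b)))}.
  by move=> /db; exact: is_derive1_continuous.
have I : (\int[mu]_(s in `[0%R, +oo[) ((1 + s) `^ (- (1 + b)))%:E = (b^-1)%:E)%E.
  rewrite (@ge0_continuous_FTC2y _ _ (fun s => - (b^-1 * (1 + s) `^ (- b))) _ 0).
  - by rewrite addr0 powR1 mulr1 sub0e -EFinN opprK.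
  - by move=> x _; exact: powR_ge0.
  - apply: continuous_in_subspaceT => x; rewrite inE/= in_itv/= andbT => x0.
    exact: (is_derive1_continuous (is_derive1_powR1D (- (1 + b)) x0)).
  - rewrite -[X in _ --> X]oppr0; apply: cvgN.
    rewrite -[X in _ --> X](mulr0 b^-1); apply: cvgM; first exact: cvg_cst.
    exact: powR_cvgy0.
  - by move=> x x0; have [] := db x (ltW x0).
  - by apply: cvg_at_right_filter; exact: (cF 0).
  - move=> x; rewrite in_itv/= andbT => x0; rewrite derive1E.
    by have [_ ->] := db x (ltW x0).
have mI : measurable_fun setT (fun s => ((1 + s) `^ (- (1 + b)))%:E).
  apply/measurable_EFinP.
  apply: (measurableT_comp (measurable_powR (- (1 + b)))).
  by apply: measurable_funD.
have := integral_beta_prime (@ltr01 R) b0.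
have -> : (\int[mu]_s (beta_prime 1 b s)%:E =
    \int[mu]_(s in `]0%R, +oo[)
      ((gamma_fun (1 + b) / (gamma_fun 1 * gamma_fun b))%:E * ((1 + s) `^ (- (1 + b)))%:E))%E.
  rewrite [RHS]integral_mkcond; apply: eq_integral => x _.
  rewrite patchE /beta_prime mem_setE in_itv/= andbT.
  by case: ifPn => // _; rewrite -EFinM subrr powRr0 mul1r mulrC.
have g0 : 0 < gamma_fun b := gamma_fun_gt0 b0.
have g1 : 0 < gamma_fun (1 + b) := gamma_fun_gt0 (addr_gt0 ltr01 b0).
rewrite ge0_integralZl//; last 3 first.
- exact: measurable_funTS.
- by move=> x _; rewrite lee_fin powR_ge0.
- by rewrite gamma_fun1 mul1r lee_fin; apply: divr_ge0; exact: ltW.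
rewrite integral_itv_obnd_cbnd; last exact: measurable_funTS.
rewrite I -EFinM gamma_fun1 mul1r (addrC b 1) => -[].
move: g0 g1; move: (gamma_fun b) (gamma_fun (1 + b)) => g h g0 h0 E.
by rewrite -[RHS]mulr1 -E; field; rewrite !gt_eqF.
Qed.

(** Size biasing stays within the family, so every moment reduces to a total mass. *)
Lemma mulr_chid a x : 0 < a -> x * chid a x = 2 * a * chid (a + 1) x.
Proof.
move=> a0; rewrite /chid; case: ifPn => x0; last by rewrite !mulr0.
rewrite gamma_funS//.
have ga := gamma_fun_gt0 a0; move: (gamma_fun a) ga => ga ga0.
have -> : a + 1 - 1 = a by lra.
have -> : x `^ (a - 1) = x `^ a / x.
  by rewrite powRB ?powRr1 ?ltW//; apply/implyP => _; rewrite gt_eqF.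
have -> : 2 `^ (a + 1) = 2 `^ a * 2 :> R.
  by rewrite powRD ?powRr1//; apply/implyP => _.
have p0 : 0 < 2 `^ a :> R by exact: powR_gt0.
by field; rewrite !gt_eqF.
Qed.

(** The exponent of [1 + s] is unchanged since [(a + 1) + (b - 1) = a + b]. Each moment costs one
    unit of [b], hence the condition [2 < b] for the second one. *)
Lemma mulr_beta_prime a b s : 0 < a -> 1 < b ->
  s * beta_prime a b s = a / (b - 1) * beta_prime (a + 1) (b - 1) s.
Proof.
move=> a0 b1; rewrite /beta_prime; case: ifPn => s0; last by rewrite !mulr0.
have b0 : 0 < b - 1 by rewrite subr_gt0.
have Eb : b = (b - 1) + 1 by lra.
rewrite [in gamma_fun b]Eb !gamma_funS//.
have Eab : a + 1 + (b - 1) = a + b by lra.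
rewrite Eab.
have ga := gamma_fun_gt0 a0; move: (gamma_fun a) ga => ga ga0.
have gb := gamma_fun_gt0 b0; move: (gamma_fun (b - 1)) gb => gb gb0.
have -> : a + 1 - 1 = a by lra.
have -> : s `^ (a - 1) = s `^ a / s.
  by rewrite powRB ?powRr1 ?ltW//; apply/implyP => _; rewrite gt_eqF.
by field; rewrite !gt_eqF.
Qed.

Lemma integral_mul_chid a : 0 < a ->
  (\int[mu]_x (x * chid a x)%:E = (2 * a)%:E)%E.
Proof.
move=> a0; have a1 : 0 < a + 1 by rewrite addr_gt0.
under eq_integral do rewrite mulr_chid// EFinM.
rewrite ge0_integralZl ?integral_chid ?mule1//.
- by apply/measurable_EFinP; exact: measurable_chid.
- by move=> x _; rewrite lee_fin chid_ge0.
- by rewrite lee_fin mulr_ge0// ltW.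
Qed.

Lemma integral_sqr_chid a : 0 < a ->
  (\int[mu]_x (x ^+ 2 * chid a x)%:E = (4 * a * (a + 1))%:E)%E.
Proof.
move=> a0; have a1 : 0 < a + 1 by rewrite addr_gt0.
have a2 : 0 < a + 1 + 1 by rewrite addr_gt0.
have E x : x ^+ 2 * chid a x = 4 * a * (a + 1) * chid (a + 1 + 1) x.
  by rewrite expr2 -mulrA mulr_chid// mulrCA mulr_chid//; ring.
under eq_integral do rewrite E EFinM.
rewrite ge0_integralZl ?integral_chid ?mule1//.
- by apply/measurable_EFinP; exact: measurable_chid.
- by move=> x _; rewrite lee_fin chid_ge0.
- by rewrite lee_fin !mulr_ge0// ltW.
Qed.

Lemma integral_mul_beta_prime a b : 0 < a -> 1 < b ->
  (\int[mu]_x (x * beta_prime a b x)%:E = (a / (b - 1))%:E)%E.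
Proof.
move=> a0 b1; have a1 : 0 < a + 1 by rewrite addr_gt0.
have b0 : 0 < b - 1 by rewrite subr_gt0.
under eq_integral do rewrite mulr_beta_prime// EFinM.
rewrite ge0_integralZl ?integral_beta_prime ?mule1//.
- by apply/measurable_EFinP; exact: measurable_beta_prime.
- by move=> x _; rewrite lee_fin beta_prime_ge0.
- by rewrite lee_fin divr_ge0// ltW.
Qed.

Lemma integral_sqr_beta_prime a b : 0 < a -> 2 < b ->
  (\int[mu]_x (x ^+ 2 * beta_prime a b x)%:E =
   (a * (a + 1) / ((b - 1) * (b - 2)))%:E)%E.
Proof.
move=> a0 b2; have a1 : 0 < a + 1 by rewrite addr_gt0.
have a2 : 0 < a + 1 + 1 by rewrite addr_gt0.
have b1 : 1 < b by lra.
have b1' : 1 < b - 1 by lra.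
have b20 : 0 < b - 1 - 1 by lra.
have b10 : 0 < b - 1 by lra.
have E x : x ^+ 2 * beta_prime a b x =
    a * (a + 1) / ((b - 1) * (b - 2)) * beta_prime (a + 1 + 1) (b - 1 - 1) x.
  rewrite expr2 -mulrA mulr_beta_prime// mulrCA mulr_beta_prime//.
  by field; rewrite !gt_eqF//; lra.
under eq_integral do rewrite E EFinM.
rewrite ge0_integralZl ?integral_beta_prime ?mule1//.
- by apply/measurable_EFinP; exact: measurable_beta_prime.
- by move=> x _; rewrite lee_fin beta_prime_ge0.
- by rewrite lee_fin divr_ge0// mulr_ge0//; lra.
Qed.

End moments.

(** * The F-distribution as a density *)

Section laws.
Context {R : realType}.
Implicit Types a b x y s : R.
Local Notation mu := (@lebesgue_measure R).
Local Opaque gamma_fun.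

(** Inversion is discontinuous at 0, so it is split by sign and expressed through real powers, with
    the convention that the inverse of 0 is 0. *)
Lemma measurable_inv : measurable_fun setT (@GRing.inv R).
Proof.
have -> : @GRing.inv R =
    fun x => if 0 < x then x `^ (-1) else if x < 0 then - (- x) `^ (-1) else 0.
  apply/funext => x; case: ltgtP => // [x0|x0|<-]; last by rewrite invr0.
  - by rewrite powR_inv1// ltW.
  - by rewrite powR_inv1 ?invrN ?opprK// oppr_ge0 ltW.
have ml : measurable_fun setT (fun x : R => 0 < x).
  exact: measurable_fun_ltr.
have mr : measurable_fun setT (fun x : R => x < 0).
  exact: measurable_fun_ltr.
have mp : measurable_fun setT (fun x : R => - (- x) `^ (-1)).
  apply: measurable_funN.
  exact: (measurableT_comp (measurable_powR (-1)) (@oppr_measurable R setT)).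
apply: measurable_fun_ifT => //.
by apply: measurable_fun_ifT.
Qed.

Lemma measurable_ratio : measurable_fun setT (fun z : R * R => z.1 / z.2).
Proof.
apply: measurable_funM; first exact: measurable_fst.
exact: (measurableT_comp measurable_inv measurable_snd).
Qed.

Definition fisher_pdf a b y : R := a / b * beta_prime a b (a / b * y).

Lemma fisher_pdf_ge0 a b y : 0 < a -> 0 < b -> 0 <= fisher_pdf a b y.
Proof.
by move=> a0 b0; rewrite mulr_ge0 ?beta_prime_ge0// divr_ge0// ltW.
Qed.

Lemma measurable_fisher_pdf a b : measurable_fun setT (fisher_pdf a b).
Proof.
apply: measurable_funM; first exact: measurable_cst.
exact: (measurableT_comp (measurable_beta_prime a b) (mulrl_measurable (a / b))).
Qed.

Lemma ge0_integral_fisher_pdf a b (h : R -> \bar R) : 0 < a -> 0 < b ->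
  measurable_fun setT h -> (forall x, 0 <= h x)%E ->
  (\int[mu]_y (h y * (fisher_pdf a b y)%:E) =
   \int[mu]_s (h (b / a * s)%R * (beta_prime a b s)%:E))%E.
Proof.
move=> a0 b0 mh h0; have c0 : 0 < a / b by rewrite divr_gt0.
have mb : measurable_fun setT (fun s => (beta_prime a b s)%:E).
  by apply/measurable_EFinP; exact: measurable_beta_prime.
rewrite [RHS](ge0_integral_scale c0).
- apply: eq_integral => y _; rewrite muleCA -EFinM mulrA.
  by congr (h _ * _)%E; field; rewrite !gt_eqF.
- by apply: emeasurable_funM => //; exact: (measurableT_comp mh (mulrl_measurable (b / a))).
- by move=> x; rewrite mule_ge0// lee_fin beta_prime_ge0.
Qed.

Lemma ge0_integral_density_lebesgue (nu : {measure set R -> \bar R}) (f : R -> R) :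
  measurable_fun setT f -> (forall x, 0 <= f x) ->
  (forall A, measurable A -> nu A = (\int[mu]_(x in A) (f x)%:E)%E) ->
  forall g : R -> \bar R, measurable_fun setT g -> (forall x, 0 <= g x)%E ->
  (\int[nu]_x g x = \int[mu]_x (g x * (f x)%:E))%E.
Proof.
move=> mf f0 nuE g mg g0.
have mid : measurable_fun setT (idfun : R -> measurableTypeR R).
  by move=> _ A mA; rewrite setTI; exact: mA.
pose nu' := @measure_function_pushforward__canonical__measure_function_Measure
  _ _ _ _ _ nu _ mid.
transitivity (\int[nu']_x g x)%E.
  have := @ge0_integral_pushforward _ _ _ _ R _ mid nu setT g measurableT mg.
  by rewrite preimage_setT => -> // x _; exact: g0.
exact: (@ge0_integral_density _ _ R mu nu' f mf f0 nuE g mg g0).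
Qed.

Lemma chi2_probE k (A : set R) : (0 < k)%N ->
  chi2_prob k A = (\int[mu]_(x in A) (chid (k%:R / 2) x)%:E)%E.
Proof. by case: k. Qed.

Lemma fisher_probE m n (A : set R) : (0 < m)%N -> (0 < n)%N -> measurable A ->
  fisher_prob m n A =
  (\int[mu]_(y in A) (fisher_pdf (m%:R / 2) (n%:R / 2) y)%:E)%E.
Proof.
move=> m0 n0 mA.
pose a : R := m%:R / 2; pose b : R := n%:R / 2.
have mR0 : 0 < m%:R :> R by rewrite ltr0n.
have nR0 : 0 < n%:R :> R by rewrite ltr0n.
have a0 : 0 < a by rewrite divr_gt0.
have b0 : 0 < b by rewrite divr_gt0.
pose f (g : R * R) := (g.1 / m%:R) / (g.2 / n%:R).
have fE g : f g = b / a * (g.1 / g.2).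
  (* Since division by 0 gives 0, the identity also holds on the null set where the denominator
     vanishes. *)
  rewrite /f /a /b; have [->|g2] := eqVneq g.2 0.
    by rewrite mul0r invr0 !mulr0.
  by field; rewrite g2 (gt_eqF mR0) (gt_eqF nR0).
have mf : measurable_fun setT f.
  rewrite (_ : f = fun g => b / a * (g.1 / g.2)); last exact/funext.
  apply: measurable_funM; first exact: measurable_cst.
  exact: measurable_ratio.
pose h x := (\1_A (b / a * x))%:E : \bar R.
have m1 : measurable_fun setT (fun x : R => (\1_A x)%:E : \bar R).
  by apply/measurable_EFinP; exact: measurable_indic.
have mh : measurable_fun setT h.
  exact: (measurableT_comp m1 (mulrl_measurable (b / a))).
have h0 x : (0 <= h x)%E by rewrite lee_fin.
have mhr : measurable_fun [set: R * R] (fun z : R * R => h (z.1 / z.2)).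
  exact: (measurableT_comp mh measurable_ratio).
have mB : measurable (f @^-1` A) by rewrite -[X in measurable X]setTI; exact: mf.
rewrite /fisher_prob /pushforward -/f.
transitivity (\int[(chi2_prob m \x chi2_prob n)%E]_z h (z.1 / z.2)%R)%E.
  transitivity (\int[(chi2_prob m \x chi2_prob n)%E]_z (\1_(f @^-1` A) z)%:E)%E.
    by rewrite integral_indic// setIT.
  by apply: eq_integral => z _; rewrite /h -fE.
rewrite (fubini_tonelli2 (m1 := chi2_prob m) (m2 := chi2_prob n) (fun z : R * R => h (z.1 / z.2)) mhr)//.
rewrite /fubini_G/=.
have dE k (g : R -> \bar R) : (0 < k)%N -> measurable_fun setT g -> (forall x, 0 <= g x)%E ->
  (\int[chi2_prob k]_x g x = \int[mu]_x (g x * (chid (k%:R / 2) x)%:E))%E.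
  move=> k0 mg g0.
  apply: (@ge0_integral_density_lebesgue (chi2_prob k) (chid (k%:R / 2))) => //.
  - exact: measurable_chid.
  - by move=> x; rewrite chid_ge0// divr_gt0// ltr0n.
  - by move=> B _; exact: chi2_probE.
rewrite dE//; last 2 first.
- exact: (measurable_fun_fubini_tonelli_G (m1 := chi2_prob m) (fun z : R * R => h (z.1 / z.2)) mhr).
- by move=> y; apply: integral_ge0.
under eq_integral.
  move=> y _; rewrite dE//; last first.
    exact: (measurableT_comp mh (mulrr_measurable _)).
  over.
rewrite (integral_ratio_chid a0 b0 mh h0 mhr).
rewrite -(@ge0_integral_fisher_pdf a b (fun x => (\1_A x)%:E))//.
rewrite [RHS]integral_mkcond; apply: eq_integral => x _.
rewrite patchE indicE; case: ifPn => _; by rewrite ?mul1e ?mul0e.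
Qed.

End laws.

Section within_sd.
Context d (T : measurableType d) (R : realType) (P : probability T R).
Variables (X : {RV P >-> R}) (f : R -> R).
Local Notation mu := (@lebesgue_measure R).
Hypotheses (mf : measurable_fun setT f) (f0 : forall x, 0 <= f x).
Hypothesis f_le0 : forall x, x <= 0 -> f x = 0.
Hypothesis lawX : has_law X (fun A => \int[mu]_(x in A) (f x)%:E)%E.

Let integral_law (h : R -> \bar R) : measurable_fun setT h ->
  (forall x, 0 <= h x)%E ->
  (\int[P]_w h (X w) = \int[mu]_x (h x * (f x)%:E))%E.
Proof.
move=> mh h0; rewrite -(@ge0_integral_density_lebesgue R (distribution P X) f)//.
by rewrite ge0_integral_distribution.
Qed.

Variables M1 M2 : R.
Hypotheses (m1E : (\int[mu]_x (x * f x)%:E = M1%:E)%E)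
  (m2E : (\int[mu]_x (x ^+ 2 * f x)%:E = M2%:E)%E).

Let expectation_law : 'E_P[X]%E = M1%:E.
Proof.
rewrite expectation_def integralE.
have mp : measurable_fun setT (fun x : R => (Num.max x 0)%:E).
  by apply/measurable_EFinP; apply: measurable_maxr.
have mn : measurable_fun setT (fun x : R => (Num.max (- x) 0)%:E).
  apply/measurable_EFinP; apply: measurable_maxr => //.
have -> : ((fun w => (X w)%:E)^\+ = (fun x : R => (Num.max x 0)%:E) \o X)%E.
  by apply/funext => w; rewrite funeposE /= EFin_max.
have -> : ((fun w => (X w)%:E)^\- = (fun x : R => (Num.max (- x) 0)%:E) \o X)%E.
  by apply/funext => w; rewrite funenegE /= EFin_max.
rewrite (integral_law mp) ?(integral_law mn); last 2 first.
- by move=> x; rewrite lee_fin le_max lexx orbT.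
- by move=> x; rewrite lee_fin le_max lexx orbT.
(* The density vanishes on the nonpositive reals, so the negative part of X contributes nothing. *)
rewrite [X in (_ - X)%E]integral0_eq; last first.
  move=> x _; have [x0|x0] := leP x 0; first by rewrite f_le0// mule0.
  by rewrite max_r ?mul0e// oppr_le0 ltW.
rewrite sube0 -m1E; apply: eq_integral => x _.
have [x0|x0] := leP x 0; first by rewrite f_le0// mulr0 mule0.
by rewrite EFinM.
Qed.

Let integral_sqr_law : (\int[P]_w (X w ^+ 2)%:E = M2%:E)%E.
Proof.
have msq : measurable_fun setT (fun x : R => (x ^+ 2)%:E).
  by apply/measurable_EFinP; exact: exprn_measurable.
rewrite (@integral_law (fun x : R => (x ^+ 2)%:E))//.
by move=> x; rewrite lee_fin sqr_ge0.
Qed.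

(** Square integrability, on which the formula of the variance as second moment minus squared mean
    rests. *)
Let Lfun2 : (X : T -> R) \in Lfun P 2%:E.
Proof.
rewrite inE; apply/andP; split; rewrite inE/=; first exact: measurable_funP.
rewrite /finite_norm unlock /Lnorm; apply: poweR_lty.
rewrite (_ : (\int[P]_x _ = M2%:E)%E) ?ltry//.
rewrite -integral_sqr_law; apply: eq_integral => w _.
by rewrite /= -[in RHS]real_normK ?num_real// powR_mulrn.
Qed.

Let variance_law : 'V_P[X]%E = (M2 - M1 ^+ 2)%:E.
Proof.
rewrite (varianceE Lfun2) expectation_law.
have -> : 'E_P[(X : T -> R) ^+ 2]%E = M2%:E.
  by rewrite unlock -integral_sqr_law.
by rewrite EFinB EFin_expe.
Qed.

Lemma prob_within_sd_law : prob_within_sd X =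
  (\int[mu]_(x in `[(M1 - Num.sqrt (M2 - M1 ^+ 2))%R, (M1 + Num.sqrt (M2 - M1 ^+ 2))%R]) (f x)%:E)%E.
Proof.
rewrite /prob_within_sd expectation_law variance_law/=.
rewrite -(lawX (measurable_itv _)); congr (P _).
apply/seteqP; split => w /=; rewrite in_itv/= ler_norml;
  by move=> /andP[? ?]; apply/andP; split; lra.
Qed.

End within_sd.

(** * Comparison of distribution functions *)

Section pdf.
Context {R : realType}.
Implicit Types (f p q : R -> R) (x y s t : R).
Local Notation mu := (@lebesgue_measure R).

Definition is_pdf f := [/\ measurable_fun setT f, forall x, 0 <= f x &
  (\int[mu]_x (f x)%:E = 1)%E].

Definition dcdf f y : R := fine (\int[mu]_(x in `]-oo, y]) (f x)%:E)%E.

Section pdf_theory.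
Variable f : R -> R.
Hypothesis pf : is_pdf f.

Let mfE (A : set R) : measurable_fun A (fun x => (f x)%:E).
Proof. by case: pf => mf _ _; apply/measurable_EFinP; exact: measurable_funTS. Qed.

Let f0 x : (0 <= (f x)%:E)%E.
Proof. by case: pf => _ f0 _; rewrite lee_fin. Qed.

Lemma integral_pdf_fin_num (A : set R) : measurable A ->
  (\int[mu]_(x in A) (f x)%:E)%E \is a fin_num.
Proof.
move=> mA; rewrite ge0_fin_numE; last exact: integral_ge0.
apply: (@le_lt_trans _ _ 1%E); last exact: ltry.
by case: pf => _ _ <-; apply: ge0_subset_integral => //; exact: mfE.
Qed.

Lemma dcdfE y : (\int[mu]_(x in `]-oo, y]) (f x)%:E = (dcdf f y)%:E)%E.
Proof. by rewrite fineK// integral_pdf_fin_num. Qed.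

Lemma dcdf_ge0 y : 0 <= dcdf f y.
Proof. by apply: fine_ge0; exact: integral_ge0. Qed.

Lemma dcdf_itv_oc x y : x <= y ->
  (\int[mu]_(t in `]x, y]) (f t)%:E = (dcdf f y - dcdf f x)%:E)%E.
Proof.
move=> xy; rewrite EFinB -!dcdfE.
rewrite [X in (_ = X - _)%E](_ : _ = (\int[mu]_(t in `]-oo, x]) (f t)%:E +
  \int[mu]_(t in `]x, y]) (f t)%:E))%E.
  by rewrite addeAC subee ?add0e// integral_pdf_fin_num.
rewrite -ge0_integral_setU//=; last 2 first.
- exact: mfE.
- apply/disj_setPS => t; rewrite /= !in_itv/= => -[tx /andP[xt _]].
  by move: (lt_le_trans xt tx); rewrite ltxx.
by rewrite -itv_bndbnd_setU// bnd_simp.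
Qed.

Lemma dcdf_itv x y : x <= y ->
  (\int[mu]_(t in `[x, y]) (f t)%:E = (dcdf f y - dcdf f x)%:E)%E.
Proof.
by move=> xy; rewrite -integral_itv_obnd_cbnd ?dcdf_itv_oc.
Qed.

Lemma dcdf_tail x :
  (\int[mu]_(t in `]x, +oo[) (f t)%:E = (1 - dcdf f x)%:E)%E.
Proof.
rewrite EFinB -dcdfE; case: pf => _ _ <-.
rewrite [X in (_ = X - _)%E](_ : _ = (\int[mu]_(t in `]-oo, x]) (f t)%:E +
  \int[mu]_(t in `]x, +oo[) (f t)%:E))%E.
  by rewrite addeAC subee ?add0e// integral_pdf_fin_num.
rewrite -ge0_integral_setU//=; last 2 first.
- exact: mfE.
- apply/disj_setPS => t; rewrite /= !in_itv/= andbT => -[tx xt].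
  by move: (lt_le_trans xt tx); rewrite ltxx.
by rewrite -itv_bndbnd_setU// set_itvE.
Qed.

Lemma dcdf_le x y : x <= y -> dcdf f x <= dcdf f y.
Proof.
move=> xy; rewrite -lee_fin -!dcdfE; apply: ge0_subset_integral => //.
  exact: mfE.
by apply: subset_itvl; rewrite bnd_simp.
Qed.

Lemma dcdf_lipschitz M x y : x <= y -> (forall t, x <= t -> f t <= M) ->
  dcdf f y - dcdf f x <= M * (y - x).
Proof.
move=> xy fM; rewrite -lee_fin -dcdf_itv//.
apply: (@le_trans _ _ (\int[mu]_(t in `[x, y]) M%:E)%E).
  apply: ge0_le_integral => //; first exact: mfE.
  by move=> t; rewrite /= in_itv/= => /andP[xt _]; rewrite lee_fin fM.
rewrite integral_cst//= lebesgue_measure_itv/= lte_fin EFinM.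
case: ltP => [_|yx]; first by rewrite EFinB.
have -> : y = x by apply/le_anti/andP.
by rewrite subrr.
Qed.

End pdf_theory.

(* If [p / q] is nonincreasing across the point [x], then cross-multiplying
   the two masses on either side of [x] compares the distribution functions. *)
Lemma dcdf_le_mlr p q x : is_pdf p -> is_pdf q ->
  (forall s t, s <= x -> x < t -> q s * p t <= p s * q t) ->
  dcdf q x <= dcdf p x.
Proof.
move=> pp pq pqx; have [mp p0 _] := pp; have [mq q0 _] := pq.
have mE f (A : set R) : measurable_fun setT f -> measurable_fun A (fun x => (f x)%:E).
  by move=> mf; apply/measurable_EFinP; exact: measurable_funTS.
have step t : x < t -> dcdf q x * p t <= dcdf p x * q t.
  move=> xt; rewrite -lee_fin !EFinM -(dcdfE pq) -(dcdfE pp).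
  do 2 (rewrite -ge0_integralZr//; [|exact: mE|by move=> *; rewrite lee_fin|
    by rewrite lee_fin]).
  apply: ge0_le_integral => //.
  - by move=> s _; rewrite mule_ge0 ?lee_fin.
  - by apply: emeasurable_funM => //; exact: mE.
  - by apply: emeasurable_funM => //; exact: mE.
  - by move=> s; rewrite /= in_itv/= => sx; rewrite -!EFinM lee_fin pqx.
(* [step] was the integration over [s <= x]; integrating it over [t > x] gives this inequality, in
   which the products of the two distribution functions cancel. *)
suff : dcdf q x * (1 - dcdf p x) <= dcdf p x * (1 - dcdf q x) by lra.
rewrite -lee_fin !EFinM -(dcdf_tail pq) -(dcdf_tail pp).
do 2 (rewrite -ge0_integralZl//; [|exact: mE|by move=> *; rewrite lee_fin|
  by rewrite lee_fin dcdf_ge0]).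
apply: ge0_le_integral => //.
- by move=> s _; rewrite mule_ge0 ?lee_fin ?dcdf_ge0.
- by apply: emeasurable_funM => //; exact: mE.
- by apply: emeasurable_funM => //; exact: mE.
- by move=> s; rewrite /= in_itv/= andbT => sx; rewrite -!EFinM lee_fin step.
Qed.

End pdf.

(** * The image of the chi-square law under the exponential substitution *)

Section log_substitution.
Context {R : realType}.
Implicit Types (x y s t : R).
Local Notation mu := (@lebesgue_measure R).
Variables (k a : R).
Hypotheses (k0 : 0 < k) (a0 : 0 < a).

Let F s : R := k * ln (1 + s).
Let F' s : R := k / (1 + s).
Let Finv y : R := expR (y / k) - 1.

(* The density of [exp (Y / k) - 1] when Y has density [chid a]. *)
Definition log_chid s : R :=
  if 0 < s then chid a (k * ln (1 + s)) * (k / (1 + s)) else 0.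

Let FV s y : 0 < s -> (F s <= y) = (s <= Finv y).
Proof.
move=> s0; have s1 : 0 < 1 + s by rewrite addr_gt0.
rewrite /F /Finv mulrC -ler_pdivlMr// -[in LHS](@expRK R (y / k)).
by rewrite ler_ln ?posrE ?expR_gt0// lerBrDl.
Qed.

Let VF s y : 0 < s -> (y <= F s) = (Finv y <= s).
Proof.
move=> s0; have s1 : 0 < 1 + s by rewrite addr_gt0.
rewrite /F /Finv mulrC -ler_pdivrMr// -[in LHS](@expRK R (y / k)).
by rewrite ler_ln ?posrE ?expR_gt0// lerBlDl.
Qed.

Let Finv_gt0 y : (0 < Finv y) = (0 < y).
Proof. by rewrite /Finv subr_gt0 expR_gt1 pmulr_lgt0 ?invr_gt0. Qed.

Let F_gt0 s : 0 < s -> 0 < F s.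
Proof. by move=> s0; rewrite mulr_gt0// ln_gt0// ltrDl. Qed.

Let dF s : 0 < s -> is_derive s (1 : R) F (F' s).
Proof.
move=> s0; have s1 : 0 < 1 + s by rewrite addr_gt0.
have c1 : is_derive s (1 : R) (cst 1 : R -> R) 0 by exact: is_derive_cst.
have i1 : is_derive s (1 : R) (id : R -> R) 1 by exact: is_derive_id.
have d1 : is_derive s (1 : R) (fun t => 1 + t) 1.
  by apply: (is_derive_eq (is_deriveD c1 i1)); rewrite add0r.
apply: (is_derive_eq (is_deriveZ k (is_derive1_comp (is_derive1_ln s1) d1))).
by rewrite mulr1.
Qed.

Let cF s : 0 < s -> {for s, continuous F}.
Proof. by move=> /dF; exact: is_derive1_continuous. Qed.

Let cF' s : 0 < s -> (derive1 F) x @[x --> s] --> (derive1 F) s.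
Proof.
move=> s0; have E t : 0 < t -> (derive1 F) t = F' t.
  by move=> t0; rewrite derive1E; have [_ ->] := dF t0.
rewrite E//; apply: (@cvg_trans _ (F' x @[x --> s])).
  by apply: near_eq_cvg; near=> t; rewrite E//; near: t; exact: lt_nbhsr.
apply: (@continuousM _ _ (cst k) (fun x : R => (1 + x)^-1) s); first exact: cvg_cst.
apply: (@continuousV _ _ (fun x : R => 1 + x) s).
  by rewrite gt_eqF// addr_gt0.
by apply: continuousD; [exact: cvg_cst|exact: cvg_id].
Unshelve. all: by end_near. Qed.

Let cG y : 0 < y -> {for y, continuous (chid a)}.
Proof.
move=> y0; pose g x : R := x `^ (a - 1) * expR (- x / 2) / (2 `^ a * gamma_fun a).
have E x : 0 < x -> chid a x = g x by rewrite /chid => ->.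
rewrite /prop_for /continuous_at E//; apply: (@cvg_trans _ (g x @[x --> y])).
  by apply: near_eq_cvg; near=> t; rewrite E//; near: t; exact: lt_nbhsr.
apply: (@continuousM _ _ (fun x => x `^ (a - 1) * expR (- x / 2)) (cst _) y); last exact: cvg_cst.
apply: continuousM; first exact: (is_derive1_continuous (is_derive1_powR _ y0)).
apply: (@continuous_comp _ _ _ (fun x : R => - x / 2) expR); last exact: continuous_expR.
by apply: (@continuousM _ _ (fun x : R => - x) (cst _) y);
  [exact: opp_continuous|exact: cvg_cst].
Unshelve. all: by end_near. Qed.

Let integral_cc u v : 0 < u -> u <= v ->
  (\int[mu]_(y in `[F u, F v]) (chid a y)%:E =
   \int[mu]_(s in `[u, v]) (log_chid s)%:E)%E.
Proof.
move=> u0 uv; have v0 : 0 < v := lt_le_trans u0 uv.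
rewrite integration_by_substitution_increasing//.
- apply: eq_integral => s; rewrite inE/= in_itv/= => /andP[us _].
  have s0 : 0 < s := lt_le_trans u0 us.
  rewrite /log_chid s0 -[((_ * _)%R s)]/(chid a (F s) * (derive1 F) s).
  by rewrite derive1E; have [_ ->] := dF s0.
- move=> x y; rewrite !in_itv/= => /andP[ux _] /andP[uy _] xy.
  have x0 := lt_le_trans u0 ux; have y0 := lt_le_trans u0 uy.
  by rewrite ltr_pM2l// ltr_ln ?posrE ?addr_gt0// ltrD2l.
- move=> x; rewrite in_itv/= => /andP[ux _]; apply: cF'; exact: lt_trans ux.
- by apply/cvg_ex; exists ((derive1 F) u); apply: cvg_at_right_filter; exact: cF'.
- by apply/cvg_ex; exists ((derive1 F) v); apply: cvg_at_left_filter; exact: cF'.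
- split.
  + move=> x; rewrite in_itv/= => /andP[ux _].
    by have [] := dF (lt_trans u0 ux).
  + by apply: cvg_at_right_filter; exact: cF.
  + by apply: cvg_at_left_filter; exact: cF.
- apply: continuous_in_subspaceT => y; rewrite inE/= in_itv/= => /andP[uy _].
  by apply: cG; apply: lt_le_trans uy; exact: F_gt0.
Qed.

Let mE (g : R -> R) (A : set R) : measurable_fun setT g -> measurable_fun A (fun x : R => (g x)%:E).
Proof. by move=> mg; apply/measurable_EFinP; exact: measurable_funTS. Qed.

Lemma measurable_log_chid : measurable_fun setT log_chid.
Proof.
have m1 : measurable_fun setT (fun s : R => 1 + s).
  by apply: measurable_funD.
apply: measurable_fun_ifT => //; first exact: measurable_fun_ltr.
apply: measurable_funM.
  apply: (measurableT_comp (measurable_chid a)).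
  apply: measurable_funM; first exact: measurable_cst.
  exact: (measurableT_comp (@measurable_ln R) m1).
apply: measurable_funM; first exact: measurable_cst.
exact: (measurableT_comp measurable_inv m1).
Qed.

Lemma log_chid_ge0 s : 0 <= log_chid s.
Proof.
rewrite /log_chid; case: ifPn => // s0.
by rewrite mulr_ge0 ?chid_ge0// divr_ge0// ltW// addr_gt0.
Qed.

(** The substitution rule applies on compact intervals away from 0, where [chid a] may blow up
    ([a < 1]) or jump ([a = 1]); monotone convergence extends it to increasing unions. Letting [u n]
    tend to 0, the choice [v n = n + 1] yields the total mass and a constant [v] the distribution
    function. *)
Let integral_bigcup (u v : nat -> R) :
  (forall n, 0 < u n) -> (forall n, u n <= v n) ->
  (forall m n, (m <= n)%N -> u n <= u m) ->
  (forall m n, (m <= n)%N -> v m <= v n) ->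
  (\int[mu]_(y in [set y | exists n, (u n <= Finv y <= v n)%R]) (chid a y)%:E =
   \int[mu]_(s in [set s | exists n, (u n <= s <= v n)%R]) (log_chid s)%:E)%E.
Proof.
move=> u0 uv du iv.
have v0 n : 0 < v n := lt_le_trans (u0 n) (uv n).
pose A n : set R := `[u n, v n]%classic.
pose B n : set R := `[F (u n), F (v n)]%classic.
have -> : [set s | exists n, u n <= s <= v n] = \bigcup_n A n.
  apply/seteqP; split => s /=.
    by move=> [n uv_]; exists n => //; rewrite /A/= in_itv.
  by move=> [n _]; rewrite /A/= in_itv; exists n.
have -> : [set y | exists n, u n <= Finv y <= v n] = \bigcup_n B n.
  apply/seteqP; split => s /=.
    by move=> [n uv_]; exists n => //; rewrite /B/= in_itv/= FV// VF.
  by move=> [n _]; rewrite /B/= in_itv/= FV// VF//; exists n.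
have cA : (\int[mu]_(s in A n) (log_chid s)%:E)%E @[n --> \oo] -->
    (\int[mu]_(s in \bigcup_n A n) (log_chid s)%:E)%E.
  apply: ge0_nondecreasing_set_cvg_integral.
  - move=> m n mn; rewrite subsetEset => s; rewrite /A/= !in_itv/= => /andP[us sv].
    by rewrite (le_trans (du _ _ mn) us) (le_trans sv (iv _ _ mn)).
  - by move=> n; exact: measurable_itv.
  - by move=> n; apply: mE; exact: measurable_log_chid.
  - by move=> n s _; rewrite lee_fin log_chid_ge0.
have cB : (\int[mu]_(s in B n) (chid a s)%:E)%E @[n --> \oo] -->
    (\int[mu]_(s in \bigcup_n B n) (chid a s)%:E)%E.
  apply: ge0_nondecreasing_set_cvg_integral.
  - move=> m n mn; rewrite subsetEset => s; rewrite /B/= !in_itv/= !FV// !VF//.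
    by move=> /andP[us sv]; rewrite (le_trans (du _ _ mn) us) (le_trans sv (iv _ _ mn)).
  - by move=> n; exact: measurable_itv.
  - by move=> n; apply: mE; exact: measurable_chid.
  - by move=> n s _; rewrite lee_fin chid_ge0.
have E n : (\int[mu]_(s in B n) (chid a s)%:E = \int[mu]_(s in A n) (log_chid s)%:E)%E.
  exact: integral_cc.
rewrite -(cvg_lim _ cB)// -(cvg_lim _ cA)//.
by congr (limn _); apply/funext => n; exact: E.
Qed.

Let u_ s n : R := s / n.+1%:R.

Let u_gt0 s n : 0 < s -> 0 < u_ s n.
Proof. by move=> s0; rewrite divr_gt0. Qed.

Let u_le s n : 0 < s -> u_ s n <= s.
Proof. by move=> s0; rewrite /u_ ler_pdivrMr// ler_peMr ?ler1n// ltW. Qed.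

Let u_noninc s m n : 0 < s -> (m <= n)%N -> u_ s n <= u_ s m.
Proof.
move=> s0 mn; rewrite /u_ ler_pM2l// lef_pV2 ?posrE//.
by rewrite ler_nat ltnS.
Qed.

Let u_ex s t : 0 < s -> 0 < t -> exists n, u_ s n <= t.
Proof.
move=> s0 t0; exists (Num.truncn (s / t)); rewrite /u_ ler_pdivrMr// mulrC.
by rewrite -ler_pdivrMr//; apply: ltW; exact: truncnS_gt.
Qed.

Lemma integral_log_chid : (\int[mu]_s (log_chid s)%:E = 1)%E.
Proof.
have h1 n : u_ 1 n <= n.+1%:R.
  by apply: (le_trans (u_le n ltr01)); rewrite ler1n.
have h2 m n : (m <= n)%N -> m.+1%:R <= n.+1%:R :> R.
  by move=> mn; rewrite ler_nat ltnS.
have H := integral_bigcup (fun n => u_gt0 n ltr01) h1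
  (fun m n => u_noninc ltr01) h2.
have DE s : (exists n, u_ 1 n <= s <= n.+1%:R) <-> 0 < s.
  split=> [[n /andP[us _]]|s0]; first by apply: lt_le_trans us; exact: u_gt0.
  have [n hn] := u_ex ltr01 s0.
  pose N := maxn n (Num.truncn s); exists N; apply/andP; split.
    by apply: (le_trans (u_noninc ltr01 (leq_maxl n (Num.truncn s)))).
  apply: (@le_trans _ _ (Num.truncn s).+1%:R); first exact/ltW/truncnS_gt.
  by rewrite ler_nat ltnS leq_maxr.
transitivity (\int[mu]_(s in [set s | exists n, (u_ 1 n <= s <= n.+1%:R)%R]) (log_chid s)%:E)%E.
  rewrite [RHS]integral_mkcond; apply: eq_integral => s _; rewrite patchE.
  case: ifPn => //; rewrite notin_setE/= DE => /negP s0.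
  by rewrite /log_chid (negbTE s0).
rewrite -H -(integral_chid a0).
rewrite integral_mkcond; apply: eq_integral => s _; rewrite patchE.
case: ifPn => //; rewrite notin_setE/= DE Finv_gt0 => /negP s0.
by rewrite /chid (negbTE s0).
Qed.

Lemma log_chid_pdf : is_pdf log_chid.
Proof.
split; [exact: measurable_log_chid|exact: log_chid_ge0|exact: integral_log_chid].
Qed.

Lemma dcdf_log_chid s : 0 < s -> dcdf log_chid s = dcdf (chid a) (k * ln (1 + s)).
Proof.
move=> s0; congr fine.
have := integral_bigcup (fun n => u_gt0 n s0) (v := fun=> s) (fun n => u_le n s0)
  (fun m n => u_noninc s0) (fun _ _ _ => lexx s).
have DE t : (exists n, u_ s n <= t <= s) <-> 0 < t <= s.
  split=> [[n /andP[us ->]]|/andP[t0 ts]].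
    by rewrite andbT; apply: lt_le_trans us; exact: u_gt0.
  by have [n hn] := u_ex s0 t0; exists n; rewrite hn.
move=> H.
transitivity (\int[mu]_(t in [set t | exists n, (u_ s n <= t <= s)%R]) (log_chid t)%:E)%E.
  rewrite [LHS]integral_mkcond [RHS]integral_mkcond; apply: eq_integral => t _.
  rewrite !patchE mem_setE in_itv/=.
  have -> : (t \in [set t | exists n, (u_ s n <= t <= s)%R]) = (0 < t <= s).
    by apply/idP/idP; rewrite inE/= => /DE.
  by case: (ltP 0 t) => //= t0; rewrite /log_chid ltNge t0/= if_same.
rewrite -H [LHS]integral_mkcond [RHS]integral_mkcond; apply: eq_integral => t _.
rewrite !patchE mem_setE in_itv/= -/(F s) VF//.
have -> : (t \in [set y | exists n, (u_ s n <= Finv y <= s)%R]) = (0 < t) && (Finv t <= s).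
  by apply/idP/idP; rewrite inE/= DE Finv_gt0.
case: (ltP 0 t) => //= t0; rewrite /chid ltNge t0/=.
by rewrite if_same.
Qed.

End log_substitution.

(** * Elementary inequalities for the exponential and the logarithm *)

Section exp_ln_bounds.
Context {R : realType}.
Implicit Types (x y s t : R).

Lemma expR_ge_sum n x : 0 <= x -> \sum_(i < n) x ^+ i / i`!%:R <= expR x.
Proof.
move=> x0; rewrite -(big_mkord xpredT (fun i => x ^+ i / i`!%:R)) /expR.
apply: (nondecreasing_cvgn_le _ (is_cvg_series_exp_coeff x) n).
apply/nondecreasing_seqP => m; rewrite /series/= big_nat_recr//= lerDl.
by rewrite /exp_coeff divr_ge0 ?exprn_ge0.
Qed.

Lemma expR_ge_quad x : 0 <= x -> 1 + x + x ^+ 2 / 2 <= expR x.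
Proof.
move=> x0; apply: le_trans (expR_ge_sum 3 x0).
rewrite !big_ord_recr big_ord0/= !factS fact0 expr0 expr1.
by lra.
Qed.

(** The difference vanishes at 0 and has derivative [t^2 / ((1 + t) (2 + t)^2)], so the mean value
    theorem applies. *)
Lemma ln1D_ge y : 0 <= y -> 2 * y / (2 + y) <= ln (1 + y).
Proof.
rewrite le_eqVlt => /predU1P[<-|y0]; first by rewrite mulr0 mul0r addr0 ln1.
pose f t := ln (1 + t) - 2 * (t / (2 + t)).
pose df t := (1 + t)^-1 - 2 * (2 / (2 + t) ^+ 2).
have dD (c t : R) : is_derive t (1 : R) (fun u => c + u) 1.
  have c1 : is_derive t (1 : R) (cst c : R -> R) 0 by exact: is_derive_cst.
  have i1 : is_derive t (1 : R) (id : R -> R) 1 by exact: is_derive_id.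
  by apply: (is_derive_eq (is_deriveD c1 i1)); rewrite add0r.
have dfE t : 0 <= t -> is_derive t (1 : R) f (df t).
  move=> t0; have t1 : 0 < 1 + t by rewrite ltr_wpDr.
  have t2 : 0 < 2 + t by rewrite ltr_wpDr.
  have d1 := is_derive1_comp (is_derive1_ln t1) (dD 1 t).
  have n2 : 2 + t != 0 by rewrite gt_eqF.
  have d2 := @is_deriveV _ (fun u => 2 + u) t _ 1 n2 (dD 2 t).
  have i1 : is_derive t (1 : R) (id : R -> R) 1 by exact: is_derive_id.
  have d3 := is_deriveM i1 d2.
  apply: (is_derive_eq (is_deriveB d1 (is_deriveZ 2 d3))).
  by rewrite /df /GRing.scale/=; field; rewrite !gt_eqF.
have [||c cI E] := @MVT R f df 0 y y0.
- by move=> t; rewrite in_itv/= => /andP[t0 _]; apply: dfE; exact: ltW.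
- apply: continuous_in_subspaceT => t; rewrite inE/= in_itv/= => /andP[t0 _].
  exact: (is_derive1_continuous (dfE t t0)).
move: cI; rewrite in_itv/= => /andP[c0 _].
suff : 0 <= f y - f 0.
  by rewrite /f addr0 ln1 mul0r mulr0 subr0 subr0 subr_ge0 mulrA.
rewrite E subr0 mulr_ge0 ?(ltW y0)//.
have -> : df c = c ^+ 2 / ((1 + c) * (2 + c) ^+ 2).
  by rewrite /df; field; rewrite !gt_eqF// ltr_wpDr// ltW.
by rewrite divr_ge0 ?sqr_ge0// mulr_ge0 ?sqr_ge0// addr_ge0// ltW.
Qed.

(** Cross-multiplied form of the decrease of [(1 - exp (- v)) / v]. After factoring
    [exp (- t) = exp (- s) exp (- (t - s))], two tangent-line bounds for the exponential suffice. *)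
Lemma onemexpN_slope s t : 0 < s -> s <= t ->
  (1 - expR (- t)) * s <= (1 - expR (- s)) * t.
Proof.
move=> s0 st; have es : 0 < expR (- s) := expR_gt0 _.
have E1 : expR (- t) = expR (- s) * expR (- (t - s)).
  by rewrite -expRD; congr expR; lra.
have E2 : 1 - (t - s) <= expR (- (t - s)) by apply: le_trans (expR_ge1Dx _); lra.
have E3 : s * expR (- s) <= 1 - expR (- s).
  have : expR (- s) * (1 + s) <= expR (- s) * expR s.
    by rewrite ler_pM2l// expR_ge1Dx.
  by rewrite -expRD addNr expR0; lra.
rewrite E1.
have : expR (- s) * (1 - (t - s)) <= expR (- s) * expR (- (t - s)) by rewrite ler_pM2l.
nra.
Qed.

(** Cross-multiplied form of the increase of [sinh v / v]. With [t = s + d], the addition formula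
    and the bounds [sinh d >= d], [cosh d >= 1], [tanh s <= s] give [s sinh t >= s sinh s + s d cosh
    s >= t sinh s]. *)
Lemma sinh_slope s t : 0 < s -> s <= t ->
  (expR s - expR (- s)) * t <= (expR t - expR (- t)) * s.
Proof.
move=> s0 st; pose d := t - s; have d0 : 0 <= d by rewrite subr_ge0.
have es : 0 < expR (- s) := expR_gt0 _.
have es1 : expR (- s) < expR s by rewrite ltr_expR; lra.
have ed : expR d * expR (- d) = 1 by rewrite -expRD subrr expR0.
have ed0 : 0 < expR (- d) := expR_gt0 _.
have q := expR_ge_quad d0.
have sinhd : 2 * d <= expR d - expR (- d).
  have h2 : expR (- d) * (1 + d + d ^+ 2 / 2) <= 1.
    by rewrite -[leRHS]ed mulrC ler_pM2r.
  suff : expR (- d) <= 1 - d + d ^+ 2 / 2 by lra.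
  have : 1 <= (1 - d + d ^+ 2 / 2) * (1 + d + d ^+ 2 / 2).
    have -> : (1 - d + d ^+ 2 / 2) * (1 + d + d ^+ 2 / 2) = 1 + (d ^+ 2 / 2) ^+ 2 by field.
    by rewrite lerDl sqr_ge0.
  have p : 0 < 1 + d + d ^+ 2 / 2 by rewrite ltr_wpDr ?divr_ge0 ?sqr_ge0// ltr_wpDr.
  move=> h1; rewrite -(ler_pM2r p); exact: (le_trans h2 h1).
have coshd : 2 <= expR d + expR (- d).
  have : 0 <= (expR d - 1) ^+ 2 * expR (- d) by rewrite mulr_ge0 ?sqr_ge0// ltW.
  have -> : (expR d - 1) ^+ 2 * expR (- d) =
    expR d * (expR d * expR (- d)) - 2 * (expR d * expR (- d)) + expR (- d) by ring.
  by rewrite ed; lra.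
(* This is [ln1D_ge] at [exp (2 s) - 1], whose left side is then [2 tanh s]. *)
have tanhs : expR s - expR (- s) <= s * (expR s + expR (- s)).
  have e2 : 0 <= expR (s *+ 2) - 1 by rewrite subr_ge0 -[leLHS]expR0 ler_expR mulrn_wge0// ltW.
  have := ln1D_ge e2; rewrite [in ln _]addrC subrK expRK.
  have es2 : expR (s *+ 2) = expR s * expR s by rewrite mulr2n expRD.
  have ess : expR s * expR (- s) = 1 by rewrite -expRD subrr expR0.
  rewrite ler_pdivrMr; last by rewrite ltr_pwDl.
  rewrite es2.
  move=> h.
  have : (2 * (expR s * expR s - 1)) * expR (- s) <= s *+ 2 * (2 + (expR s * expR s - 1)) * expR (- s).
    by rewrite ler_pM2r.
  have -> : 2 * (expR s * expR s - 1) * expR (- s) = 2 * (expR s * (expR s * expR (- s)) - expR (- s)) by ring.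
  have -> : s *+ 2 * (2 + (expR s * expR s - 1)) * expR (- s) = 2 * s * (expR (- s) + expR s * (expR s * expR (- s))) by rewrite mulr2n; ring.
  by rewrite ess; lra.
have -> : t = s + d by rewrite /d; lra.
have -> : - (s + d) = - s + - d by lra.
rewrite (expRD s d) (expRD (- s) (- d)).
move: (expR s) (expR (- s)) (expR d) (expR (- d)) es es1 ed0 sinhd coshd tanhs => a b c e b0 ab e0 h1 h2 h3.
have a0 := ltW (lt_trans b0 ab); have ab0 := ltW ab.
have H1 : 0 <= (a - b) * s * (c + e - 2).
  by rewrite mulr_ge0 ?mulr_ge0 ?subr_ge0 ?(ltW s0).
have H2 : 0 <= (a + b) * s * (c - e - 2 * d).
  by rewrite mulr_ge0 ?mulr_ge0 ?subr_ge0 ?addr_ge0 ?(ltW s0) ?(ltW b0).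
have H3 : 0 <= d * (s * (a + b) - (a - b)) by rewrite mulr_ge0// subr_ge0.
lra.
Qed.

End exp_ln_bounds.

(** * The sandwich of the beta prime distribution function *)

Section log_comparison.
Context {R : realType}.
Implicit Types (x y s t : R).
Local Opaque gamma_fun.

Lemma chid_pdf (a : R) : 0 < a -> is_pdf (chid a).
Proof.
move=> a0; split; [exact: measurable_chid|by move=> x; exact: chid_ge0|].
exact: integral_chid.
Qed.

Lemma beta_prime_pdf (a b : R) : 0 < a -> 0 < b -> is_pdf (beta_prime a b).
Proof.
move=> a0 b0; split; [exact: measurable_beta_prime|by move=> x; exact: beta_prime_ge0|].
exact: integral_beta_prime.
Qed.

Let ln1D_gt0 s : 0 < s -> 0 < ln (1 + s).
Proof. by move=> s0; rewrite ln_gt0// ltrDl. Qed.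

Let powR1D s (c : R) : 0 < s -> (1 + s) `^ c = expR (c * ln (1 + s)).
Proof. by move=> s0; rewrite /powR gt_eqF// addr_gt0. Qed.

Section cross.
Variables (a b k : R).
Hypotheses (a0 : 0 < a) (b0 : 0 < b) (k0 : 0 < k).

Let Cb := gamma_fun (a + b) / (gamma_fun a * gamma_fun b).
Let Cl := k `^ (a - 1) * k / (2 `^ a * gamma_fun a).

Let Cb_gt0 : 0 < Cb.
Proof. by rewrite divr_gt0 ?mulr_gt0 ?gamma_fun_gt0 ?addr_gt0. Qed.

Let Cl_gt0 : 0 < Cl.
Proof. by rewrite divr_gt0 ?chid_norm_gt0// mulr_gt0 ?powR_gt0. Qed.

Let beta_primeE s : 0 < s -> beta_prime a b s =
  Cb * (s `^ (a - 1) * expR (- (a + b) * ln (1 + s))).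
Proof. by move=> s0; rewrite /beta_prime s0 powR1D// mulrC. Qed.

Let log_chidE s : 0 < s -> log_chid k a s =
  Cl * (ln (1 + s) `^ (a - 1) * expR (- (k / 2 + 1) * ln (1 + s))).
Proof.
move=> s0; have l0 := ln1D_gt0 s0; have s1 : 0 < 1 + s by rewrite addr_gt0.
rewrite /log_chid s0 /chid mulr_gt0// powRM ?(ltW k0) ?(ltW l0)//.
have -> : - (k / 2 + 1) * ln (1 + s) = - (k * ln (1 + s)) / 2 + - ln (1 + s) by field.
rewrite expRD [expR (- ln _)]expRN lnK ?posrE// /Cl.
have := chid_norm_gt0 a0; move: (2 `^ a * _) => c c0.
by field; rewrite !gt_eqF.
Qed.

(** Normalising constants and common exponentials are collected in [M], so comparing the cross
    products involves only two powers of order [a - 1] and the exponential left by the different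
    exponents of [1 + s]. *)
Let crossE s t : 0 < s -> s < t -> exists2 M, 0 < M &
  log_chid k a s * beta_prime a b t = (t * ln (1 + s)) `^ (a - 1) * M /\
  beta_prime a b s * log_chid k a t = (s * ln (1 + t)) `^ (a - 1) *
    expR ((a + b - (k / 2 + 1)) * (ln (1 + t) - ln (1 + s))) * M.
Proof.
move=> s0 st; have t0 := lt_trans s0 st.
rewrite !beta_primeE// !log_chidE//.
have ls := ln1D_gt0 s0; have lt := ln1D_gt0 t0.
rewrite !powRM ?(ltW s0) ?(ltW t0) ?(ltW ls) ?(ltW lt)//.
move: Cl_gt0 Cb_gt0; move: Cl Cb => cl cb cl0 cb0.
move: (ln (1 + s)) (ln (1 + t)) => x y.
exists (cl * cb * (expR (- (k / 2 + 1) * x) * expR (- (a + b) * y))).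
  by rewrite !mulr_gt0 ?expR_gt0.
split; first by ring.
have -> : (a + b - (k / 2 + 1)) * (y - x) =
  - (a + b) * x + - (k / 2 + 1) * y - (- (k / 2 + 1) * x + - (a + b) * y) by ring.
rewrite expRB !expRD.
have := expR_gt0 (- (k / 2 + 1) * x); have := expR_gt0 (- (a + b) * y).
move: (expR _) (expR _) (expR _) (expR _) => e1 e2 e3 e4 e10 e20.
by field; rewrite !gt_eqF.
Qed.

Lemma beta_prime_ge_log_chid x : 0 < x ->
  (forall s t, 0 < s -> s < t -> (t * ln (1 + s)) `^ (a - 1) <=
    (s * ln (1 + t)) `^ (a - 1) *
      expR ((a + b - (k / 2 + 1)) * (ln (1 + t) - ln (1 + s)))) ->
  dcdf (chid a) (k * ln (1 + x)) <= dcdf (beta_prime a b) x.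
Proof.
move=> x0 H; rewrite -dcdf_log_chid//; apply: dcdf_le_mlr.
- exact: beta_prime_pdf.
- exact: log_chid_pdf.
- move=> s t sx xt; have [s0|s0] := leP s 0.
    by rewrite /log_chid /beta_prime ltNge s0/= !mul0r.
  have st := le_lt_trans sx xt.
  have [M M0 [-> ->]] := crossE s0 st.
  by rewrite ler_pM2r//; exact: H.
Qed.

Lemma beta_prime_le_log_chid x : 0 < x ->
  (forall s t, 0 < s -> s < t ->
    (s * ln (1 + t)) `^ (a - 1) *
      expR ((a + b - (k / 2 + 1)) * (ln (1 + t) - ln (1 + s))) <=
    (t * ln (1 + s)) `^ (a - 1)) ->
  dcdf (beta_prime a b) x <= dcdf (chid a) (k * ln (1 + x)).
Proof.
move=> x0 H; rewrite -dcdf_log_chid//; apply: dcdf_le_mlr.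
- exact: log_chid_pdf.
- exact: beta_prime_pdf.
- move=> s t sx xt; have [s0|s0] := leP s 0.
    by rewrite /log_chid /beta_prime ltNge s0/= !mul0r.
  have st := le_lt_trans sx xt.
  have [M M0 [-> ->]] := crossE s0 st.
  by rewrite ler_pM2r//; exact: H.
Qed.

End cross.

(* Monotonicity of [(1 - exp (- v)) / v] at [v = ln (1 + s)]. *)
Let slope1 s t : 0 < s -> s < t ->
  t * ln (1 + s) <= s * ln (1 + t) * expR (ln (1 + t) - ln (1 + s)).
Proof.
move=> s0 st; have t0 := lt_trans s0 st.
have st1 : ln (1 + s) <= ln (1 + t) by rewrite ler_ln ?posrE ?addr_gt0// lerD2l ltW.
have := onemexpN_slope (ln1D_gt0 s0) st1.
have s1 : 0 < 1 + s by rewrite addr_gt0.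
have t1 : 0 < 1 + t by rewrite addr_gt0.
rewrite expRB !expRN !lnK ?posrE//.
have -> : 1 - (1 + t)^-1 = t / (1 + t) by field; rewrite gt_eqF.
have -> : 1 - (1 + s)^-1 = s / (1 + s) by field; rewrite gt_eqF.
move: (ln _) (ln _) => x y; rewrite mulrAC ler_pdivrMr// => h.
by apply: (le_trans h); rewrite le_eqVlt; apply/orP; left; apply/eqP; field; rewrite gt_eqF.
Qed.

(* Monotonicity of [sinh v / v] at [v = ln (1 + s) / 2]. *)
Let slope2 s t : 0 < s -> s < t ->
  s * ln (1 + t) * expR ((ln (1 + t) - ln (1 + s)) / 2) <= t * ln (1 + s).
Proof.
move=> s0 st; have t0 := lt_trans s0 st.
have s1 : 0 < 1 + s by rewrite addr_gt0.
have t1 : 0 < 1 + t by rewrite addr_gt0.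
have st1 : ln (1 + s) / 2 <= ln (1 + t) / 2.
  by rewrite ler_pM2r ?invr_gt0// ler_ln ?posrE// lerD2l ltW.
have ls0 : 0 < ln (1 + s) / 2 by rewrite divr_gt0 ?ln1D_gt0.
have h := sinh_slope ls0 st1.
have E u : 0 < 1 + u -> expR (ln (1 + u) / 2) - expR (- (ln (1 + u) / 2)) =
    u * expR (- (ln (1 + u) / 2)).
  move=> u1; have e1 : expR (ln (1 + u) / 2) * expR (ln (1 + u) / 2) = 1 + u.
    by rewrite -expRD -splitr lnK.
  have e2 : expR (ln (1 + u) / 2) * expR (- (ln (1 + u) / 2)) = 1.
    by rewrite -expRD subrr expR0.
  move: (expR (ln (1 + u) / 2)) (expR (- _)) e1 e2 => e e' e1 e2.
  have -> : u = e * e - 1 by rewrite e1; lra.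
  by rewrite mulrBl -mulrA e2 mulr1 mul1r.
move: h; rewrite !E// => h.
have -> : (ln (1 + t) - ln (1 + s)) / 2 = ln (1 + t) / 2 + - (ln (1 + s) / 2) by field.
rewrite expRD.
have et : 0 < expR (ln (1 + t) / 2) := expR_gt0 _.
have ett : expR (- (ln (1 + t) / 2)) * expR (ln (1 + t) / 2) = 1 by rewrite -expRD addNr expR0.
move: h; rewrite -(ler_pM2r et).
have -> : t * expR (- (ln (1 + t) / 2)) * (ln (1 + s) / 2) * expR (ln (1 + t) / 2) =
  t * ln (1 + s) / 2 * (expR (- (ln (1 + t) / 2)) * expR (ln (1 + t) / 2)) by ring.
by rewrite ett; lra.
Qed.

Variables (a b : R).
Hypotheses (a0 : 0 < a) (b0 : 0 < b).

Let lnpos s t : 0 < s -> s < t -> 0 < s * ln (1 + t) /\ 0 < t * ln (1 + s).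
Proof.
by move=> s0 st; split; rewrite mulr_gt0 ?ln1D_gt0// (lt_trans s0).
Qed.

Let expRMr x (c : R) : expR (c * x) = expR x `^ c.
Proof. by rewrite mulrC expRM. Qed.

Let powR_le (u v c : R) : 0 <= c -> 0 < u -> u <= v -> u `^ c <= v `^ c.
Proof.
move=> c0 u0 uv; apply: ge0_ler_powR => //; rewrite nnegrE ltW//.
exact: lt_le_trans uv.
Qed.

Let powR_ge (u v c : R) : c <= 0 -> 0 < u -> u <= v -> v `^ c <= u `^ c.
Proof.
move=> c0 u0 uv; have v0 := lt_le_trans u0 uv.
have E w : w `^ c = (w `^ (- c))^-1 by rewrite powRN invrK.
rewrite !E lef_pV2 ?posrE ?powR_gt0//.
by apply: powR_le => //; rewrite oppr_ge0.
Qed.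

(** This identity and the next explain the two values of [k]: the leftover exponential becomes
    itself an [(a - 1)]-th power, so the comparison is [slope1] or [slope2] raised to the power
    [a - 1], reversed when [a <= 1]. *)
Let Elog : a + b - (b *+ 2 / 2 + 1) = a - 1.
Proof. by rewrite mulr2n; field. Qed.

Let Elog' : a + b - ((b *+ 2 + a - 1) / 2 + 1) = (a - 1) / 2.
Proof. by rewrite mulr2n; field. Qed.

Lemma beta_prime_ge_chid x : 1 <= a -> 0 < x ->
  dcdf (chid a) (b *+ 2 * ln (1 + x)) <= dcdf (beta_prime a b) x.
Proof.
move=> a1 x0; apply: beta_prime_ge_log_chid => //; first by rewrite mulrn_wgt0.
move=> s t s0 st; have [p1 p2] := lnpos s0 st.
rewrite Elog expRMr -powRM ?expR_ge0 ?(ltW p1)//.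
by apply: powR_le; [rewrite subr_ge0|exact: p2|exact: slope1].
Qed.

Lemma beta_prime_le_chid x : a <= 1 -> 0 < x ->
  dcdf (beta_prime a b) x <= dcdf (chid a) (b *+ 2 * ln (1 + x)).
Proof.
move=> a1 x0; apply: beta_prime_le_log_chid => //; first by rewrite mulrn_wgt0.
move=> s t s0 st; have [p1 p2] := lnpos s0 st.
rewrite Elog expRMr -powRM ?expR_ge0 ?(ltW p1)//.
by apply: powR_ge; [rewrite subr_le0|exact: p2|exact: slope1].
Qed.

Lemma beta_prime_le_chid_shift x : 1 <= a -> 0 < x ->
  dcdf (beta_prime a b) x <= dcdf (chid a) ((b *+ 2 + a - 1) * ln (1 + x)).
Proof.
move=> a1 x0; apply: beta_prime_le_log_chid => //.
  by rewrite -addrA ltr_pwDl ?mulrn_wgt0// subr_ge0.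
move=> s t s0 st; have [p1 p2] := lnpos s0 st.
rewrite Elog' mulrAC -mulrA expRMr -powRM ?expR_ge0 ?(ltW p1)//.
apply: powR_le; [by rewrite subr_ge0|by rewrite mulr_gt0 ?expR_gt0|exact: slope2].
Qed.

Lemma beta_prime_ge_chid_shift x : a <= 1 -> 0 < b *+ 2 + a - 1 -> 0 < x ->
  dcdf (chid a) ((b *+ 2 + a - 1) * ln (1 + x)) <= dcdf (beta_prime a b) x.
Proof.
move=> a1 k0 x0; apply: beta_prime_ge_log_chid => //.
move=> s t s0 st; have [p1 p2] := lnpos s0 st.
rewrite Elog' mulrAC -mulrA expRMr -powRM ?expR_ge0 ?(ltW p1)//.
apply: powR_ge; [by rewrite subr_le0|by rewrite mulr_gt0 ?expR_gt0|exact: slope2].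
Qed.

End log_comparison.

(** * Probabilities of one standard deviation *)

Section distribution_functions.
Context {R : realType}.
Implicit Types (a b x y s t : R).
Local Notation mu := (@lebesgue_measure R).
Local Opaque gamma_fun.

Lemma dcdf_le0 (f : R -> R) y : (forall x, x <= 0 -> f x = 0) -> y <= 0 -> dcdf f y = 0.
Proof.
move=> f0 y0; rewrite /dcdf integral0_eq// => x /=; rewrite in_itv/= => xy.
by rewrite f0// (le_trans xy).
Qed.

Lemma chid_le0 a x : x <= 0 -> chid a x = 0.
Proof. by rewrite /chid leNgt => /negbTE ->. Qed.

Lemma beta_prime_le0 a b x : x <= 0 -> beta_prime a b x = 0.
Proof. by rewrite /beta_prime leNgt => /negbTE ->. Qed.

Lemma integral_fisher_pdf_itv a b x y : 0 < a -> 0 < b ->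
  (\int[mu]_(t in `[x, y]) (fisher_pdf a b t)%:E =
   \int[mu]_(s in `[(a / b * x)%R, (a / b * y)%R]) (beta_prime a b s)%:E)%E.
Proof.
move=> a0 b0; have c0 : 0 < a / b by rewrite divr_gt0.
pose h t := (\1_(`[x, y]%classic : set R) t)%:E : \bar R.
have mh : measurable_fun setT h.
  by apply/measurable_EFinP; apply: measurable_indic; exact: measurable_itv.
have h0 t : (0 <= h t)%E by rewrite lee_fin.
transitivity (\int[mu]_t (h t * (fisher_pdf a b t)%:E))%E.
  rewrite integral_mkcond; apply: eq_integral => t _.
  by rewrite patchE /h indicE; case: ifPn => _; rewrite ?mul1e ?mul0e.
rewrite (ge0_integral_fisher_pdf a0 b0 mh h0) [RHS]integral_mkcond.
apply: eq_integral => s _; rewrite patchE /h indicE !mem_setE !in_itv/=.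
have -> : (x <= b / a * s) = (a / b * x <= s).
  by rewrite -[in LHS](ler_pM2l c0) mulrA; congr (_ <= _); field; rewrite !gt_eqF.
have -> : (b / a * s <= y) = (s <= a / b * y).
  by rewrite -[in LHS](ler_pM2l c0) mulrA; congr (_ <= _); field; rewrite !gt_eqF.
by case: ifPn => _; rewrite ?mul1e ?mul0e.
Qed.

Lemma chi2_within_sd (k : nat) d (T : measurableType d) (P : probability T R)
    (G : {RV P >-> R}) : (0 < k)%N -> has_law G (chi2_prob k) ->
  let a := k%:R / 2 in
  prob_within_sd G = (dcdf (chid a) (2 * a * (1 + (Num.sqrt a)^-1)) -
                      dcdf (chid a) (2 * a * (1 - (Num.sqrt a)^-1)))%:E.
Proof.
move=> k0 lawG a; have a0 : 0 < a by rewrite divr_gt0// ltr0n.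
have lawG' : has_law G (fun A => \int[mu]_(x in A) (chid a x)%:E)%E.
  by move=> A mA; rewrite lawG// chi2_probE.
rewrite (@prob_within_sd_law _ _ _ _ G (chid a) (measurable_chid a)
  (fun x => chid_ge0 x a0) (@chid_le0 a) lawG' (2 * a) (4 * a * (a + 1))
  (integral_mul_chid a0) (integral_sqr_chid a0)).
have q0 : 0 < Num.sqrt a by rewrite sqrtr_gt0.
(* The variance is [4 a]; writing its root this way lets the mean [2 a] factor out and leaves
   [1 / sqrt a] as the only irrational quantity. *)
have -> : Num.sqrt (4 * a * (a + 1) - (2 * a) ^+ 2) = 2 * a * (Num.sqrt a)^-1.
  have -> : 4 * a * (a + 1) - (2 * a) ^+ 2 = (2 * a * (Num.sqrt a)^-1) ^+ 2.
    by rewrite [RHS]exprMn exprVn sqr_sqrtr ?(ltW a0)//; field; rewrite gt_eqF.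
  by rewrite sqrtr_sqr ger0_norm// mulr_ge0 ?invr_ge0 ?ltW// mulr_gt0.
rewrite dcdf_itv; last first.
- rewrite lerD2l -subr_ge0 opprK; rewrite -mulr2n mulrn_wge0//.
  by rewrite mulr_ge0 ?invr_ge0 ?ltW// mulr_gt0.
- exact: chid_pdf.
by congr (_ - _)%:E; congr dcdf; ring.
Qed.

Lemma fisher_within_sd (m n : nat) d (T : measurableType d) (P : probability T R)
    (X : {RV P >-> R}) : (0 < m)%N -> (5 <= n)%N -> has_law X (fisher_prob m n) ->
  let a := m%:R / 2 in let b := n%:R / 2 in
  let rho := Num.sqrt ((a + b - 1) / (a * (b - 2))) in
  prob_within_sd X = (dcdf (beta_prime a b) (a / (b - 1) * (1 + rho)) -
                      dcdf (beta_prime a b) (a / (b - 1) * (1 - rho)))%:E.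
Proof.
move=> m0 n5 lawX a b rho; have a0 : 0 < a by rewrite divr_gt0// ltr0n.
have n5R : 5 <= n%:R :> R by rewrite (ler_nat _ 5).
have b2 : 2 < b by rewrite /b; lra.
have b0 : 0 < b by lra.
have b1 : 1 < b by lra.
have b10 : 0 < b - 1 by lra.
have b20 : 0 < b - 2 by lra.
have lawX' : has_law X (fun A => \int[mu]_(x in A) (fisher_pdf a b x)%:E)%E.
  by move=> A mA; rewrite lawX// fisher_probE// (leq_trans _ n5).
have f0 x : 0 <= fisher_pdf a b x by exact: fisher_pdf_ge0.
have fn x : x <= 0 -> fisher_pdf a b x = 0.
  move=> x0; rewrite /fisher_pdf beta_prime_le0 ?mulr0//.
  by rewrite mulr_ge0_le0// divr_ge0// ltW.
have c0 : 0 < b / a by rewrite divr_gt0.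
have mom (h g : R -> R) : measurable_fun setT h ->
    (forall x, x <= 0 -> h x * fisher_pdf a b x = 0) ->
    (forall x, 0 <= x -> 0 <= h x) ->
    (forall x, g x = h (b / a * x)) ->
    (\int[mu]_x (h x * fisher_pdf a b x)%:E = \int[mu]_x (g x * beta_prime a b x)%:E)%E.
  move=> mh hn h0 gE.
  (* The scaling formula requires an everywhere nonnegative function. Truncating [h] at 0 changes
     nothing, because both densities vanish on the nonpositive reals. *)
  have mh' : measurable_fun setT (fun x => (Num.max (h x) 0)%:E).
    by apply/measurable_EFinP; apply: measurable_maxr.
  transitivity (\int[mu]_x ((Num.max (h x) 0)%:E * (fisher_pdf a b x)%:E))%E.
    apply: eq_integral => x _; rewrite EFinM.
    have [x0|x0] := leP x 0; first by rewrite -!EFinM hn// fn// mulr0.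
    by rewrite max_l// h0// ltW.
  rewrite (ge0_integral_fisher_pdf a0 b0 mh'); last first.
    by move=> x; rewrite lee_fin le_max lexx orbT.
  apply: eq_integral => x _; rewrite EFinM gE.
  have [x0|x0] := leP x 0; first by rewrite beta_prime_le0// !mule0.
  by rewrite max_l// h0// mulr_ge0// ltW.
have m1 : (\int[mu]_x (x * fisher_pdf a b x)%:E = (b / (b - 1))%:E)%E.
  rewrite (mom id (fun x => b / a * x))//; last first.
    by move=> x x0; rewrite fn// mulr0.
  transitivity (\int[mu]_x ((b / a)%:E * (x * beta_prime a b x)%:E))%E.
    by apply: eq_integral => x _; rewrite -EFinM mulrA.
  have mb : measurable_fun setT (fun x => (x * beta_prime a b x)%:E).
    apply/measurable_EFinP; apply: measurable_funM => //.
    exact: measurable_beta_prime.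
  rewrite ge0_integralZl//; last 2 first.
  - move=> x _; rewrite lee_fin; have [x0|x0] := leP x 0.
      by rewrite beta_prime_le0// mulr0.
    by rewrite mulr_ge0 ?beta_prime_ge0// ltW.
  - by rewrite lee_fin ltW.
  rewrite integral_mul_beta_prime// -EFinM; congr EFin.
  by field; rewrite !gt_eqF.
have m2 : (\int[mu]_x (x ^+ 2 * fisher_pdf a b x)%:E =
    ((b / a) ^+ 2 * (a * (a + 1) / ((b - 1) * (b - 2))))%:E)%E.
  rewrite (mom (fun x => x ^+ 2) (fun x => (b / a) ^+ 2 * x ^+ 2)); last 4 first.
  - exact: exprn_measurable.
  - by move=> x x0; rewrite fn// mulr0.
  - by move=> x _; rewrite sqr_ge0.
  - by move=> x; rewrite [RHS]exprMn.
  transitivity (\int[mu]_x (((b / a) ^+ 2)%:E * (x ^+ 2 * beta_prime a b x)%:E))%E.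
    by apply: eq_integral => x _; rewrite -EFinM; congr EFin; exact: esym (mulrA _ _ _).
  have mb : measurable_fun setT (fun x => (x ^+ 2 * beta_prime a b x)%:E).
    apply/measurable_EFinP; apply: measurable_funM; first exact: exprn_measurable.
    exact: measurable_beta_prime.
  rewrite ge0_integralZl//; last 2 first.
  - by move=> x _; rewrite lee_fin mulr_ge0 ?sqr_ge0 ?beta_prime_ge0.
  - by rewrite lee_fin sqr_ge0.
  by rewrite integral_sqr_beta_prime.
rewrite (@prob_within_sd_law _ _ _ _ X (fisher_pdf a b) (measurable_fisher_pdf a b)
  f0 fn lawX' _ _ m1 m2).
have rho0 : 0 <= rho by exact: sqrtr_ge0.
have rhoE : rho ^+ 2 = (a + b - 1) / (a * (b - 2)).
  by rewrite sqr_sqrtr// divr_ge0 ?mulr_ge0//; lra.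
have -> : Num.sqrt ((b / a) ^+ 2 * (a * (a + 1) / ((b - 1) * (b - 2))) - (b / (b - 1)) ^+ 2) =
    b / (b - 1) * rho.
  have -> : (b / a) ^+ 2 * (a * (a + 1) / ((b - 1) * (b - 2))) - (b / (b - 1)) ^+ 2 =
      (b / (b - 1) * rho) ^+ 2.
    by rewrite [RHS]exprMn rhoE; field; rewrite !gt_eqF.
  by rewrite sqrtr_sqr ger0_norm// mulr_ge0// divr_ge0// ltW.
rewrite integral_fisher_pdf_itv// dcdf_itv; last first.
- have h : 0 <= b / (b - 1) * rho by rewrite mulr_ge0// divr_ge0// ltW.
  by apply: ler_wpM2l; [rewrite divr_ge0// ltW|lra].
- exact: beta_prime_pdf.
by congr (_ - _)%:E; congr dcdf; field; rewrite !gt_eqF.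
Qed.

End distribution_functions.

(** * Elementary distribution functions *)

Section explicit_distribution_functions.
Context {R : realType}.
Implicit Types (a b x y s t : R).
Local Notation mu := (@lebesgue_measure R).
Local Opaque gamma_fun.

Lemma dcdf_FTC (f g F : R -> R) y : 0 < y ->
  (forall x, x <= 0 -> f x = 0) -> (forall x, 0 < x -> f x = g x) ->
  (forall x, 0 <= x -> is_derive x (1 : R) F (g x)) ->
  (forall x, 0 <= x -> {for x, continuous g}) ->
  dcdf f y = F y - F 0.
Proof.
move=> y0 f0 fg dF cg.
have cgy : {within `[0, y], continuous g}.
  apply: continuous_in_subspaceT => x; rewrite inE/= in_itv/= => /andP[x0 _].
  exact: cg.
have cF x : 0 <= x -> {for x, continuous F} by move=> /dF; exact: is_derive1_continuous.
have mg : measurable_fun `]0, y] (fun x => (g x)%:E).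
  apply/measurable_EFinP; apply: (measurable_funS (E := `[0, y]%classic)) => //.
    by apply: subset_itvr; rewrite bnd_simp.
  exact: subspace_continuous_measurable_fun.
have E : (\int[mu]_(x in `]-oo, y]) (f x)%:E = \int[mu]_(x in `]0%R, y]) (g x)%:E)%E.
  rewrite integral_mkcond [RHS]integral_mkcond; apply: eq_integral => x _.
  rewrite !patchE !mem_setE !in_itv/=.
  by have [x0|x0] := ltP 0 x; [rewrite /= fg|rewrite /= f0// if_same].
rewrite /dcdf E integral_itv_obnd_cbnd// (@continuous_FTC2 _ _ F)//.
- split.
  + by move=> x; rewrite in_itv/= => /andP[x0 _]; have [] := dF x (ltW x0).
  + by apply: cvg_at_right_filter; exact: cF.
  + by apply: cvg_at_left_filter; apply: cF; exact: ltW.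
- move=> x; rewrite in_itv/= => /andP[x0 _].
  by rewrite derive1E; have [_ ->] := dF x (ltW x0).
Qed.

Let dexp x : is_derive x (1 : R) (fun t => expR (- t / 2)) (- (2^-1) * expR (- x / 2)).
Proof.
have i1 : is_derive x (1 : R) (id : R -> R) 1 by exact: is_derive_id.
have d1 : is_derive x (1 : R) (fun t : R => - t / 2) (- (2^-1)).
  have := is_deriveZ (- (2^-1)) i1; rewrite /GRing.scale/= mulr1.
  have -> : (fun t : R => - t / 2) = (- (2^-1)) \*: (id : R -> R).
    by apply/funext => t /=; rewrite /GRing.scale/= mulNr mulrC mulNr.
  by [].
by apply: (is_derive_eq (is_derive1_comp (is_derive_expR _) d1)); rewrite mulrC.
Qed.

Lemma dcdf_chid1 y : 0 < y -> dcdf (chid 1) y = 1 - expR (- y / 2).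
Proof.
move=> y0.
have dF x : 0 <= x ->
    is_derive x (1 : R) (fun x => - expR (- x / 2)) (2^-1 * expR (- x / 2)).
  move=> _; apply: (is_derive_eq (is_deriveN (dexp x))).
  by rewrite mulNr opprK.
rewrite (dcdf_FTC y0 _ _ dF).
- by rewrite oppr0 mul0r expR0; lra.
- exact: chid_le0.
- move=> x x0; rewrite /chid x0 subrr powRr0 mul1r gamma_fun1 mulr1 powRr1//.
  by rewrite mulrC.
- move=> x _; apply: (@continuousM _ _ (cst (2^-1)) (fun x => expR (- x / 2)) x).
    exact: cvg_cst.
  exact: (is_derive1_continuous (dexp x)).
Qed.

Let gamma_fun2 : gamma_fun (2 : R) = 1.
Proof. by have := gamma_funS (@ltr01 R); rewrite gamma_fun1 mulr1. Qed.

Lemma dcdf_chid2 y : 0 < y -> dcdf (chid 2) y = 1 - (1 + y / 2) * expR (- y / 2).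
Proof.
move=> y0.
have dF x : 0 <= x -> is_derive x (1 : R) (fun x => - ((1 + 2^-1 * x) * expR (- x / 2)))
    (4^-1 * x * expR (- x / 2)).
  move=> _.
  have c1 : is_derive x (1 : R) (cst 1 : R -> R) 0 by exact: is_derive_cst.
  have i1 : is_derive x (1 : R) (id : R -> R) 1 by exact: is_derive_id.
  have d1 := is_deriveD c1 (is_deriveZ (2^-1) i1).
  apply: (is_derive_eq (is_deriveN (is_deriveM d1 (dexp x)))).
  by rewrite !fctE /= /GRing.scale/=; field.
rewrite (dcdf_FTC y0 _ _ dF).
- by rewrite oppr0 mul0r mulr0 addr0 expR0 mulr1 [2^-1 * _]mulrC; lra.
- exact: chid_le0.
- move=> x x0; rewrite /chid x0 gamma_fun2 mulr1.
  have -> : 2 - 1 = 1 :> R by lra.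
  rewrite powRr1 ?(ltW x0)// (powR_mulrn 2)// expr2.
  by field.
- move=> x _; apply: (@continuousM _ _ (fun x => 4^-1 * x) (fun x => expR (- x / 2)) x).
    by apply: (@continuousM _ _ (cst (4^-1)) id x); [exact: cvg_cst|exact: cvg_id].
  exact: (is_derive1_continuous (dexp x)).
Qed.

Lemma dcdf_beta_prime2 b s : 0 < b -> 0 < s ->
  dcdf (beta_prime 2 b) s = 1 - (1 + s) `^ (- b) * (1 + b * (s / (1 + s))).
Proof.
move=> b0 s0.
pose g x := b * (b + 1) * (x * (1 + x) `^ (- (2 + b))).
(* Obtained by writing the factor [x] of [g] as [(1 + x) - 1] and integrating the two powers
   separately. *)
pose F x := - ((b + 1) * (1 + x) `^ (- b) - b * (1 + x) `^ (- b - 1)).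
have b1 : 0 < b + 1 by rewrite addr_gt0.
have P x : 0 <= x -> (1 + x) `^ (- b - 1) = (1 + x) `^ (- b) / (1 + x).
  move=> x0; have x1 : 0 < 1 + x by rewrite ltr_wpDr.
  by rewrite powRB ?powRr1 ?(ltW x1)//; apply/implyP => _; rewrite gt_eqF.
have P2 x : 0 <= x -> (1 + x) `^ (- b - 1 - 1) = (1 + x) `^ (- b) / (1 + x) / (1 + x).
  move=> x0; have x1 : 0 < 1 + x by rewrite ltr_wpDr.
  by rewrite -P// powRB ?powRr1 ?(ltW x1)//; apply/implyP => _; rewrite gt_eqF.
have dF x : 0 <= x -> is_derive x (1 : R) F (g x).
  move=> x0; have x1 : 0 < 1 + x by rewrite ltr_wpDr.
  have d1 := is_deriveZ (b + 1) (is_derive1_powR1D (- b) x0).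
  have d2 := is_deriveZ b (is_derive1_powR1D (- b - 1) x0).
  apply: (is_derive_eq (is_deriveN (is_deriveB d1 d2))).
  rewrite /GRing.scale/= /g; have -> : - (2 + b) = - b - 1 - 1 by lra.
  by rewrite P2// P//; field; rewrite gt_eqF.
rewrite (dcdf_FTC s0 _ _ dF).
- rewrite /F P ?(ltW s0)// addr0 !powR1.
  by field; rewrite gt_eqF// addr_gt0.
- exact: beta_prime_le0.
- move=> x x0; rewrite /beta_prime x0 gamma_fun2 mul1r.
  have -> : 2 + b = b + 1 + 1 by lra.
  rewrite !gamma_funS//.
  have -> : 2 - 1 = 1 :> R by lra.
  rewrite powRr1 ?(ltW x0)// /g.
  have -> : 2 + b = b + 1 + 1 by lra.
  have := gamma_fun_gt0 b0; move: (gamma_fun b) => c c0.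
  by field; rewrite gt_eqF.
- move=> x x0; apply: (@continuousM _ _ (cst (b * (b + 1)))
    (fun x => x * (1 + x) `^ (- (2 + b))) x); first exact: cvg_cst.
  apply: (@continuousM _ _ id (fun x => (1 + x) `^ (- (2 + b))) x); first exact: cvg_id.
  exact: (is_derive1_continuous (is_derive1_powR1D _ x0)).
Qed.

(** From [t^(a - 1) <= 1 + t <= 2 exp (t / 2)]. The disjunction keeps [t] away from 0 when [a < 1],
    where the density is unbounded. *)
Lemma chid_le a t : 0 < a -> a <= 2 -> (1 <= a) || (1 <= t) ->
  chid a t <= 2 / (2 `^ a * gamma_fun a).
Proof.
move=> a0 a2 at1; have c0 := chid_norm_gt0 a0.
have [t0|t0] := leP t 0; first by rewrite chid_le0// divr_ge0// ltW.
rewrite /chid t0 ler_pM2r ?invr_gt0// mulNr expRN ler_pdivrMr ?expR_gt0//.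
have e1 : 1 + t / 2 <= expR (t / 2) by exact: expR_ge1Dx.
suff : t `^ (a - 1) <= 1 + t by lra.
have [t1|t1] := leP 1 t.
  apply: (@le_trans _ _ (t `^ 1)); first by apply: ler_powR => //; lra.
  by rewrite powRr1 ?ltW//; lra.
have a1 : 1 <= a by move: at1; rewrite [1 <= t]leNgt t1 orbF.
apply: (@le_trans _ _ (1 `^ (a - 1))); last by rewrite powR1 lerDl ltW.
by apply: ge0_ler_powR; rewrite ?nnegrE ?subr_ge0// ltW.
Qed.

End explicit_distribution_functions.

(** * The endpoints *)

Section endpoints.
Context {R : realType}.
Implicit Types (a b x y s t r : R).
Local Opaque gamma_fun.

Definition fisher_ratio a b : R := Num.sqrt ((a + b - 1) / (a * (b - 2))).

(* Arithmetic-geometric mean: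
   [2 sqrt ((a + b - 1) (b - 2)) <= a + 2 b - 3]. *)
Lemma fisher_ratio_ge a b : 0 < a -> 2 < b ->
  (Num.sqrt a)^-1 * (2 * (a + b - 1) / (a + 2 * b - 3)) <= fisher_ratio a b.
Proof.
move=> a0 b2; have q0 : 0 < b - 2 by lra.
have p0 : 0 < a + b - 1 by lra.
have pq0 : 0 < a + 2 * b - 3 by lra.
have sa : 0 < Num.sqrt a by rewrite sqrtr_gt0.
rewrite -[leLHS]ger0_norm; last by rewrite mulr_ge0 ?invr_ge0 ?divr_ge0 ?mulr_ge0 ?ltW.
rewrite -sqrtr_sqr ler_wsqrtr// exprMn exprVn sqr_sqrtr ?(ltW a0)//.
have -> : (a + b - 1) / (a * (b - 2)) = a^-1 * ((a + b - 1) / (b - 2)).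
  by field; rewrite !gt_eqF.
rewrite ler_pM2l ?invr_gt0//.
rewrite ler_pdivlMr// expr_div_n mulrAC ler_pdivrMr ?exprn_gt0//.
have : 0 <= (a + 1) ^+ 2 * (a + b - 1) by rewrite mulr_ge0 ?sqr_ge0 ?ltW.
lra.
Qed.

(** The bound [sqrt (1 + 2 c) <= 1 + c] with [c = (a + 1) / (2 (b - 2))]. *)
Lemma fisher_ratio_le a b : 0 < a -> 2 < b ->
  fisher_ratio a b <= (Num.sqrt a)^-1 * (1 + (a + 1) / (2 * (b - 2))).
Proof.
move=> a0 b2; have q0 : 0 < b - 2 by lra.
have sa : 0 < Num.sqrt a by rewrite sqrtr_gt0.
have c0 : 0 <= (a + 1) / (2 * (b - 2)) by rewrite divr_ge0 ?mulr_ge0//; lra.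
rewrite -[leRHS]ger0_norm; last by rewrite mulr_ge0 ?invr_ge0 ?(ltW sa)// addr_ge0.
rewrite -sqrtr_sqr ler_wsqrtr// exprMn exprVn sqr_sqrtr ?(ltW a0)//.
have -> : (a + b - 1) / (a * (b - 2)) = a^-1 * (1 + 2 * ((a + 1) / (2 * (b - 2)))).
  by field; rewrite !gt_eqF.
rewrite ler_pM2l ?invr_gt0//.
have := sqr_ge0 ((a + 1) / (2 * (b - 2))); move: (_ / _) => c; lra.
Qed.

Lemma ln1D_ge_frac (p q s : R) : 0 <= p -> 0 < q -> p / q <= s ->
  2 * p / (2 * q + p) <= ln (1 + s).
Proof.
move=> p0 q0 pqs; have s0 : 0 <= p / q by rewrite divr_ge0// ltW.
apply: (@le_trans _ _ (ln (1 + p / q))); last first.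
  by rewrite ler_ln ?posrE ?ltr_wpDr// ?lerD2l// (le_trans s0).
apply: le_trans (ln1D_ge s0); rewrite le_eqVlt; apply/orP; left; apply/eqP.
by field; rewrite !gt_eqF//; lra.
Qed.

Lemma inv_sqrtr_sqr a : 0 < a -> 0 < (Num.sqrt a)^-1 /\ a * (Num.sqrt a)^-1 ^+ 2 = 1.
Proof.
move=> a0; rewrite invr_gt0 sqrtr_gt0; split => //.
by rewrite exprVn sqr_sqrtr ?ltW// divff// gt_eqF.
Qed.

(** With a rational minorant [p / q] of the endpoint [s], the comparison of [Y] with a logarithm
    becomes polynomial. *)
Let upper_le (p q k Y s : R) : 0 <= p -> 0 < q -> p / q <= s -> 0 <= k ->
  Y * (2 * q + p) <= k * (2 * p) -> Y <= k * ln (1 + s).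
Proof.
move=> p0 q0 pqs k0 H.
apply: le_trans (ler_wpM2l k0 (ln1D_ge_frac p0 q0 pqs)).
by rewrite mulrA ler_pdivlMr//; lra.
Qed.

(** There is room to spare: replacing [rho] by its limit [r], the polynomial inequality reduces to
    [r <= 2], while [r = sqrt 2]. Since [a < 1], the lower bound of the sandwich is the shifted
    one. *)
Lemma upper_endpoint_half a b : a = 2^-1 -> 2 < b ->
  dcdf (chid a) (2 * a * (1 + (Num.sqrt a)^-1)) <=
  dcdf (beta_prime a b) (a / (b - 1) * (1 + fisher_ratio a b)).
Proof.
move=> aE b2; have a0 : 0 < a by rewrite aE invr_gt0.
have [r0 ar] := inv_sqrtr_sqr a0; have := fisher_ratio_ge a0 b2.
move: (Num.sqrt a)^-1 (fisher_ratio a b) r0 ar => r rho r0 ar hrho.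
have b10 : 0 < b - 1 by lra.
have r2 : r <= 2 by move: ar; rewrite aE; nra.
have rr : r <= rho.
  apply: le_trans hrho; rewrite ler_peMr ?(ltW r0)// ler_pdivlMr aE; lra.
have s0 : 0 < a / (b - 1) * (1 + rho).
  by rewrite mulr_gt0 ?divr_gt0//; lra.
have b0 : 0 < b by lra.
have a1 : a <= 1 by rewrite aE; lra.
have k0 : 0 < b *+ 2 + a - 1 by rewrite aE (mulr2n b); lra.
apply: le_trans (beta_prime_ge_chid_shift a0 b0 a1 k0 s0).
apply: dcdf_le; first exact: chid_pdf.
apply: (@upper_le (1 + r) (2 * (b - 1))).
- by rewrite addr_ge0// ltW.
- by rewrite mulr_gt0.
- rewrite ler_pdivrMr ?mulr_gt0//.
  have -> : a / (b - 1) * (1 + rho) * (2 * (b - 1)) = 1 + rho.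
    by rewrite aE; field; rewrite gt_eqF.
  lra.
- by rewrite aE (mulr2n b); lra.
- have : 0 <= (1 + r) * (2 - r) by rewrite mulr_ge0//; lra.
  by rewrite aE (mulr2n b); lra.
Qed.

(** Here [rho >= b / (b - 1)], so the endpoint is at least [(2 b - 1) / (b - 1)^2], the fraction
    supplied to [upper_le]; what remains reduces to [1 <= b]. *)
Lemma upper_endpoint_one b : 2 < b ->
  dcdf (chid 1) (2 * 1 * (1 + (Num.sqrt 1)^-1)) <=
  dcdf (beta_prime 1 b) (1 / (b - 1) * (1 + fisher_ratio 1 b)).
Proof.
move=> b2; have := fisher_ratio_ge ltr01 b2; rewrite sqrtr1 invr1.
move: (fisher_ratio 1 b) => rho hrho.
have b10 : 0 < b - 1 by lra.
have hr : b <= rho * (b - 1).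
  rewrite -ler_pdivrMr//; apply: le_trans hrho.
  by rewrite mul1r le_eqVlt; apply/orP; left; apply/eqP; field; rewrite !gt_eqF; lra.
have rho0 : 0 < rho by rewrite -(pmulr_lgt0 _ b10); lra.
have s0 : 0 < 1 / (b - 1) * (1 + rho) by rewrite mulr_gt0 ?divr_gt0//; lra.
have b0 : 0 < b by lra.
apply: le_trans (beta_prime_ge_chid ltr01 b0 (lexx 1) s0).
apply: dcdf_le; first exact: chid_pdf.
apply: (@upper_le (2 * b - 1) ((b - 1) ^+ 2)).
- lra.
- by rewrite exprn_gt0.
- rewrite ler_pdivrMr ?exprn_gt0//.
  have -> : 1 / (b - 1) * (1 + rho) * (b - 1) ^+ 2 = (b - 1) + rho * (b - 1).
    by field; rewrite gt_eqF.
  lra.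
- by rewrite mulrn_wge0// ltW.
- by rewrite (mulr2n b); nra.
Qed.

Lemma upper_endpoint_three_half a b : a = 3 / 2 -> 5 / 2 <= b ->
  dcdf (chid a) (2 * a * (1 + (Num.sqrt a)^-1)) <=
  dcdf (beta_prime a b) (a / (b - 1) * (1 + fisher_ratio a b)).
Proof.
move=> aE b52; have a0 : 0 < a by rewrite aE divr_gt0.
have b2 : 2 < b by lra.
have [r0 ar] := inv_sqrtr_sqr a0; have := fisher_ratio_ge a0 b2.
move: (Num.sqrt a)^-1 (fisher_ratio a b) r0 ar => r rho r0 ar hrho.
have b10 : 0 < b - 1 by lra.
have b3 : 0 < 4 * b - 3 by lra.
have r2 : r * r = 2 / 3 by move: ar; rewrite aE; lra.
(* Modulo [r * r = 2 / 3] the final inequality amounts to [4 b + 7 <= r (12 b - 9)]. At [b = 5 / 2]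
   it asks for [r >= 17 / 21], about 0.8095, so [81 / 100] barely suffices; the true value is about
   0.8165. *)
have r1 : 81 / 100 <= r by nra.
have hr : r * (4 * b + 2) <= rho * (4 * b - 3).
  rewrite -ler_pdivrMr//; apply: le_trans hrho.
  by rewrite -mulrA le_eqVlt; apply/orP; left; apply/eqP; rewrite aE; field; rewrite !gt_eqF; lra.
have rho0 : 0 < rho by rewrite -(pmulr_lgt0 _ b3) (lt_le_trans _ hr)// mulr_gt0//; lra.
have s0 : 0 < a / (b - 1) * (1 + rho) by rewrite mulr_gt0 ?divr_gt0//; lra.
have b0 : 0 < b by lra.
have a1 : 1 <= a by rewrite aE; lra.
apply: le_trans (beta_prime_ge_chid a0 b0 a1 s0).
apply: dcdf_le; first exact: chid_pdf.
apply: (@upper_le (3 * ((4 * b - 3) + r * (4 * b + 2))) (2 * (b - 1) * (4 * b - 3))).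
- by rewrite mulr_ge0// addr_ge0 ?(ltW b3)// mulr_ge0 ?(ltW r0)//; lra.
- by rewrite !mulr_gt0.
- rewrite ler_pdivrMr ?mulr_gt0//.
  have -> : a / (b - 1) * (1 + rho) * (2 * (b - 1) * (4 * b - 3)) =
      3 * ((4 * b - 3) + rho * (4 * b - 3)).
    by rewrite aE; field; rewrite gt_eqF.
  lra.
- by rewrite mulrn_wge0// ltW.
- rewrite aE (mulr2n b).
  have [k k0 ->] : exists2 k, 0 <= k & b = k + 5 / 2 by exists (b - 5 / 2); lra.
  have h1 : 0 <= k * (r - 81 / 100) by rewrite mulr_ge0//; lra.
  have h2 : 0 <= k * k * (r - 81 / 100) by rewrite !mulr_ge0//; lra.
  have e1 : r * r * k = 2 / 3 * k by rewrite r2.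
  have e2 : r * r * (k * k) = 2 / 3 * (k * k) by rewrite r2.
  have h3 : 0 <= k * k by rewrite mulr_ge0.
  nra.
Qed.

(** If the left endpoint is nonpositive, the left side is 0. Otherwise [r <= rho < 1], and
    [a * r^2 = 1] excludes [a <= 1]; for the other two values the shifted upper bound and
    [ln (1 + s) <= s] reduce the claim to a polynomial inequality. *)
Lemma lower_endpoint a b : 0 < a -> (a <= 1 \/ a = 3 / 2 \/ a = 2) -> 5 / 2 <= b ->
  dcdf (beta_prime a b) (a / (b - 1) * (1 - fisher_ratio a b)) <=
  dcdf (chid a) (2 * a * (1 - (Num.sqrt a)^-1)).
Proof.
move=> a0 a123 b52; have b2 : 2 < b by lra.
have b10 : 0 < b - 1 by lra.
have [s0|s0] := leP (a / (b - 1) * (1 - fisher_ratio a b)) 0.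
  rewrite dcdf_le0 => [|x|//]; last exact: beta_prime_le0.
  by apply: dcdf_ge0; exact: chid_pdf.
have [r0 ar] := inv_sqrtr_sqr a0; have := fisher_ratio_ge a0 b2; move: s0.
move: (Num.sqrt a)^-1 (fisher_ratio a b) r0 ar => r rho r0 ar s0 hrho.
have b0 : 0 < b by lra.
have rho1 : rho < 1 by move: s0; rewrite pmulr_rgt0 ?divr_gt0// subr_gt0.
have c1 : 1 <= 2 * (a + b - 1) / (a + 2 * b - 3) by rewrite ler_pdivlMr; lra.
have rr : r <= rho by apply: le_trans hrho; rewrite ler_peMr ?(ltW r0).
have a1 : 1 <= a by rewrite leNgt; apply/negP => a1; nra.
apply: le_trans (beta_prime_le_chid_shift a0 b0 a1 s0) _.
apply: dcdf_le; first exact: chid_pdf.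
have k0 : 0 <= b *+ 2 + a - 1 by rewrite (mulr2n b); lra.
apply: (@le_trans _ _ ((b *+ 2 + a - 1) * (a / (b - 1) * (1 - rho)))).
  by rewrite ler_wpM2l// le_ln1Dx// (lt_trans _ s0)//; lra.
have -> : (b *+ 2 + a - 1) * (a / (b - 1) * (1 - rho)) =
   ((b *+ 2 + a - 1) * a * (1 - rho)) / (b - 1) by field; rewrite gt_eqF.
rewrite ler_pdivrMr// (mulr2n b).
have c0 : 0 < a + 2 * b - 3 by lra.
have hr : r * (2 * (a + b - 1)) <= rho * (a + 2 * b - 3).
  by rewrite -ler_pdivrMr// -mulrA.
case: a123 => [a1'|[aE|aE]].
- have r1 : r < 1 by lra.
  by exfalso; nra.
- have r2 : r * r = 2 / 3 by move: ar; rewrite aE; lra.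
  have r1 : 81 / 100 <= r by nra.
  suff : (b + b + a - 1) * a * (1 - rho) * (a + 2 * b - 3) <=
     2 * a * (1 - r) * (b - 1) * (a + 2 * b - 3) by rewrite ler_pM2r.
  have : (b + b + a - 1) * a * (r * (2 * (a + b - 1))) <=
    (b + b + a - 1) * a * (rho * (a + 2 * b - 3)).
    by rewrite ler_wpM2l// mulr_ge0//; lra.
  rewrite aE; have : 0 <= (b - 5 / 2) * (r - 81 / 100) by rewrite mulr_ge0; lra.
  nra.
- have r2 : r * r = 1 / 2 by move: ar; rewrite aE; lra.
  have r1 : 7 / 10 <= r by nra.
  suff : (b + b + a - 1) * a * (1 - rho) * (a + 2 * b - 3) <=
     2 * a * (1 - r) * (b - 1) * (a + 2 * b - 3) by rewrite ler_pM2r.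
  have : (b + b + a - 1) * a * (r * (2 * (a + b - 1))) <=
    (b + b + a - 1) * a * (rho * (a + 2 * b - 3)).
    by rewrite ler_wpM2l// mulr_ge0//; lra.
  rewrite aE; have : 0 <= (b - 5 / 2) * (r - 7 / 10) by rewrite mulr_ge0; lra.
  nra.
Qed.

End endpoints.

(** * The upper endpoint for four numerator degrees of freedom *)

Section upper_endpoint_two.
Context {R : realType}.
Implicit Types (a b x y s t r : R).
Local Opaque gamma_fun.

(** The right side is the chi-square tail [(1 + y / 2) exp (- y / 2)] at [y / 2 = 2 + 2 r]. The
    factor [1 + b v], with [v = s / (1 + s)], is bounded by the exponential tangent to it where it
    equals [3 + 2 r], and the exponents are then compared. The constant [6 + 8 r] is [(2 + 2 r)^2]
    modulo [r * r = 1 / 2]. *)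
Lemma beta_prime2_tail_le b s r : 0 < b -> 0 < s -> 0 < r -> r * r = 1 / 2 ->
  6 + 8 * r + b * (s / (1 + s)) <= (3 + 2 * r) * (b * (2 * s / (2 + s))) ->
  (1 + s) `^ (- b) * (1 + b * (s / (1 + s))) <= (3 + 2 * r) * expR (- (2 + 2 * r)).
Proof.
move=> b0 s0 r0 r2; have s1 : 0 < 1 + s by rewrite addr_gt0.
have l := ln1D_ge (ltW s0).
rewrite /powR gt_eqF// mulNr.
have v0 : 0 < s / (1 + s) by rewrite divr_gt0.
move: (s / (1 + s)) (2 * s / (2 + s)) v0 l => v L v0 l H.
have u0 : 0 < 3 + 2 * r by lra.
pose w := (b * v - (2 + 2 * r)) / (3 + 2 * r).
have -> : 1 + b * v = (3 + 2 * r) * (1 + w) by rewrite /w; field; rewrite gt_eqF.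
rewrite mulrCA ler_pM2l//.
apply: (@le_trans _ _ (expR (- (b * L)) * expR w)).
  apply: (@le_trans _ _ (expR (- (b * ln (1 + s))) * expR w)).
    by rewrite ler_pM2l ?expR_gt0// expR_ge1Dx.
  by rewrite ler_pM2r ?expR_gt0// ler_expR lerN2 ler_pM2l.
rewrite -expRD ler_expR.
suff : w <= b * L - (2 + 2 * r) by lra.
rewrite /w ler_pdivrMr//; nra.
Qed.

(* Modulo [r * r = 1 / 2] the difference of the two sides has nonnegative
   coefficients in [k = 2 b - 7] and [r]. *)
Let tail_condition b r A D : 7 / 2 <= b -> 0 < r -> r * r = 1 / 2 ->
  A = (2 * b - 1) + r * (2 * b + 2) -> D = (2 * b - 1) * (2 * b - 2) ->
  (6 + 8 * r) * ((D + 2 * A) * (D + 4 * A)) + b * (4 * A) * (D + 2 * A) <=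
  (3 + 2 * r) * (b * (4 * A)) * (D + 4 * A).
Proof.
move=> b72 r0 r2 AE DE.
have [k k0 bE] : exists2 k, 0 <= k & b = (k + 7) / 2 by exists (2 * b - 7); lra.
rewrite -subr_ge0.
have -> : (3 + 2 * r) * (b * (4 * A)) * (D + 4 * A) -
    ((6 + 8 * r) * ((D + 2 * A) * (D + 4 * A)) + b * (4 * A) * (D + 2 * A)) =
    (90 + 648 * r) + (288 + 720 * r) * k + (66 + 144 * r) * k ^+ 2 +
    (4 + 8 * r) * k ^+ 3 +
    (r * r - 1 / 2) * (4 * k ^+ 4 + (112 + 16 * r) * k ^+ 3 +
      (1144 + 336 * r) * k ^+ 2 + (4944 + 2160 * r) * k + (7236 + 3888 * r)).
  by rewrite AE DE bE; field.
rewrite r2 subrr mul0r addr0.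
have c0 (p q : R) : 0 <= p -> 0 <= q -> 0 <= p + q * r.
  by move=> p0 q0; rewrite addr_ge0 ?mulr_ge0 ?(ltW r0).
have k2 : 0 <= k ^+ 2 by rewrite exprn_ge0.
have k3 : 0 <= k ^+ 3 by rewrite exprn_ge0.
have n0 (m : nat) : 0 <= m%:R :> R by exact: ler0n.
apply: addr_ge0; last exact: (mulr_ge0 (c0 4 8 (n0 4) (n0 8)) k3).
apply: addr_ge0; last exact: (mulr_ge0 (c0 66 144 (n0 66) (n0 144)) k2).
apply: addr_ge0; last exact: (mulr_ge0 (c0 288 720 (n0 288) (n0 720)) k0).
exact: (c0 90 648 (n0 90) (n0 648)).
Qed.

Lemma upper_endpoint_two a b : a = 2 -> b = 5 / 2 \/ b = 3 \/ 7 / 2 <= b ->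
  dcdf (chid a) (2 * a * (1 + (Num.sqrt a)^-1)) <=
  dcdf (beta_prime a b) (a / (b - 1) * (1 + fisher_ratio a b)).
Proof.
move=> aE bE; have a0 : 0 < a by rewrite aE.
have b52 : 5 / 2 <= b by case: bE => [->|[->|]] //; lra.
have b2 : 2 < b by lra.
have b0 : 0 < b by lra.
have b10 : 0 < b - 1 by lra.
have r0 : 0 < (Num.sqrt a)^-1 by rewrite invr_gt0 sqrtr_gt0.
have r2 : (Num.sqrt a)^-1 * (Num.sqrt a)^-1 = 1 / 2.
  by rewrite -expr2 exprVn sqr_sqrtr ?ltW// aE mul1r.
have rho_ge := fisher_ratio_ge a0 b2.
have rho2 : fisher_ratio a b * fisher_ratio a b = (b + 1) / (2 * (b - 2)).
  rewrite -expr2 sqr_sqrtr aE; first by field; rewrite gt_eqF//; lra.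
  by rewrite divr_ge0// ?mulr_ge0//; lra.
have rho0 : 0 <= fisher_ratio a b by exact: sqrtr_ge0.
move: ((Num.sqrt a)^-1) (fisher_ratio a b) r0 r2 rho_ge rho2 rho0
  => r rho r0 r2 rho_ge rho2 rho0.
have r1 : r <= 1 by nra.
have r7 : 7 / 10 <= r by nra.
suff [s [s0 ss H]] : exists s, [/\ 0 < s, s <= a / (b - 1) * (1 + rho) &
    6 + 8 * r + b * (s / (1 + s)) <= (3 + 2 * r) * (b * (2 * s / (2 + s)))].
  apply: le_trans (dcdf_le (beta_prime_pdf a0 b0) ss).
  rewrite aE dcdf_beta_prime2// dcdf_chid2; last by rewrite !mulr_gt0//; lra.
  rewrite lerD2l lerN2; apply: le_trans (beta_prime2_tail_le b0 s0 r0 r2 H) _.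
  rewrite le_eqVlt; apply/orP; left; apply/eqP.
  by congr (_ * expR _); field.
(* The arithmetic-geometric minorant of [rho] is too weak at [b = 5 / 2] and [b = 3]: the polynomial
   in [tail_condition] is negative at [k = -2] and [k = -1]. In these two cases [rho] is bounded
   numerically from its exact square, and the witness is the resulting endpoint, rounded down. *)
case: bE => [bE|[bE|b72]].
- have rho3 : rho * rho = 7 / 2 by rewrite rho2 bE; field.
  have rho1 : 187 / 100 <= rho by nra.
  exists (382 / 100); split; first by lra.
    rewrite aE bE.
    have -> : 2 / (5 / 2 - 1) * (1 + rho) = 4 / 3 * (1 + rho) by field.
    by lra.
  have -> : 382 / 100 / (1 + 382 / 100) = 382 / 482 :> R by field.
  have -> : 2 * (382 / 100) / (2 + 382 / 100) = 764 / 582 :> R by field.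
  by rewrite bE; lra.
- have rho3 : rho * rho = 2 by rewrite rho2 bE; field.
  have rho1 : 141 / 100 <= rho by nra.
  exists (241 / 100); split; first by lra.
    rewrite aE bE.
    have -> : 2 / (3 - 1) * (1 + rho) = 1 + rho by field.
    by lra.
  have -> : 241 / 100 / (1 + 241 / 100) = 241 / 341 :> R by field.
  have -> : 2 * (241 / 100) / (2 + 241 / 100) = 482 / 441 :> R by field.
  by rewrite bE; lra.
- pose A := (2 * b - 1) + r * (2 * b + 2); pose D := (2 * b - 1) * (2 * b - 2).
  have A0 : 0 < A by rewrite /A addr_gt0 ?mulr_gt0//; lra.
  have D0 : 0 < D by rewrite /D mulr_gt0//; lra.
  have b21 : 0 < 2 * b - 1 by lra.
  (* The endpoint with [rho] replaced by the minorant of [fisher_ratio_ge]. *)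
  exists (4 * A / D); split.
  + by rewrite divr_gt0// mulr_gt0.
  + have -> : 4 * A / D = 2 / (b - 1) * (1 + r * (2 * (b + 1) / (2 * b - 1))).
      by rewrite /A /D; field; rewrite !gt_eqF//; lra.
    rewrite aE ler_pM2l ?divr_gt0// lerD2l; apply: le_trans rho_ge.
    have -> : a + b - 1 = b + 1 by rewrite aE; lra.
    by have -> : a + 2 * b - 3 = 2 * b - 1 by rewrite aE; lra.
  + have D4 : 0 < D + 4 * A by rewrite addr_gt0// mulr_gt0.
    have D2 : 0 < D + 2 * A by rewrite addr_gt0// mulr_gt0.
    have := tail_condition b72 r0 r2 (erefl A) (erefl D).
    move: A D A0 D0 D4 D2 => A D A0 D0 D4 D2 h.
    have -> : 4 * A / D / (1 + 4 * A / D) = 4 * A / (D + 4 * A).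
      by field; rewrite !gt_eqF.
    have -> : 2 * (4 * A / D) / (2 + 4 * A / D) = 4 * A / (D + 2 * A).
      by field; rewrite !gt_eqF//; lra.
    have DD : 0 < (D + 2 * A) * (D + 4 * A) by rewrite mulr_gt0.
    rewrite -(ler_pM2r DD).
    have -> : (6 + 8 * r + b * (4 * A / (D + 4 * A))) * ((D + 2 * A) * (D + 4 * A)) =
      (6 + 8 * r) * ((D + 2 * A) * (D + 4 * A)) + b * (4 * A) * (D + 2 * A).
      by field; rewrite gt_eqF.
    have -> : (3 + 2 * r) * (b * (4 * A / (D + 2 * A))) * ((D + 2 * A) * (D + 4 * A)) =
      (3 + 2 * r) * (b * (4 * A)) * (D + 4 * A).
      by field; rewrite gt_eqF.
    exact: h.
Qed.

End upper_endpoint_two.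

(** * The limit *)

Section limit.
Context {R : realType}.
Implicit Types (a b x y s t r : R).
Local Opaque gamma_fun.

(** The density bound acts as a Lipschitz constant to the right of [y]; the one-sided form spares
    the callers a discussion of the order of [x] and [y]. *)
Let dcdf_chid_near a x y c : 0 < a -> a <= 2 -> (1 <= a) || (1 <= y) ->
  0 <= c -> x - y <= c ->
  dcdf (chid a) x - dcdf (chid a) y <= 2 / (2 `^ a * gamma_fun a) * c.
Proof.
move=> a0 a2 ay c0 xy; have pa := chid_pdf a0.
have M0 : 0 <= 2 / (2 `^ a * gamma_fun a).
  by rewrite divr_ge0// ltW// chid_norm_gt0.
have [yx|xy'] := leP y x; last first.
  apply: (@le_trans _ _ 0); last exact: mulr_ge0.
  by rewrite subr_le0; apply: dcdf_le => //; exact: ltW.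
apply: (@le_trans _ _ (2 / (2 `^ a * gamma_fun a) * (x - y))).
  apply: dcdf_lipschitz => // t yt; apply: chid_le => //.
  by case/orP: ay => [->//|y1]; rewrite (le_trans y1 yt) orbT.
exact: ler_wpM2l.
Qed.

(** The error 68 is 48 from the upper endpoint plus 20 from the lower one, all constants being
    generous bounds uniform in [a]. *)
Lemma within_sd_near a b : 2^-1 <= a -> a <= 2 -> 3 <= b ->
  dcdf (beta_prime a b) (a / (b - 1) * (1 + fisher_ratio a b)) -
  dcdf (beta_prime a b) (a / (b - 1) * (1 - fisher_ratio a b)) <=
  dcdf (chid a) (2 * a * (1 + (Num.sqrt a)^-1)) -
  dcdf (chid a) (2 * a * (1 - (Num.sqrt a)^-1)) +
  2 / (2 `^ a * gamma_fun a) * (68 / (b - 2)).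
Proof.
move=> a12 a2 b3; have a0 : 0 < a by lra.
have b0 : 0 < b by lra.
have b2 : 2 < b by lra.
have b10 : 0 < b - 1 by lra.
have b20 : 0 < b - 2 by lra.
have pa := chid_pdf a0.
have r0 : 0 < (Num.sqrt a)^-1 by rewrite invr_gt0 sqrtr_gt0.
have ar : a * ((Num.sqrt a)^-1 * (Num.sqrt a)^-1) = 1.
  by rewrite -expr2 exprVn sqr_sqrtr ?ltW// divff// gt_eqF.
have hle := fisher_ratio_le a0 b2.
have rho0 : 0 <= fisher_ratio a b by exact: sqrtr_ge0.
move: ((Num.sqrt a)^-1) (fisher_ratio a b) r0 ar hle rho0 => r rho r0 ar hle rho0.
have r32 : r <= 3 / 2 by nra.
pose e := (b - 2)^-1; have e0 : 0 < e by rewrite invr_gt0.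
have e1 : e <= 1 by rewrite invf_le1//; lra.
have rhor : rho - r <= 3 * e.
  have E : r * (1 + (a + 1) / (2 * (b - 2))) = r + r * (a + 1) / 2 * e.
    by rewrite /e; field; rewrite gt_eqF.
  move: hle; rewrite E => hle.
  have : r * (a + 1) / 2 * e <= 3 * e by rewrite ler_pM2r//; nra.
  lra.
pose f := (b - 1)^-1; have f0 : 0 < f by rewrite invr_gt0.
have fe : f <= e by rewrite lef_pV2 ?posrE//; lra.
have fb : f * b = 1 + f by rewrite /f; field; rewrite gt_eqF.
rewrite -/f -[68 / _]/(68 * e).
(* Keeps the upper endpoint where the density is bounded even for [a < 1]. *)
have Yp1 : 1 <= 2 * a * (1 + r).
  have h : 0 <= a * r by rewrite mulr_ge0// ltW.
  lra.
have rho5 : rho <= 9 / 2 by lra.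
have up : dcdf (beta_prime a b) (a * f * (1 + rho)) - dcdf (chid a) (2 * a * (1 + r)) <=
    2 / (2 `^ a * gamma_fun a) * (48 * e).
  have s0 : 0 < a * f * (1 + rho) by rewrite !mulr_gt0// ltr_pwDl.
  have lns : ln (1 + a * f * (1 + rho)) <= a * f * (1 + rho).
    by rewrite le_ln1Dx// (lt_trans _ s0)//; lra.
  have ln0 : 0 <= ln (1 + a * f * (1 + rho)) by rewrite ln_ge0// lerDl ltW.
  have H : dcdf (beta_prime a b) (a * f * (1 + rho)) <=
      dcdf (chid a) ((2 * b + 1) * (a * f * (1 + rho))).
    (* The factor [2 b + 1] dominates both [2 b] and [2 b + a - 1], so one estimate serves both
       sides of the sandwich. *)
    have [a1|a1] := leP 1 a.
      apply: le_trans (beta_prime_le_chid_shift a0 b0 a1 s0) _.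
      apply: dcdf_le => //; rewrite (mulr2n b).
      by apply: ler_pM => //; lra.
    apply: le_trans (beta_prime_le_chid a0 b0 (ltW a1) s0) _.
    apply: dcdf_le => //; rewrite (mulr2n b).
    by apply: ler_pM => //; lra.
  apply: (@le_trans _ _ (dcdf (chid a) ((2 * b + 1) * (a * f * (1 + rho))) -
     dcdf (chid a) (2 * a * (1 + r)))); first by rewrite lerD2r.
  apply: dcdf_chid_near => //; first by rewrite Yp1 orbT.
    by rewrite mulr_ge0// ltW.
  have -> : (2 * b + 1) * (a * f * (1 + rho)) = a * (1 + rho) * (2 * (f * b) + f) by ring.
  rewrite fb.
  have h1 : a * (rho - r) <= 2 * (3 * e).
    apply: (@le_trans _ _ (a * (3 * e))); first by rewrite ler_pM2l.
    by rewrite ler_wpM2r// mulr_ge0// ltW.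
  have h2 : a * (1 + rho) * f <= 2 * (11 / 2) * e.
    apply: ler_pM; [|exact: ltW| |exact: fe].
      by rewrite mulr_ge0 ?addr_ge0// ltW.
    by apply: ler_pM => //; lra.
  lra.
have lo : dcdf (chid a) (2 * a * (1 - r)) - dcdf (beta_prime a b) (a * f * (1 - rho)) <=
    2 / (2 `^ a * gamma_fun a) * (20 * e).
  have M0 : 0 <= 2 / (2 `^ a * gamma_fun a) * (20 * e).
    apply: mulr_ge0; last by rewrite mulr_ge0// ltW.
    by rewrite divr_ge0// ltW// chid_norm_gt0.
  have Hge := dcdf_ge0 (beta_prime_pdf a0 b0).
  (* For [a <= 1] the chi-square lower endpoint is nonpositive, so nothing has to be estimated near
     0, where the density may be unbounded. *)
  have [a1|a1] := leP a 1.
    rewrite dcdf_le0 ?sub0r; first by apply: le_trans M0; rewrite oppr_le0.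
      exact: chid_le0.
    have r1 : 1 <= r by rewrite leNgt; apply/negP => r1; nra.
    by rewrite mulr_ge0_le0 ?subr_le0// mulr_ge0// ltW.
  have h1 : a * (rho - r) <= 2 * (3 * e).
    apply: (@le_trans _ _ (a * (3 * e))); first by rewrite ler_pM2l.
    by rewrite ler_wpM2r// mulr_ge0// ltW.
  have [s0|s0] := leP (a * f * (1 - rho)) 0.
    have rho1 : 1 <= rho.
      by rewrite -subr_le0 -(pmulr_rle0 _ (mulr_gt0 a0 f0)).
    rewrite [X in _ - X]dcdf_le0//; last exact: beta_prime_le0.
    rewrite -[X in _ - X](@dcdf_le0 _ (chid a) 0)//; last exact: chid_le0.
    apply: dcdf_chid_near => //; first by rewrite ltW.
      by rewrite mulr_ge0// ltW.
    have : 0 <= a * (rho - 1) by rewrite mulr_ge0 ?subr_ge0// ltW.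
    lra.
  apply: (@le_trans _ _ (dcdf (chid a) (2 * a * (1 - r)) -
    dcdf (chid a) (b *+ 2 * ln (1 + a * f * (1 - rho))))).
    rewrite lerD2l lerN2; exact: beta_prime_ge_chid (ltW a1) s0.
  apply: dcdf_chid_near => //; first by rewrite ltW.
    by rewrite mulr_ge0// ltW.
  have rho1 : 0 < 1 - rho by move: s0; rewrite pmulr_rgt0// mulr_gt0.
  have lns := ln1D_ge (ltW s0).
  (* From [(s - s^2 / 2) (2 + s) = 2 s - s^3 / 2]. *)
  have sE : a * f * (1 - rho) - (a * f * (1 - rho)) ^+ 2 / 2 <= ln (1 + a * f * (1 - rho)).
    apply: le_trans lns; move: (a * f * (1 - rho)) s0 => s s0.
    rewrite ler_pdivlMr; last lra.
    have : 0 <= s ^+ 3 by rewrite exprn_ge0// ltW.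
    lra.
  have : b *+ 2 * (a * f * (1 - rho) - (a * f * (1 - rho)) ^+ 2 / 2) <=
      b *+ 2 * ln (1 + a * f * (1 - rho)).
    by rewrite ler_pM2l// mulrn_wgt0.
  have -> : b *+ 2 * (a * f * (1 - rho) - (a * f * (1 - rho)) ^+ 2 / 2) =
     (f * b) * (2 * a * (1 - rho) - f * (a * (1 - rho)) ^+ 2).
    by rewrite (mulr2n b); field.
  rewrite fb => h2.
  have h3 : f * (a * (1 - rho)) ^+ 2 <= 4 * e.
    rewrite mulrC; apply: ler_pM => //; [exact: sqr_ge0|exact: ltW|].
    rewrite (_ : 4 = 2 ^+ 2); last by rewrite expr2; lra.
    rewrite ler_pXn2r ?nnegrE ?mulr_ge0 ?(ltW a0) ?(ltW rho1)//.
    by apply: (@le_trans _ _ (2 * 1)); [apply: ler_pM => //; lra|lra].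
  have h4 : 0 <= f * (2 * a * (1 - rho)) by rewrite !mulr_ge0 ?(ltW f0) ?(ltW a0) ?(ltW rho1).
  have h5 : f * (f * (a * (1 - rho)) ^+ 2) <= 1 * (4 * e).
    apply: ler_pM => //; [exact: ltW| |exact: le_trans fe e1].
    by rewrite mulr_ge0 ?sqr_ge0// ltW.
  lra.
lra.
Qed.

End limit.

(** * Numerical bounds *)

Section numerics.
Context {R : realType}.
Implicit Types (a b x y s t r : R).
Local Notation mu := (@lebesgue_measure R).
Local Opaque gamma_fun.

Lemma expRN_le_quad x : 0 <= x -> expR (- x) <= 1 - x + x ^+ 2 / 2.
Proof.
move=> x0; have q := expR_ge_quad x0.
have p : 0 < 1 + x + x ^+ 2 / 2 by rewrite ltr_wpDr ?divr_ge0 ?sqr_ge0// ltr_wpDr.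
rewrite -(ler_pM2r p).
apply: (@le_trans _ _ (expR (- x) * expR x)).
  by rewrite ler_pM2l ?expR_gt0.
rewrite -expRD addNr expR0.
have -> : (1 - x + x ^+ 2 / 2) * (1 + x + x ^+ 2 / 2) = 1 + (x ^+ 2 / 2) ^+ 2 by field.
by rewrite lerDl sqr_ge0.
Qed.

(* At [h = pi / 4], [sin h <= h] and [sin h ^+ 2 = 1 / 2]. *)
Lemma pi_sqr_ge8 : 8 <= (pi : R) ^+ 2.
Proof.
pose h : R := pi / 4; have h0 : 0 < h by rewrite divr_gt0 ?pi_gt0.
have [|c _ E] := @MVT R sin cos 0 h h0.
- by apply: continuous_subspaceT => x; exact: continuous_sin.
have sh : sin h <= h.
  move: E; rewrite sin0 !subr0 => ->; rewrite ler_piMl ?cos_le1//.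
  exact: ltW.
have h2 : h < pi / 2.
  by rewrite /h ltr_pM2l ?pi_gt0// ltf_pV2 ?posrE//; lra.
have sh0 : 0 < sin h by apply: sin_gt0_pihalf; rewrite h0 h2.
have : cos (h *+ 2) = 0.
  by rewrite -[RHS]cos_pihalf; congr cos; rewrite /h (mulr2n (pi / 4)); field.
rewrite cos_mulr2n cos2sin2 => e.
have s2 : sin h ^+ 2 = 1 / 2.
  by move: e; rewrite mulr2n; lra.
have : sin h ^+ 2 <= h ^+ 2 by rewrite ler_pXn2r// nnegrE ltW.
by rewrite s2 /h expr_div_n; lra.
Qed.

(** On the interval, [exp (- x^2 / 2) <= 1 - x^2 / 2 + x^4 / 8], whose integral is [103 / 60], and
    [pi^2 >= 8] gives [sqrt (2 pi) >= 2.378]. The quotient is about 0.7219, which fixes the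
    threshold 0.722; the smallest chi-square value, at [a = 2], is about 0.737. *)
Lemma normal_prob_within_sd :
  (normal_prob 0 1 [set t : R | (`|t| <= 1)%R] <= (722 / 1000)%:E)%E.
Proof.
have -> : [set t : R | `|t| <= 1] = `[-1, 1]%classic.
  by apply/seteqP; split => t /=; rewrite in_itv/= ler_norml.
pose g (x : R) := 1 - x ^+ 2 / 2 + x ^+ 4 / 8.
pose F (x : R) := x + - (6^-1) * x ^+ 3 + 40^-1 * x ^+ 5.
have sq : 2378 / 1000 <= Num.sqrt (pi *+ 2 : R).
  have pi0 := @pi_gt0 R; have p8 := pi_sqr_ge8.
  rewrite -[leLHS]ger0_norm; last by lra.
  rewrite -sqrtr_sqr ler_wsqrtr// (mulr2n (pi : R)).
  by nra.
rewrite /normal_prob.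
have i0 : 0 <= (Num.sqrt (pi *+ 2 : R))^-1 by rewrite invr_ge0 sqrtr_ge0.
have dF (x : R) : is_derive x (1 : R) F (g x).
  have i1 : is_derive x (1 : R) (id : R -> R) 1 by exact: is_derive_id.
  have d3 := is_deriveZ (- (6^-1)) (is_deriveX 3 i1).
  have d5 := is_deriveZ (40^-1) (is_deriveX 5 i1).
  apply: (is_derive_eq (is_deriveD (is_deriveD i1 d3) d5)).
  by rewrite /GRing.scale/= /g; field.
have cg : continuous g.
  have -> : g = (fun x => 1 + (- (2^-1)) * (x * x) + 8^-1 * (x * x * (x * x))).
    by apply/funext => t; rewrite /g; field.
  move=> x; apply: cvgD; first apply: cvgD; first exact: cvg_cst.
    by apply: cvgM; [exact: cvg_cst|apply: cvgM; exact: cvg_id].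
  apply: cvgM; first exact: cvg_cst.
  by apply: cvgM; apply: cvgM; exact: cvg_id.
have cgi : {within `[-1, 1], continuous g} by exact: continuous_subspaceT.
have mg : measurable_fun (`[-1, 1]%classic : set R) (fun x => (g x)%:E).
  by apply/measurable_EFinP; exact: subspace_continuous_measurable_fun.
have pg x : normal_pdf 0 1 x <= (Num.sqrt (pi *+ 2 : R))^-1 * g x.
  rewrite normal_pdfE ?oner_eq0// /normal_peak /normal_fun subr0 expr1n mul1r.
  apply: ler_wpM2l => //; rewrite mulNr.
  have -> : g x = 1 - x ^+ 2 / (1 *+ 2) + (x ^+ 2 / (1 *+ 2)) ^+ 2 / 2.
    by rewrite /g; field.
  by apply: expRN_le_quad; rewrite divr_ge0 ?sqr_ge0.
have g0 x : 0 <= g x.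
  have -> : g x = ((x ^+ 2 / 2 - 1) ^+ 2 + 1) / 2 by rewrite /g; field.
  by rewrite divr_ge0// addr_ge0 ?sqr_ge0.
apply: (@le_trans _ _ (\int[mu]_(x in `[(-1)%R, 1%R]) ((Num.sqrt (pi *+ 2 : R))^-1%R%:E * (g x)%:E))%E).
  apply: ge0_le_integral => //.
  - by move=> x _; rewrite lee_fin normal_pdf_ge0.
  - by apply/measurable_EFinP; apply: measurable_funTS; exact: measurable_normal_pdf.
  - exact: measurable_funeM.
  - by move=> x _; rewrite lee_fin.
rewrite ge0_integralZl//; last first.
  by move=> x _; rewrite lee_fin.
rewrite (@continuous_FTC2 _ g F)//.
- rewrite -EFinB -EFinM lee_fin ler_pdivrMl; last by lra.
  by rewrite /F; lra.
- split.
  + by move=> x _; have [] := dF x.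
  + by apply: cvg_at_right_filter; exact: is_derive1_continuous (dF _).
  + by apply: cvg_at_left_filter; exact: is_derive1_continuous (dF _).
- by move=> x _; rewrite derive1E; have [_ ->] := dF x.
Qed.

End numerics.

(** * Lower bounds for the four chi-square probabilities *)

Section limit_probability.
Context {R : realType}.
Implicit Types (a b x y s t r c : R) (f g h : R -> R).
Local Notation mu := (@lebesgue_measure R).
Local Opaque gamma_fun.

(** The tangent bound at [x / 16], raised to the 16th power; with 8 in place of 16 the two numerical
    bounds drawn from it would fail. *)
Lemma expRN_ge_pow16 x : x <= 16 -> (1 - x / 16) ^+ 16 <= expR (- x).
Proof.
move=> x16; have -> : - x = 16%:R * (- x / 16) by field.
rewrite expRM_natl; apply: lerXn2r; rewrite ?nnegrE ?expR_ge0//.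
  by rewrite subr_ge0 ler_pdivrMr// mul1r.
by apply: le_trans (expR_ge1Dx _); rewrite mulNr.
Qed.

Lemma mul_expRN_le1 x c : c <= expR x -> c * expR (- x) <= 1.
Proof.
move=> cx; have -> : 1 = expR x * expR (- x) by rewrite -expRD subrr expR0.
by rewrite ler_wpM2r ?expR_ge0.
Qed.

(** Here and in the next three bounds, 0.276 and 0.586 are half of the lower endpoints for
    [a = 3 / 2] and [a = 2], rounded up, and 2.7 and 3.4 half of the upper endpoints, rounded
    down. *)
Lemma expRN276_ge : 756 / 1000 <= expR (- (276 / 1000)) :> R.
Proof.
apply: le_trans (expRN_ge_pow16 _); last by lra.
by lra.
Qed.

Lemma expRN586_ge : 550 / 1000 <= expR (- (586 / 1000)) :> R.
Proof.
apply: le_trans (expRN_ge_pow16 _); last by lra.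
by lra.
Qed.

Lemma expR27_ge : 147 / 10 <= expR (27 / 10) :> R.
Proof.
apply: le_trans (expR_ge_sum 9 _); last by lra.
by rewrite !big_ord_recr big_ord0/= !factS fact0; lra.
Qed.

Lemma expR34_ge : 297 / 10 <= expR (34 / 10) :> R.
Proof.
apply: le_trans (expR_ge_sum 11 _); last by lra.
by rewrite !big_ord_recr big_ord0/= !factS fact0; lra.
Qed.

(** Serves to dominate a density without elementary primitive by two densities that have one, over a
    left half-line, a tail or the whole line. *)
Lemma le_integral_pdf_comb f g h c d (A : set R) : measurable A ->
  is_pdf f -> is_pdf g -> is_pdf h -> 0 <= c -> 0 <= d ->
  (forall t, A t -> f t <= c * g t + d * h t) ->
  (\int[mu]_(t in A) (f t)%:E <=
   c%:E * \int[mu]_(t in A) (g t)%:E + d%:E * \int[mu]_(t in A) (h t)%:E)%E.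
Proof.
move=> mA [mf f0 _] [mg g0 _] [mh h0 _] c0 d0 fgh.
have mE k : measurable_fun setT k -> measurable_fun A (fun x => (k x)%:E).
  by move=> mk; apply/measurable_EFinP; exact: measurable_funTS.
rewrite -!ge0_integralZl//; [|exact: mE|by move=> *; rewrite lee_fin|exact: mE|
  by move=> *; rewrite lee_fin].
rewrite -ge0_integralD//.
- apply: ge0_le_integral => //.
  + by move=> t _; rewrite lee_fin.
  + exact: mE.
  + by apply: emeasurable_funD; apply: measurable_funeM; exact: mE.
- by move=> t _; rewrite -EFinM lee_fin mulr_ge0.
- by apply: measurable_funeM; exact: mE.
- by move=> t _; rewrite -EFinM lee_fin mulr_ge0.
- by apply: measurable_funeM; exact: mE.
Qed.

Lemma dcdf_le_comb f g h c d y : is_pdf f -> is_pdf g -> is_pdf h -> 0 <= c -> 0 <= d ->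
  (forall t, t <= y -> f t <= c * g t + d * h t) ->
  dcdf f y <= c * dcdf g y + d * dcdf h y.
Proof.
move=> pf pg ph c0 d0 fgh; rewrite -lee_fin EFinD !EFinM -!dcdfE//.
by apply: le_integral_pdf_comb => // t; rewrite /= in_itv/=; exact: fgh.
Qed.

Lemma dcdf_tail_le_comb f g h c d y : is_pdf f -> is_pdf g -> is_pdf h ->
  0 <= c -> 0 <= d -> (forall t, y < t -> f t <= c * g t + d * h t) ->
  1 - dcdf f y <= c * (1 - dcdf g y) + d * (1 - dcdf h y).
Proof.
move=> pf pg ph c0 d0 fgh; rewrite -lee_fin [X in (_ <= X)%E]EFinD !EFinM -!dcdf_tail//.
by apply: le_integral_pdf_comb => // t; rewrite /= in_itv/= andbT; exact: fgh.
Qed.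

Lemma is_pdf_comb_ge1 f g h c d : is_pdf f -> is_pdf g -> is_pdf h -> 0 <= c -> 0 <= d ->
  (forall t, f t <= c * g t + d * h t) -> 1 <= c + d.
Proof.
move=> pf pg ph c0 d0 fgh.
have [[_ _ fE] [_ _ gE] [_ _ hE]] := And3 pf pg ph.
have := le_integral_pdf_comb measurableT pf pg ph c0 d0 (fun t _ => fgh t).
by rewrite fE gE hE !mule1 -EFinD lee_fin.
Qed.

(** The classical [sqrt (2 pi)], about 2.507. By the functional equation it normalises both
    [chid (1/2)] and [chid (3/2)]. *)
Let w : R := 2 `^ (2^-1) * gamma_fun (2^-1).

Let w_gt0 : 0 < w.
Proof. by apply: chid_norm_gt0; rewrite invr_gt0. Qed.

Let h12_gt0 : 0 < 2^-1 :> R. Proof. by rewrite invr_gt0. Qed.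

Let chid_halfE t : 0 < t ->
  chid 2^-1 t = expR (- t / 2) / (Num.sqrt t * w).
Proof.
move=> t0; rewrite /chid t0 -/w.
have -> : 2^-1 - 1 = - 2^-1 :> R by lra.
rewrite powRN powR12_sqrt ?ltW//.
have s0 : 0 < Num.sqrt t by rewrite sqrtr_gt0.
by field; rewrite !gt_eqF.
Qed.

Let chid_three_halfE t : 0 < t ->
  chid (3 / 2) t = Num.sqrt t * expR (- t / 2) / w.
Proof.
move=> t0; have := mulr_chid t h12_gt0.
have -> : 2^-1 + 1 = 3 / 2 :> R by lra.
rewrite mulfV// mul1r => <-; rewrite chid_halfE//.
have s0 : 0 < Num.sqrt t by rewrite sqrtr_gt0.
rewrite -{1}(sqr_sqrtr (ltW t0)).
by field; rewrite !gt_eqF.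
Qed.

Let chid_oneE t : 0 < t -> chid 1 t = expR (- t / 2) / 2.
Proof.
by move=> t0; rewrite /chid t0 subrr powRr0 gamma_fun1 powRr1// mul1r mulr1.
Qed.

Let chid_twoE t : 0 < t -> chid 2 t = t * expR (- t / 2) / 4.
Proof.
move=> t0; have := mulr_chid t (@ltr01 R); rewrite chid_oneE// mulr1.
have -> : 1 + 1 = 2 :> R by lra.
by move=> E; move: E; lra.
Qed.

(* Integrating the arithmetic-geometric mean inequality
   [2 t <= k sqrt t + t sqrt t / k], with [k = 7 / 4] close to the optimal [sqrt 3]. *)
Lemma gamma_half_norm_ge : 2309 / 1000 <= w.
Proof.
have p52 : is_pdf (chid (5 / 2 : R)) by apply: chid_pdf; lra.
have p32 : is_pdf (chid (3 / 2 : R)) by apply: chid_pdf; lra.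
have p2 : is_pdf (chid (2 : R)) by exact: chid_pdf.
(* The two weights add up to [w / 4 * (97 / 56)], so [w >= 224 / 97], slightly above 2.309. *)
suff : 1 <= w / 4 * (7 / 8) + w / 4 * (6 / 7) by lra.
have c1 : 0 <= w / 4 * (7 / 8) by have := w_gt0; lra.
have c2 : 0 <= w / 4 * (6 / 7) by have := w_gt0; lra.
apply: (is_pdf_comb_ge1 p2 p32 p52 c1 c2) => t; have [t0|t0] := leP t 0; first by rewrite !chid_le0//; lra.
have a32 : 0 < 3 / 2 :> R by lra.
have := mulr_chid t a32; have -> : 3 / 2 + 1 = 5 / 2 :> R by lra.
have -> : 2 * (3 / 2) = 3 :> R by lra.
move=> E; have -> : chid (5 / 2) t = t * chid (3 / 2) t / 3 by rewrite E; field.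
rewrite chid_twoE// chid_three_halfE//.
have s0 : 0 < Num.sqrt t by rewrite sqrtr_gt0.
have e0 := expR_gt0 (- t / 2); move: (expR _) e0 => e e0.
have := esym (sqr_sqrtr (ltW t0)); move: (Num.sqrt t) s0 => u u0 ->.
move: w_gt0; move: w => v v0.
rewrite -subr_ge0.
have -> : v / 4 * (7 / 8) * (u * e / v) + v / 4 * (6 / 7) * (u ^+ 2 * (u * e / v) / 3) -
  u ^+ 2 * e / 4 = u * e * (2 / 7) * (u / 2 - 7 / 8) ^+ 2.
  by field; rewrite gt_eqF.
apply: mulr_ge0; last exact: sqr_ge0.
by have := mulr_gt0 u0 e0; lra.
Qed.

Let dcdf_one y : 0 < y -> dcdf (chid 1) y = 1 - expR (- (y / 2)).
Proof. by move=> y0; rewrite dcdf_chid1// mulNr. Qed.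

Let dcdf_two y : 0 < y -> dcdf (chid 2) y = 1 - (1 + y / 2) * expR (- (y / 2)).
Proof. by move=> y0; rewrite dcdf_chid2// mulNr. Qed.

Lemma chid_within_sd_half a : a = 2^-1 -> 722 / 1000 <
  dcdf (chid a) (2 * a * (1 + (Num.sqrt a)^-1)) -
  dcdf (chid a) (2 * a * (1 - (Num.sqrt a)^-1)).
Proof.
move=> aE; have a0 : 0 < a by rewrite aE.
have [r0 ar] := inv_sqrtr_sqr a0.
move: (Num.sqrt a)^-1 r0 ar => r r0; rewrite {}aE => ar.
have r14 : 7 / 5 <= r by rewrite leNgt; apply/negP => h; nra.
have e2 : 2 * 2^-1 = 1 :> R by lra.
rewrite e2 mul1r mul1r [X in _ - X]dcdf_le0; [|exact: chid_le0|lra].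
rewrite subr0; have ph := chid_pdf h12_gt0.
have p1 := chid_pdf (@ltr01 R).
have c0 : 0 <= 4 / (3 * w) by rewrite divr_ge0//; have := w_gt0; lra.
(* [12 / 5] lies just below the upper endpoint [1 + sqrt 2], and beyond it [sqrt t >= 3 / 2]. A
   single dominating density is enough, so the second one gets weight 0. *)
have /(dcdf_tail_le_comb ph p1 p1 c0 (lexx 0)) : forall t, 12 / 5 < t ->
    chid 2^-1 t <= 4 / (3 * w) * chid 1 t + 0 * chid 1 t.
  move=> t ht; have t0 : 0 < t by lra.
  rewrite mul0r addr0 chid_halfE// chid_oneE//.
  have s0 : 0 < Num.sqrt t by rewrite sqrtr_gt0.
  have st : 3 / 2 <= Num.sqrt t.
    have := sqr_sqrtr (ltW t0); rewrite expr2 => h.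
    by rewrite leNgt; apply/negP => h'; nra.
  have -> : 4 / (3 * w) * (expR (- t / 2) / 2) = expR (- t / 2) * (3 / 2 * w)^-1.
    by field; rewrite gt_eqF.
  have w0 := w_gt0; rewrite ler_wpM2l ?expR_ge0// lef_pV2 ?posrE ?ler_pM2r//.
    exact: mulr_gt0.
  by lra.
move=> /le_trans H; have {H} : 1 - dcdf (chid 2^-1) (12 / 5) <= 4 / (3 * w) * expR (- (6 / 5)).
  have y0 : 0 < 12 / 5 :> R by lra.
  have -> : 6 / 5 = 12 / 5 / 2 :> R by lra.
  by apply: H; rewrite mul0r addr0 (dcdf_one y0) opprB [1 + _]addrC subrK.
have u : 12 / 5 <= 1 + r by lra.
have := dcdf_le ph u.
have E : 29 / 10 * expR (- (6 / 5)) <= 1 :> R.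
  by apply: mul_expRN_le1; apply: le_trans (expR_ge_quad _); lra.
have E0 := expR_gt0 (- (6 / 5) : R).
have C : 4 / (3 * w) <= 3 / 5.
  by rewrite ler_pdivrMr; have := gamma_half_norm_ge; lra.
by nra.
Qed.

Lemma chid_within_sd_one : 722 / 1000 <
  dcdf (chid 1) (2 * 1 * (1 + (Num.sqrt 1)^-1)) -
  dcdf (chid 1) (2 * 1 * (1 - (Num.sqrt 1)^-1)) :> R.
Proof.
rewrite sqrtr1 invr1 subrr mulr0 [X in _ - X]dcdf_le0//; last exact: chid_le0.
rewrite subr0 dcdf_one; last by lra.
have -> : 2 * 1 * (1 + 1) / 2 = 2 :> R by lra.
suff : 5 * expR (- 2) <= 1 :> R by lra.
by apply: mul_expRN_le1; apply: le_trans (expR_ge_quad _); lra.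
Qed.

(* The mean inequality [2 c sqrt t <= t + c ^ 2], divided by the normalising constant. *)
Let chid_three_half_le c t : 0 < c ->
  chid (3 / 2) t <= 2 / (c * w) * chid 2 t + c / w * chid 1 t.
Proof.
move=> c0; have [t0|t0] := leP t 0; first by rewrite !chid_le0//; lra.
rewrite chid_three_halfE// chid_oneE// chid_twoE//.
have s0 : 0 < Num.sqrt t by rewrite sqrtr_gt0.
have e0 := expR_gt0 (- t / 2); move: (expR _) e0 => e e0.
have := esym (sqr_sqrtr (ltW t0)); move: (Num.sqrt t) s0 => u u0 ->.
move: w_gt0; move: w => v v0.
rewrite -subr_ge0.
have -> : 2 / (c * v) * (u ^+ 2 * e / 4) + c / v * (e / 2) - u * e / v =
    e / (2 * c * v) * (u - c) ^+ 2.
  by field; rewrite !gt_eqF.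
apply: mulr_ge0; last exact: sqr_ge0.
by rewrite divr_ge0 ?(ltW e0)// !mulr_ge0// ltW.
Qed.

Let three_half_low c y : 0 < c -> 0 < y -> dcdf (chid (3 / 2)) y <=
  2 / (c * w) * (1 - (1 + y / 2) * expR (- (y / 2))) + c / w * (1 - expR (- (y / 2))).
Proof.
move=> c0 y0; have p32 : is_pdf (chid (3 / 2 : R)) by apply: chid_pdf; lra.
have p1 := chid_pdf (@ltr01 R); have p2 := chid_pdf (@ltr0n R 2).
have c1 : 0 <= 2 / (c * w) by apply: divr_ge0 => //; exact: ltW (mulr_gt0 c0 w_gt0).
have c2 : 0 <= c / w by apply: divr_ge0; exact: ltW.
apply: le_trans (dcdf_le_comb p32 p2 p1 c1 c2 (fun t _ => chid_three_half_le t c0)) _.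
by apply: lerD; [rewrite (dcdf_two y0)|rewrite (dcdf_one y0)].
Qed.

Let three_half_tail c y : 0 < c -> 0 < y -> 1 - dcdf (chid (3 / 2)) y <=
  (2 / (c * w) * (1 + y / 2) + c / w) * expR (- (y / 2)).
Proof.
move=> c0 y0; have p32 : is_pdf (chid (3 / 2 : R)) by apply: chid_pdf; lra.
have p1 := chid_pdf (@ltr01 R); have p2 := chid_pdf (@ltr0n R 2).
have c1 : 0 <= 2 / (c * w) by apply: divr_ge0 => //; exact: ltW (mulr_gt0 c0 w_gt0).
have c2 : 0 <= c / w by apply: divr_ge0; exact: ltW.
apply: le_trans (dcdf_tail_le_comb p32 p2 p1 c1 c2 (fun t _ => chid_three_half_le t c0)) _.
rewrite [leRHS]mulrDl -[X in _ <= X + _]mulrA.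
by apply: lerD; [rewrite (dcdf_two y0)|rewrite (dcdf_one y0)]; rewrite opprB addrC subrK.
Qed.

Let three_half_low_num : dcdf (chid (3 / 2)) (552 / 1000) <= 115 / 1000 :> R.
Proof.
(* The mean inequality is sharp at [t = c^2]; [c = 3 / 5] places that point inside the interval of
   integration. *)
have c0 : 0 < 3 / 5 :> R by lra.
have y0 : 0 < 552 / 1000 :> R by lra.
apply: le_trans (three_half_low c0 y0) _.
have -> : 552 / 1000 / 2 = 276 / 1000 :> R by lra.
have := expRN276_ge; move: (expR _) => e e0.
have -> : 2 / (3 / 5 * w) * (1 - (1 + 276 / 1000) * e) + 3 / 5 / w * (1 - e) =
  (10 / 3 * (1 - (1 + 276 / 1000) * e) + 3 / 5 * (1 - e)) / w.
  by field; rewrite gt_eqF.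
by rewrite ler_pdivrMr//; have := gamma_half_norm_ge; lra.
Qed.

Let three_half_tail_num : 1 - dcdf (chid (3 / 2)) (54 / 10) <= 13 / 80 :> R.
Proof.
(* Now [c^2 = 49 / 9] is just above 5.4, where the exponentially decaying tail carries most of its
   mass. *)
have c0 : 0 < 7 / 3 :> R by lra.
have y0 : 0 < 54 / 10 :> R by lra.
apply: le_trans (three_half_tail c0 y0) _.
have -> : 54 / 10 / 2 = 27 / 10 :> R by lra.
have e27 := mul_expRN_le1 expR27_ge.
move: (expR _) e27 => e e27.
have -> : (2 / (7 / 3 * w) * (1 + 27 / 10) + 7 / 3 / w) * e =
  (6 / 7 * (37 / 10 * e) + 7 / 3 * e) / w.
  by field; rewrite gt_eqF.
by rewrite ler_pdivrMr//; have := gamma_half_norm_ge; lra.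
Qed.

(** The masses left out on the two sides are at most 0.115 and 0.1625, in total 0.2775, just under
    the permitted 0.278. *)
Lemma chid_within_sd_three_half a : a = 3 / 2 -> 722 / 1000 <
  dcdf (chid a) (2 * a * (1 + (Num.sqrt a)^-1)) -
  dcdf (chid a) (2 * a * (1 - (Num.sqrt a)^-1)).
Proof.
move=> aE; have a0 : 0 < a by rewrite aE; lra.
have [r0 ar] := inv_sqrtr_sqr a0; have pa := chid_pdf a0.
move: (Num.sqrt a)^-1 r0 ar => r r0; rewrite aE in pa *; move=> ar.
have r8 : 816 / 1000 <= r by rewrite leNgt; apply/negP => h; nra.
have l : 54 / 10 <= 2 * (3 / 2) * (1 + r) by lra.
have u : 2 * (3 / 2) * (1 - r) <= 552 / 1000 by lra.
move: (dcdf_le pa l) (dcdf_le pa u) three_half_low_num three_half_tail_num.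
by lra.
Qed.

(** The tightest of the four cases, but the distribution function is explicit: only the rounding of
    the endpoints and of two exponentials loses anything. *)
Lemma chid_within_sd_two a : a = 2 -> 722 / 1000 <
  dcdf (chid a) (2 * a * (1 + (Num.sqrt a)^-1)) -
  dcdf (chid a) (2 * a * (1 - (Num.sqrt a)^-1)).
Proof.
move=> aE; have a0 : 0 < a by rewrite aE.
have [r0 ar] := inv_sqrtr_sqr a0; have pa := chid_pdf a0.
move: (Num.sqrt a)^-1 r0 ar => r r0; rewrite aE in pa *; move=> ar.
have r7 : 707 / 1000 <= r by rewrite leNgt; apply/negP => h; nra.
have l : 68 / 10 <= 2 * 2 * (1 + r) by lra.
have u : 2 * 2 * (1 - r) <= 1172 / 1000 by lra.
move: (dcdf_le pa l) (dcdf_le pa u).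
rewrite (dcdf_two (y := 68 / 10)) ?(dcdf_two (y := 1172 / 1000)); try lra.
have -> : 68 / 10 / 2 = 34 / 10 :> R by lra.
have -> : 1172 / 1000 / 2 = 586 / 1000 :> R by lra.
have e34 := mul_expRN_le1 expR34_ge.
by move: expRN586_ge e34; lra.
Qed.

End limit_probability.

(** * Combining the cases *)

Section comparison.
Context {R : realType}.
Local Opaque gamma_fun.

Lemma half_degree (m : nat) : m \in [:: 1%N; 2%N; 3%N; 4%N] ->
  [\/ m%:R / 2 = 2^-1 :> R, m%:R / 2 = 1 :> R, m%:R / 2 = 3 / 2 :> R | m%:R / 2 = 2 :> R].
Proof.
rewrite !inE => /or4P[] /eqP ->.
- by apply: Or41; rewrite mul1r.
- by apply: Or42; rewrite divff.
- exact: Or43.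
- by apply: Or44; lra.
Qed.

Lemma chid_within_sd (a : R) : [\/ a = 2^-1, a = 1, a = 3 / 2 | a = 2] ->
  722 / 1000 < dcdf (chid a) (2 * a * (1 + (Num.sqrt a)^-1)) -
               dcdf (chid a) (2 * a * (1 - (Num.sqrt a)^-1)).
Proof.
case=> [|->||].
- exact: chid_within_sd_half.
- exact: chid_within_sd_one.
- exact: chid_within_sd_three_half.
- exact: chid_within_sd_two.
Qed.

Lemma chid_within_sd_le (a b : R) : [\/ a = 2^-1, a = 1, a = 3 / 2 | a = 2] ->
  b = 5 / 2 \/ b = 3 \/ 7 / 2 <= b ->
  dcdf (chid a) (2 * a * (1 + (Num.sqrt a)^-1)) -
  dcdf (chid a) (2 * a * (1 - (Num.sqrt a)^-1)) <=
  dcdf (beta_prime a b) (a / (b - 1) * (1 + fisher_ratio a b)) -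
  dcdf (beta_prime a b) (a / (b - 1) * (1 - fisher_ratio a b)).
Proof.
move=> aE bE.
have b52 : 5 / 2 <= b by case: bE => [->|[->|]] //; lra.
have b2 : 2 < b by lra.
have a0 : 0 < a by case: aE => ->; lra.
apply: lerB.
  case: aE => aE.
  - exact: upper_endpoint_half.
  - by rewrite aE; exact: upper_endpoint_one.
  - exact: upper_endpoint_three_half.
  - exact: upper_endpoint_two.
apply: lower_endpoint => //; case: aE => aE.
- by left; rewrite aE; lra.
- by left; rewrite aE.
- by right; left.
- by right; right.
Qed.

Lemma half_five_or (n : nat) : (5 <= n)%N ->
  n%:R / 2 = 5 / 2 :> R \/ n%:R / 2 = 3 :> R \/ 7 / 2 <= n%:R / 2 :> R.
Proof.
move=> n5; case: (ltngtP n 6) => [n6|n7|->].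
- left; suff -> : n = 5%N by [].
  by apply/eqP; rewrite eqn_leq n5 -ltnS n6.
- by right; right; rewrite ler_pM2r// (ler_nat R 7).
- by right; left; lra.
Qed.

End comparison.

Theorem theorem1p2 (R : realType) (d1 : nat)
    (d1_in : d1 \in [:: 1%N; 2%N; 3%N; 4%N])
    (dX : nat -> measure_display) (TX : forall d2 : nat, measurableType (dX d2))
    (PX : forall d2 : nat, probability (TX d2) R)
    (X : forall d2 : nat, {RV (PX d2) >-> R})
    (lawX : forall d2 : nat, (5 <= d2)%N -> has_law (X d2) (fisher_prob d1 d2))
    (dZ : measure_display) (TZ : measurableType dZ) (PZ : probability TZ R)
    (Z : {RV PZ >-> R}) (lawZ : has_law Z (normal_prob 0 1))
    (dG : measure_display) (TG : measurableType dG) (PG : probability TG R)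
    (G : {RV PG >-> R}) (lawG : has_law G (chi2_prob d1)) :
  (forall d2 : nat, (5 <= d2)%N ->
    (PZ [set t | (`|Z t| <= 1)%R] < prob_within_sd (X d2))%E) /\
  ereal_inf [set prob_within_sd (X d2) | d2 in [set n : nat | (5 <= n)%N]] =
    prob_within_sd G.
Proof.
have m0 : (0 < d1)%N by case: d1 d1_in {lawX lawG}.
have aE := @half_degree R _ d1_in.
pose a : R := d1%:R / 2.
have Xge d2 (n5 : (5 <= d2)%N) : (prob_within_sd G <= prob_within_sd (X d2))%E.
  rewrite (chi2_within_sd m0 lawG) (fisher_within_sd m0 n5 (lawX _ n5)) lee_fin.
  exact: (chid_within_sd_le aE (@half_five_or R _ n5)).
have mA : measurable [set t : R | `|t| <= 1].
  have -> : [set t : R | `|t| <= 1] = `[-1, 1]%classic.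
    by apply/seteqP; split => t /=; rewrite in_itv/= ler_norml.
  exact: measurable_itv.
have ZG : (PZ [set t | (`|Z t| <= 1)%R] < prob_within_sd G)%E.
  have -> : PZ [set t | (`|Z t| <= 1)%R] = normal_prob 0 1 [set t : R | (`|t| <= 1)%R].
    by rewrite -(lawZ _ mA).
  apply: (le_lt_trans normal_prob_within_sd).
  by rewrite (chi2_within_sd m0 lawG) lte_fin; exact: chid_within_sd.
split=> [d2 n5|]; first exact: lt_le_trans ZG (Xge _ n5).
apply/le_anti/andP; split; last first.
  by apply: le_ereal_inf_tmp => _ [d2 /= n5 <-]; exact: Xge.
apply/lee_addgt0Pr => e e0.
pose M := 2 / (2 `^ a * gamma_fun a).
have a0 : 0 < a by rewrite divr_gt0 ?ltr0n.
have M0 : 0 < M by rewrite divr_gt0 ?chid_norm_gt0.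
(* At [b = n / 2] the error is [68 M / (n / 2 - 2) = 136 M / (n - 4)], which is below [e] as soon as
   [n - 6 > 136 M / e]; the summand 6 also secures [b >= 3]. *)
pose n := ((Num.truncn (136 * M / e)).+1 + 6)%N.
have n6 : (6 <= n)%N by rewrite leq_addl.
have n5 : (5 <= n)%N by exact: ltnW.
apply: ge_ereal_inf; exists (prob_within_sd (X n)); first by exists n.
rewrite (chi2_within_sd m0 lawG) (fisher_within_sd m0 n5 (lawX _ n5)) -EFinD lee_fin.
have n6R : 6 <= n%:R :> R by rewrite (ler_nat R 6).
have b3 : 3 <= n%:R / 2 :> R by lra.
have a12 : 2^-1 <= a by rewrite /a; case: aE => ->; lra.
have a2 : a <= 2 by rewrite /a; case: aE => ->; lra.
apply: (le_trans (within_sd_near a12 a2 b3)).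
rewrite lerD2l -/M.
have b2 : 0 < n%:R / 2 - 2 :> R by lra.
rewrite mulrA ler_pdivrMr//.
have : 136 * M / e < n%:R - 6.
  rewrite /n natrD; have := truncnS_gt (136 * M / e); lra.
rewrite ltr_pdivrMr// => h.
have := e0; lra.
Qed.
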